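(* Let $\alpha,K,M>0$ and suppose that the ODE $\dot x=A(t)x$, $x\in\mathbb{R}^n$, with locally integrable coefficient matrix $A$, admits an exponential dichotomy on the whole line $\mathbb{R}$ with exponent $\alpha$ and bound $K$. For $\rho>0$ put $\ell(\alpha,\rho):=Me^{4\alpha\rho}(4KM+\alpha)$. Then there is $r_0>0$ satisfying $\ell(\alpha,r_0)\,r_0<\alpha$ such that for any $\beta\in(0,\alpha-\ell(\alpha,r_0)r_0]$, any $r\in(0,r_0]$ and any kernel $\eta$ that satisfies the standing assumptions in the context with delay $r$ and constants $r_0,M$ and satisfies $\eta(t,\theta)=-A(t)$ for all $\theta\le -r$, $t\in\mathbb{R}$, the delay equation $\dot x(t)=\int_{-r}^0 d_\theta\eta(t,\theta)x(t+\theta)$ admits an exponential dichotomy on the whole line $\mathbb{R}$ with exponent $\beta$.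
   Context: $\mathbb{R}^n$ carries the norm $|\cdot|$ induced by the inner product; $C([-r,0],\mathbb{R}^n)$ is the Banach space of continuous functions with the supremum norm; $x_t(\theta)=x(t+\theta)$ for $\theta\in[-r,0]$. Standing assumptions with delay $r$ and constants $r_0,M$. $\eta$ is an $n\times n$ matrix-valued function on $\mathbb{R}\times\mathbb{R}$ and $L(t)\phi=\int_{-r}^0 d_\theta\eta(t,\theta)\phi(\theta)$ for $\phi\in C([-r,0],\mathbb{R}^n)$, where: $\eta$ is measurable in $(t,\theta)$, continuous from the left in $\theta$ on $(-r,0)$, $\eta(t,\theta)=0$ for $\theta\ge 0$ and $\eta(t,\theta)=\eta(t,-r)$ for $\theta\le -r$; $\eta(t,\cdot)$ has bounded variation on $[-r,0]$ for each $t$; $L(t)\phi$ is measurable in $t$ for each $\phi$; and $\|L(t)\|$ is locally integrable with $\sup_{t\in\mathbb{R}}\frac{1}{r_0}\int_t^{t+r_0}\|L(u)\|\,du\le M<+\infty$. Evolution operators. For $s\in\mathbb{R}$, $\phi\in C([-r,0],\mathbb{R}^n)$ there is a unique continuous $x:[s-r,\infty)\to\mathbb{R}^n$ with $x_s=\phi$, locally absolutely continuous on $[s,\infty)$ and satisfying $\dot x(t)=L(t)x_t$ for a.e. $t\ge s$; set $T(t,s)\phi=x_t$ for $t\ge s$. Exponential dichotomy. The delay equation admits an exponential dichotomy on $\mathbb{R}$ with exponent $\alpha>0$ and bound $K>0$ if there are projections $P(t)$ on $C([-r,0],\mathbb{R}^n)$, $t\in\mathbb{R}$, such that: $T(t,s)P(s)=P(t)T(t,s)$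 for $t\ge s$; $T(t,s)|_{\mathcal{N}(P(s))}$ is an isomorphism from the kernel $\mathcal{N}(P(s))$ onto $\mathcal{N}(P(t))$ for $t\ge s$, with inverse denoted $T(s,t)$; and $\|T(t,s)P(s)\|\le Ke^{-\alpha(t-s)}$ for $t\ge s$, $\|T(t,s)(Id-P(s))\|\le Ke^{-\alpha(s-t)}$ for $s\ge t$. ''With exponent $\beta$'' means with exponent $\beta$ and some bound. For the ODE the definition is the same, with $\mathbb{R}^n$ in place of $C([-r,0],\mathbb{R}^n)$ and the evolution operator of the ODE in place of $T(t,s)$. *)

(* Defs.v *)
From HB Require Import structures.
From mathcomp Require Import all_boot all_order all_algebra.
From mathcomp Require Import all_classical all_reals all_analysis.
From mathcomp Require Import measurable_realfun.
Import Order.TTheory GRing.Theory Num.Theory.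
Import numFieldNormedType.Exports.

Set Implicit Arguments.
Unset Strict Implicit.
Unset Printing Implicit Defensive.

Local Open Scope classical_set_scope.
Local Open Scope ring_scope.

(* The library norm on 'cV[R]_n is the sup norm; it is only used as a source of
   the (equivalent) topology. *)
Definition euclid_norm (R : realType) (n : nat) (v : 'cV[R]_n) : R :=
  Num.sqrt (\sum_(i < n) v i ord0 ^+ 2).

(* Extended-real valued, so that a finite upper bound entails boundedness. *)
Definition op_norm (R : realType) (X Y : Type) (NX : X -> R) (NY : Y -> R)
    (f : X -> Y) : \bar R :=
  ereal_sup [set (NY (f x))%:E | x in [set x | NX x <= 1]].

(* C([-r,0], R^n): a function on [-r,0] is represented by its extension by 0
   to R, so that Leibniz equality is equality on [-r,0]. *)
Section continuous_segments.
Variables (R : realType) (n : nat) (r : R).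

Definition cseg_pred : {pred R -> 'cV[R]_n} :=
  fun f => `[< {within `[- r, 0], continuous f} /\
               (forall th : R, th \notin `[- r, 0] -> f th = 0) >].

Lemma cseg_submod_closed : submod_closed cseg_pred.
Proof.
split.
- apply/asboolP; split => // x; exact: cst_continuous.
- move=> a f g /asboolP[cf f0] /asboolP[cg g0]; apply/asboolP; split.
    by move=> x; exact: (@cvgD _ _ _ (nbhs x) _ (a *: f) g _ _ (cvgZl_tmp (k := a) (cf x)) (cg x)).
  by move=> th hth; rewrite -[LHS]/(a *: f th + g th) f0// g0// scaler0 addr0.
Qed.

HB.instance Definition _ :=
  GRing.isSubmodClosed.Build R (R -> 'cV[R]_n) cseg_pred cseg_submod_closed.

Record cseg := Cseg {
  cseg_fun :> R -> 'cV[R]_n;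
  cseg_funP : cseg_fun \in cseg_pred }.

HB.instance Definition _ := [isSub of cseg for cseg_fun].
HB.instance Definition _ := [Choice of cseg by <:].
HB.instance Definition _ := [SubChoice_isSubLmodule of cseg by <:].

Definition sup_norm (phi : cseg) : R :=
  sup [set euclid_norm (phi th) | th in `[- r, 0]].

End continuous_segments.

(* Riemann-Stieltjes integral of f against a matrix-valued integrator g. A
   partition a = x_0 < x_1 < ... < x_m = b is coded by s = [:: x_1; ...; x_m];
   xi gives the tags. Jumps of g at both endpoints contribute. *)
Section stieltjes.
Variables (R : realType) (n : nat) (a b : R).
Variables (g : R -> 'M[R]_n) (f : R -> 'cV[R]_n).

Definition stieltjes_sum (s : seq R) (xi : nat -> R) : 'cV[R]_n :=
  \sum_(0 <= i < size s)
    (g (nth b (a :: s) i.+1) - g (nth b (a :: s) i)) *m f (xi i).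

Definition is_stieltjes_integral (I : 'cV[R]_n) : Prop :=
  forall e, 0 < e -> exists2 d, 0 < d &
    forall (s : seq R) (xi : nat -> R), itv_partition a b s ->
      (forall i, (i < size s)%N ->
         nth b (a :: s) i.+1 - nth b (a :: s) i < d /\
         nth b (a :: s) i <= xi i <= nth b (a :: s) i.+1) ->
      euclid_norm (stieltjes_sum s xi - I) < e.

Definition stieltjes_integral : 'cV[R]_n :=
  xget 0 [set I | is_stieltjes_integral I].

End stieltjes.

Definition delay_op (R : realType) (n : nat) (r : R) (eta : R -> R -> 'M[R]_n)
    (t : R) (phi : R -> 'cV[R]_n) : 'cV[R]_n :=
  stieltjes_integral (- r) 0 (eta t) phi.

Definition delay_op_norm (R : realType) (n : nat) (r : R)
    (eta : R -> R -> 'M[R]_n) (t : R) : \bar R :=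
  op_norm (@sup_norm R n r) (@euclid_norm R n)
    (fun phi : cseg n r => delay_op r eta t phi).

(* Measurability is in the sense of Lebesgue: the sigma-algebras are completed,
   on R (the domain of [completed_lebesgue_measure]) and on R^2. *)
Section lebesgue_measurability.
Variable R : realType.
Local Notation mu := (@completed_lebesgue_measure R).
Local Notation leb := (@lebesgue_measure R).

Definition lebesgue_measurable_fun (f : R -> R) : Prop :=
  measurable_fun setT
    (f : caratheodory_type (wlength (@idfun R))^*%mu -> R).

Definition lebesgue_measurable_fun2 (f : R -> R -> R) : Prop :=
  measurable_fun setT
    ((fun p => f p.1 p.2)
      : g_sigma_algebraType (completed_algebra_gen (leb \x leb)%E) -> R).

Definition loc_integrable (f : R -> \bar R) : Prop :=
  forall a b : R, mu.-integrable `[a, b] f.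

End lebesgue_measurability.

Definition standing_assumptions (R : realType) (n : nat) (r r0 M : R)
    (eta : R -> R -> 'M[R]_n) : Prop :=
  [/\ forall i j, lebesgue_measurable_fun2 (fun t th => eta t th i j),
      forall t th : R, - r < th < 0 -> eta t x @[x --> th^'-] --> eta t th,
      forall t th : R, 0 <= th -> eta t th = 0,
      forall t th : R, th <= - r -> eta t th = eta t (- r) &
      forall t i j, bounded_variation (- r) 0 (fun th => eta t th i j)] /\
  [/\ forall (phi : cseg n r) i,
        lebesgue_measurable_fun (fun t => delay_op r eta t phi i ord0),
      loc_integrable (delay_op_norm r eta) &
      (ereal_sup (range (fun t : R => (r0^-1)%:E *
         \int[completed_lebesgue_measure]_(u in `[t, (t + r0)%R])
            delay_op_norm r eta u)) <= M%:E)%E].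

Definition abs_continuous (R : realType) (n : nat) (a b : R)
    (x : R -> 'cV[R]_n) : Prop :=
  forall e, 0 < e -> exists2 d, 0 < d &
    forall (m : nat) (u v : 'I_m -> R),
      (forall i, [/\ a <= u i, u i <= v i & v i <= b]) ->
      trivIset setT (fun i => `]u i, v i[%classic) ->
      \sum_i (v i - u i) < d ->
      \sum_i euclid_norm (x (v i) - x (u i)) < e.

Section delay_evolution.
Variables (R : realType) (n : nat) (r : R) (eta : R -> R -> 'M[R]_n).

(* Only the values of x on [s - r, +oo[ are relevant. *)
Definition delay_solution (s : R) (phi : cseg n r) (x : R -> 'cV[R]_n) : Prop :=
  [/\ {within `[s - r, +oo[, continuous x},
      forall th : R, th \in `[- r, 0] -> x (s + th) = phi th,
      forall b, s <= b -> abs_continuous s b x &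
      {ae lebesgue_measure, forall t : R, s <= t ->
         is_derive t (1 : R) x (delay_op r eta t (fun th => x (t + th)))}].

(* T(t,s) phi = x_t, meaningful for s <= t. *)
Definition delay_evolution (t s : R) (phi : cseg n r) : cseg n r :=
  xget 0 [set psi : cseg n r | exists2 x, delay_solution s phi x &
    forall th : R, th \in `[- r, 0] -> psi th = x (t + th)].

End delay_evolution.

Section ode_evolution.
Variables (R : realType) (n : nat) (A : R -> 'M[R]_n).

Definition ode_solution (s : R) (v : 'cV[R]_n) (x : R -> 'cV[R]_n) : Prop :=
  [/\ x s = v,
      forall a b, a <= b -> abs_continuous a b x &
      {ae lebesgue_measure, forall t : R,
         is_derive t (1 : R) x (A t *m x t)}].

Definition ode_evolution (t s : R) (v : 'cV[R]_n) : 'cV[R]_n :=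
  xget 0 [set w | exists2 x, ode_solution s v x & w = x t].

End ode_evolution.

Section dichotomy.
Variables (R : realType) (X : lmodType R) (N : X -> R) (T : R -> R -> X -> X).

Definition null_space (Q : X -> X) : set X := [set x | Q x = 0].

(* T(t,s) for t <= s: the inverse of T(s,t) : N(P(t)) -> N(P(s)); junk when
   T(s,t) is not bijective between the kernels. *)
Definition backward_evolution (P : R -> X -> X) (t s : R) : X -> X :=
  'pinv_(fun=> 0) (null_space (P t)) (T s t).

(* Boundedness of P t is the case s = t of the first estimate. *)
Definition exp_dichotomy (alpha K : R) : Prop :=
  [/\ 0 < alpha, 0 < K & exists P : R -> {linear X -> X},
   [/\ forall t x, P t (P t x) = P t x,
       forall t s, s <= t -> forall x, T t s (P s x) = P t (T t s x),
       forall t s, s <= t ->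
         set_bij (null_space (P s)) (null_space (P t)) (T t s),
       forall t s, s <= t ->
         (op_norm N N (fun x => T t s (P s x)) <=
            (K * expR (- alpha * (t - s))%R)%R%:E)%E &
       forall t s, t <= s ->
         (op_norm N N (fun x => backward_evolution P t s (x - P s x)%R) <=
            (K * expR (- alpha * (s - t))%R)%R%:E)%E]].

End dichotomy.

Definition ell (R : realType) (K M alpha rho : R) : R :=
  M * expR (4 * alpha * rho) * (4 * K * M + alpha).

(* Main.v *)
Require Import Defs.
From HB Require Import structures.
From mathcomp Require Import all_boot all_order all_algebra.
From mathcomp Require Import all_classical all_reals all_analysis.
From mathcomp Require Import measurable_realfun ring lra.
Import Order.TTheory GRing.Theory Num.Theory.
Import numFieldNormedType.Exports.

Set Implicit Arguments.
Unset Strict Implicit.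
Unset Printing Implicit Defensive.

Local Open Scope classical_set_scope.
Local Open Scope ring_scope.

(** On a constant history [c] the delay functional is [L t c = (eta t 0 - eta t (- r)) *m c],
    that is [A t *m c]. So the delay equation is the ordinary differential equation perturbed
    by [L t x_t - A t *m x t], and this defect is at most [|L t|] times the oscillation of
    [x] over one delay. A solution changes over one delay only by the integral of its
    derivative, which the window bound [M * r0] on [|L t|] makes small. Hence feeding a
    function into the defect and solving the ordinary differential equation for the bounded
    response contracts oscillations when [r0] is small.

    The bounded response exists because of the dichotomy: [ode_admissible] constructs it with
    the Green operator, in every norm whose weight varies more slowly than
    [exp (alpha * |t|)], and [bounded_ode_solution_eq0] shows that it is unique. The weights
    [exp (- beta * |t - s|)] retain the decay rate, and [beta <= alpha - ell r0 * r0] is what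
    the contraction requires of them ([contraction_small_delay]). The contraction
    principle [weighted_fixpoint] then turns to the delay equation: it has no bounded solution
    on the line other than 0 ([bounded_delay_solution_eq0]), and for an inhomogeneity that
    decays away from [s] it has a solution that decays away from [s] ([delay_admissible]).

    The dichotomy is read off from these two facts. Cut off the forward solution with history
    [phi] at [s] to the left of [s]; the error made on two windows drives a solution that decays
    in both directions, and adding it yields a solution [z] on the whole line that decays
    backward and differs from the forward solution by a function that decays forward
    ([backward_part_exists]). There is only one such [z], because the difference of two is a
    bounded solution on the line. So [phi |-> phi - z_s] is a linear projection, which commutes
    with the evolution, and the two decay properties are the two estimates of the dichotomy
    ([delay_dichotomy]).

    The analytic prerequisites concern Caratheodory equations with locally integrable
    coefficients: the fundamental theorem of calculus for absolutely continuous functions and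
    the completed Lebesgue measure, Riemann-Stieltjes integrals of continuous functions against
    integrators of bounded variation, the measurability of [t |-> L t x_t], and the existence
    and uniqueness of solutions. With weights that grow at the rate [1 / r0] the integral
    equation is a contraction on the whole half-line ([ivp_exists]), and solving the adjoint
    equation together with the given one produces the fundamental matrices and their inverses
    ([fundamental_matrices]). *)

(** * Lebesgue measurable functions and Borel functions *)


Section lebesgue_interface.
Variable R : realType.
Local Notation leb := (@lebesgue_measure R).
Local Notation cmu := (@completed_lebesgue_measure R).
Local Notation cT := (caratheodory_type (wlength (@idfun R))^*%mu).

Lemma borel_measurable_completed (B : set R) :
  measurable (B : set (measurableTypeR R)) -> measurable (B : set cT).
Proof. by move=> mB; exact: sub_caratheodory. Qed.

Lemma itv_measurable_completed (i : interval R) :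
  measurable ([set` i] : set cT).
Proof. by apply: borel_measurable_completed; exact: measurable_itv. Qed.

Lemma borel_fun_completed (f : R -> R) :
  measurable_fun setT (f : measurableTypeR R -> R) -> lebesgue_measurable_fun f.
Proof.
move=> mf _ Y mY; rewrite setTI; apply: borel_measurable_completed.
by rewrite -[X in measurable X]setTI; exact: mf.
Qed.

(** Each of the countably many rational superlevel sets of [f] agrees with a Borel set
    off a Borel null set. Off the union [N] of these null sets they determine [f], and the
    modification is 0 on [N]. This is how the differentiation theorem for integrals, which
    is about Borel functions, reaches the completed measure. *)
Lemma completed_borel_modification (f : R -> R) : lebesgue_measurable_fun f ->
  exists g : R -> R, measurable_fun setT (g : measurableTypeR R -> R) /\
    exists N : set R, [/\ measurable (N : set (measurableTypeR R)),
      leb N = 0%E & forall x, ~ N x -> f x = g x].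
Proof.
move=> mf.
have pre (q : rat) : exists AF : set R * set R,
    [/\ measurable (AF.1 : set (measurableTypeR R)),
        measurable (AF.2 : set (measurableTypeR R)), leb AF.2 = 0%E &
        forall x, ~ AF.2 x -> AF.1 x <-> ratr q < f x].
  have := mf measurableT `]ratr q, +oo[%classic (measurable_itv _).
  rewrite setTI -completed_caratheodory_measurable g_sigma_completed_algebra_genE.
  move=> [A mA [N [F [mF F0 NF]] AN]]; exists (A, F); split => //= x Fx.
  have -> : (ratr q < f x) = ((f @^-1` `]ratr q, +oo[%classic) x) :> Prop.
    by rewrite /= in_itv /= andbT.
  by rewrite -AN; split => [?|[//|/NF//]]; left.
have [AF hAF] := choice pre.
pose N := \bigcup_q (AF q).2.
have mN : measurable (N : set (measurableTypeR R)).
  by apply: bigcupT_measurable_rat => q; have [] := hAF q.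
have N0 : leb N = 0%E.
  pose F i := if unpickle i is Some q then (AF q).2 else set0.
  have Fq (q : rat) : F (pickle q) = (AF q).2 by rewrite /F pickleK.
  have F0 i : leb.-negligible (F i).
    rewrite /F; case: unpickle => [q|]; last exact: negligible_set0.
    by have [_ m0 z0 _] := hAF q; exact/negligibleP.
  clearbody F; apply/negligibleP => //.
  apply: negligibleS (negligible_bigcup F0) => x [q _ Nqx].
  by exists (pickle q); [exact: I | rewrite Fq].
exists (fun x => if x \in N then 0 else f x); split; last first.
  by exists N; split => // x Nx; case: ifPn => // /set_mem.
apply: (measurability _ (RGenOInfty.measurableE R)) => _ [_ [a ->] <-].
rewrite setTI.
have -> : (fun x => if x \in N then 0 else f x) @^-1` `]a, +oo[ =
   (\bigcup_(q in [set q : rat | a < ratr q]) ((AF q).1 `\` N)) `|`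
   (if a < 0 then N else set0).
  apply/seteqP; split=> x.
    rewrite /= in_itv /= andbT; case: ifPn => [/set_mem Nx a0|/negP Nx].
      by right; rewrite a0.
    move=> /rat_in_itvoo[q]; rewrite in_itv /= => /andP[aq qf]; left.
    exists q => //; split; last by move=> /mem_set.
    by have [_ _ _ -> //] := hAF q => ?; apply: Nx; apply/mem_set; exists q.
  case=> [[q /= aq [Aq Nx]]|] /=; rewrite in_itv /= andbT.
    rewrite memNset//; apply: (lt_trans aq).
    by have [_ _ _ <- //] := hAF q => ?; apply: Nx; exists q.
  by case: ifPn => // a0 Nx; rewrite mem_set.
apply: measurableU; last by case: ifP.
rewrite bigcup_mkcond; apply: bigcupT_measurable_rat => q.
by case: ifPn => // _; apply: measurableD => //; have [] := hAF q.
Qed.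

(** The Lebesgue measure on Borel sets is the image of its completion under the identity,
    so this is the change of variables formula, for the positive and negative parts. *)
Lemma integral_completed (f : R -> R) (D : set R) :
  measurable_fun setT (f : measurableTypeR R -> R) ->
  measurable (D : set (measurableTypeR R)) ->
  (\int[cmu]_(x in D) (f x)%:E = \int[leb]_(x in D) (f x)%:E)%E.
Proof.
move=> mf mD.
have mid : @measurable_fun _ _ cT (measurableTypeR R) setT idfun.
  by move=> _ Y mY; rewrite setTI; exact: borel_measurable_completed.
have pf : pushforward cmu (idfun : cT -> measurableTypeR R) =1 leb.
  by move=> A; rewrite /pushforward preimage_id.
have ge0 (h : R -> \bar R) : (forall x, 0 <= h x)%E ->
    measurable_fun setT (h : measurableTypeR R -> \bar R) ->
    (\int[cmu]_(x in D) h x = \int[leb]_(x in D) h x)%E.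
  move=> h0 mh.
  have := @ge0_integral_pushforward _ _ _ _ _ _ mid cmu D h mD (measurable_funTS mh) (fun y _ => h0 y).
  rewrite preimage_id => <-.
  by apply: eq_measure_integral => A mA _.
rewrite [LHS]integralE [RHS]integralE; congr (_ - _)%E.
  by apply: ge0 => //; apply: measurable_funepos; exact/measurable_EFinP.
by apply: ge0 => //; apply: measurable_funeneg; exact/measurable_EFinP.
Qed.

End lebesgue_interface.

(** * Oriented integrals of locally integrable functions *)


Section local_integrals.
Variable R : realType.
Local Notation leb := (@lebesgue_measure R).
Local Notation cmu := (@completed_lebesgue_measure R).
Local Notation cT := (caratheodory_type (wlength (@idfun R))^*%mu).
Implicit Types (f g h : R -> R) (a b c t : R).

Definition locint f := loc_integrable (fun t => (f t)%:E).

Lemma locint_measurable f : locint f -> lebesgue_measurable_fun f.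
Proof.
move=> lf.
rewrite /lebesgue_measurable_fun; have <- : \bigcup_k `[- k%:R, k%:R]%classic = [set: R].
  apply/seteqP; split=> // x _.
  exists (Num.truncn `|x|).+1 => //; rewrite /= in_itv /= -ler_norml.
  by rewrite ltW// truncnS_gt.
apply/measurable_fun_bigcup => [k|k]; first exact: itv_measurable_completed.
by apply/measurable_EFinP; exact: (measurable_int cmu (lf _ _)).
Qed.

Lemma locint_oc f a b : locint f -> cmu.-integrable `]a, b] (fun t => (f t)%:E).
Proof.
move=> lf; apply: (@integrableS _ _ _ cmu `[a, b]) (lf a b) => //;
  try exact: itv_measurable_completed.
exact: subset_itv_oc_cc.
Qed.

Lemma eq_locint f g : f =1 g -> locint f -> locint g.
Proof. by move=> fg lf; have -> : g = f by apply/funext. Qed.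

Lemma locint_cst c : locint (fun=> c).
Proof.
move=> a b; apply: (@measurable_bounded_integrable _ _ _ cmu (fun=> c)).
- exact: itv_measurable_completed.
- suff : (leb `[a, b] < +oo)%E by [].
  by rewrite lebesgue_measure_itv/=; case: ifP => // _; rewrite ltry.
- exact: measurable_cst.
- by exists `|c|; split => // M cM t _ /=; rewrite ltW.
Qed.

Lemma locintD f g : locint f -> locint g -> locint (fun t => f t + g t).
Proof.
move=> lf lg a b; apply: (@eq_integrable _ _ _ cmu _ _ (fun t => (f t)%:E + (g t)%:E)%E) => //.
  exact: itv_measurable_completed.
by apply: integrableD => //; exact: itv_measurable_completed.
Qed.

Lemma locintZ k f : locint f -> locint (fun t => k * f t).
Proof.
move=> lf a b; apply: (@eq_integrable _ _ _ cmu _ _ (fun t => k%:E * (f t)%:E)%E) => //.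
  exact: itv_measurable_completed.
by apply: integrableZl => //; exact: itv_measurable_completed.
Qed.

Lemma locintN f : locint f -> locint (fun t => - f t).
Proof. by move=> /(locintZ (-1)); apply: eq_locint => t; rewrite mulN1r. Qed.

Lemma locintB f g : locint f -> locint g -> locint (fun t => f t - g t).
Proof. by move=> lf lg; exact: (locintD lf (locintN lg)). Qed.

Lemma locint_sum (I : Type) (s : seq I) (F : I -> R -> R) :
  (forall i, locint (F i)) -> locint (fun t => \sum_(i <- s) F i t).
Proof.
move=> lF; elim: s => [|i s ih].
  by apply: eq_locint (locint_cst 0) => t; rewrite big_nil.
by apply: eq_locint (locintD (lF i) ih) => t; rewrite big_cons.
Qed.

Lemma locint_dominated f g : lebesgue_measurable_fun f -> locint g ->
  (forall t, `|f t| <= g t) -> locint f.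
Proof.
move=> mf lg fg a b.
have mab := @itv_measurable_completed R `[a, b].
apply: (le_integrable mab) (lg a b).
  by apply/measurable_EFinP; exact: measurable_funTS.
by move=> t _; rewrite lee_fin (le_trans (fg t))// ler_norm.
Qed.

Lemma locint_norm f : locint f -> locint (fun t => `|f t|).
Proof.
move=> lf a b.
apply: (@eq_integrable _ _ _ cmu _ _ (fun t => `|(f t)%:E|)%E) => //.
  exact: itv_measurable_completed.
by apply: integrable_abse; exact: lf.
Qed.

Lemma continuous_lebesgue_measurable f : continuous f -> lebesgue_measurable_fun f.
Proof. by move=> cf; apply: borel_fun_completed; exact: continuous_measurable_fun. Qed.

Lemma continuous_bounded_itv f a b : continuous f ->
  exists2 M, 0 <= M & forall t, a <= t <= b -> `|f t| <= M.
Proof.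
move=> cf; have [ab|ba] := leP a b; last first.
  exists 0 => // t /andP[at_ tb].
  by have := le_trans at_ tb; rewrite leNgt ba.
have cn : {within `[a, b], continuous (fun t => `|f t|)}.
  by apply: continuous_subspaceT => t; exact: (continuous_comp (cf t) (@norm_continuous _ R^o _)).
have [c _ hc] := EVT_max ab cn.
by exists `|f c| => // t tab; apply: hc; rewrite in_itv.
Qed.

Lemma locint_mul_continuous f h : continuous h -> locint f ->
  locint (fun t => h t * f t).
Proof.
move=> ch lf a b.
have mab := @itv_measurable_completed R `[a, b].
have [M M0 hM] := continuous_bounded_itv a b ch.
apply: (le_integrable mab) (locintZ M (locint_norm lf) a b).
  apply/measurable_EFinP; apply: measurable_funTS; apply: measurable_funM.
    exact: continuous_lebesgue_measurable.
  exact: locint_measurable.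
move=> t; rewrite /= in_itv/= => tab; rewrite lee_fin !normrM normr_id.
by rewrite ler_wpM2r// (le_trans (hM _ tab))// ler_norm.
Qed.

(** One of the two half-open intervals is empty: this is the integral from [a] to [b] with
    its sign, so that the additivity [oint_cat] holds for points in any order. *)
Definition oint a b f : R :=
  \int[cmu]_(t in `]a, b]) f t - \int[cmu]_(t in `]b, a]) f t.

Lemma oint_le a b f : a <= b -> oint a b f = \int[cmu]_(t in `]a, b]) f t.
Proof.
move=> ab; have e : `]b, a]%classic = set0 by rewrite set_itv_ge// bnd_simp -leNgt.
by rewrite /oint e Rintegral_set0 subr0.
Qed.

Lemma ointC a b f : oint b a f = - oint a b f.
Proof. by rewrite /oint opprB. Qed.

Lemma oint_id a f : oint a a f = 0.
Proof. by rewrite /oint subrr. Qed.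

Lemma oint_cat_le a b c f : locint f -> a <= b -> b <= c ->
  oint a c f = oint a b f + oint b c f.
Proof.
move=> lf ab bc; rewrite !oint_le ?(le_trans ab)//.
have -> : `]a, c]%classic = `]a, b] `|` `]b, c].
  by rewrite -itv_bndbnd_setU ?bnd_simp.
rewrite Rintegral_setU//; try exact: itv_measurable_completed.
  rewrite -itv_bndbnd_setU ?bnd_simp//; exact: locint_oc.
by apply/disj_setPS => x [] /=; rewrite !in_itv/= => /andP[_ xb]; rewrite ltNge xb.
Qed.

Lemma oint_cat a b c f : locint f -> oint a c f = oint a b f + oint b c f.
Proof.
move=> lf.
have key := oint_cat_le lf.
have [ab|/ltW ba] := leP a b; have [bc|/ltW cb] := leP b c;
  have [ac|/ltW ca] := leP a c.
- exact: key.
- have := key _ _ _ bc ca; rewrite (ointC a b) (ointC a c); lra.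
- have := key _ _ _ ac cb; rewrite (ointC c b); lra.
- have := key _ _ _ ca ab; rewrite (ointC c b) (ointC a c); lra.
- have := key _ _ _ ba ac; rewrite (ointC b a) ; lra.
- have := key _ _ _ bc ca; rewrite (ointC b a) (ointC c a); lra.
- have := key _ _ _ ac cb; rewrite (ointC b a) (ointC c b); lra.
- have := key _ _ _ cb ba; rewrite (ointC c b) (ointC b a) (ointC c a); lra.
Qed.

Lemma ointD a b f g : locint f -> locint g ->
  oint a b (fun t => f t + g t) = oint a b f + oint a b g.
Proof.
move=> lf lg; rewrite /oint !RintegralD; first lra.
all: by try exact: itv_measurable_completed; try exact: locint_oc.
Qed.

Lemma ointZ a b k f : locint f -> oint a b (fun t => k * f t) = k * oint a b f.
Proof.
move=> lf; rewrite /oint !RintegralZl ?mulrBr//.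
all: by try exact: itv_measurable_completed; try exact: locint_oc.
Qed.

Lemma ointN a b f : locint f -> oint a b (fun t => - f t) = - oint a b f.
Proof.
move=> lf; rewrite -mulN1r -ointZ//; congr oint; apply/funext => t.
by rewrite mulN1r.
Qed.

Lemma oint_sum (I : Type) (s : seq I) (F : I -> R -> R) a b :
  (forall i, locint (F i)) ->
  oint a b (fun t => \sum_(i <- s) F i t) = \sum_(i <- s) oint a b (F i).
Proof.
move=> lF; elim: s => [|i s ih].
  rewrite big_nil; under [X in oint _ _ X]eq_fun do rewrite big_nil.
  by rewrite /oint !Rintegral_cst ?mul0r ?subrr//; exact: itv_measurable_completed.
rewrite big_cons -ih -ointD//; last exact: locint_sum.
by under [X in oint _ _ X]eq_fun do rewrite big_cons.
Qed.

Lemma le_oint a b f g : a <= b -> locint f -> locint g ->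
  (forall t, a < t <= b -> f t <= g t) -> oint a b f <= oint a b g.
Proof.
move=> ab lf lg fg; rewrite !oint_le//; apply: le_Rintegral.
- exact: itv_measurable_completed.
- exact: locint_oc.
- exact: locint_oc.
- by move=> x; rewrite /= in_itv; exact: fg.
Qed.

Lemma eq_oint a b f g : a <= b ->
  (forall t, a < t <= b -> f t = g t) -> oint a b f = oint a b g.
Proof.
move=> ab fg; rewrite !oint_le//; apply: eq_Rintegral => t.
by rewrite inE /= in_itv; exact: fg.
Qed.

Lemma oint_cst a b c : oint a b (fun=> c) = c * (b - a).
Proof.
wlog ab : a b / a <= b.
  move=> h; have [/h//|/ltW/h e] := leP a b.
  by rewrite ointC e -mulrN opprB.
rewrite oint_le// Rintegral_cst; last exact: itv_measurable_completed.
rewrite [fine _](_ : _ = fine (leb `]a, b]))// lebesgue_measure_itv /= lte_fin.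
case: ltP => //= ba; congr (_ * _); apply/eqP; by rewrite eq_sym subr_eq0 eq_le ab ba.
Qed.

Lemma oint_ge0 a b f : a <= b -> (forall t, a < t <= b -> 0 <= f t) ->
  0 <= oint a b f.
Proof.
move=> ab f0; rewrite oint_le//; apply: Rintegral_ge0 => t /=; rewrite in_itv.
exact: f0.
Qed.

Lemma norm_oint_le a b f g : a <= b -> locint f -> locint g ->
  (forall t, a < t <= b -> `|f t| <= g t) -> `|oint a b f| <= oint a b g.
Proof.
move=> ab lf lg fg; rewrite ler_norml lerNl -ointN//; apply/andP; split.
  apply: le_oint => // [|t /fg]; first exact: locintN.
  by apply: le_trans; rewrite -normrN ler_norm.
by apply: le_oint => // t /fg; apply: le_trans; exact: ler_norm.
Qed.

End local_integrals.

(** * Absolutely continuous functions with zero derivative *)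


Section absolutely_continuous.
Variable R : realType.
Local Notation leb := (@lebesgue_measure R).
Local Notation cmu := (@completed_lebesgue_measure R).
Implicit Types (f g h x : R -> R) (a b c t : R).

Definition real_abs_continuous a b x :=
  forall e, 0 < e -> exists2 d, 0 < d &
    forall (m : nat) (u v : 'I_m -> R),
      (forall i, [/\ a <= u i, u i <= v i & v i <= b]) ->
      trivIset setT (fun i => `]u i, v i[%classic) ->
      \sum_i (v i - u i) < d ->
      \sum_i `|x (v i) - x (u i)| < e.

(** Cousin's covering principle, in the form of an induction along [a, b]: the supremum of
    the points of [a, b] that satisfy [P] satisfies [P] itself, and it cannot lie before
    [b]. *)
Lemma itv_induction a b (P : R -> Prop) : a <= b -> P a ->
  (forall t, a <= t <= b -> exists2 d, 0 < d & forall u v,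
      a <= u -> v <= b -> t - d < u <= t -> t <= v < t + d -> P u -> P v) ->
  P b.
Proof.
move=> ab Pa step.
pose S := [set c | a <= c <= b /\ P c].
have Sa : S a by split; rewrite // lexx.
have Sb : ubound S b by move=> c [/andP[]].
have supS : has_sup S by split; [exists a|exists b].
have aS : a <= sup S by apply: sup_upper_bound.
have Sb' : sup S <= b by apply: ge_sup => //; exists a.
have [d d0 hd] := step (sup S) (introT andP (conj aS Sb')).
have [u [/andP[au ub] Pu] du] := sup_adherent d0 supS.
have uS : u <= sup S by apply: sup_upper_bound => //; split => //; exact/andP.
have uS' : sup S - d < u <= sup S by rewrite du.
have [Sltb|bS] := ltP (sup S) b; last first.
  by apply: (hd u) => //; rewrite Sb' /=; lra.
pose v := Num.min b (sup S + d / 2).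
have Sv : sup S < v by rewrite /v lt_min Sltb/=; lra.
have vd : v < sup S + d.
  by rewrite /v gt_min; apply/orP; right; lra.
have vb : v <= b by rewrite /v ge_min lexx.
have Pv : P v by apply: (hd u) => //; rewrite (ltW Sv).
have : v <= sup S by apply: sup_upper_bound => //; split => //; lra.
by rewrite leNgt Sv.
Qed.

Lemma sum_disjoint_itv_le (m : nat) (u v : nat -> R) (U : set R) :
  measurable U -> (forall i, (i < m)%N -> u i <= v i) ->
  (forall i j, (i < j < m)%N -> v i <= u j) ->
  (forall i, (i < m)%N -> `]u i, v i[ `<=` U) ->
  ((\sum_(i < m) (v i - u i))%:E <= leb U)%E.
Proof.
move=> mU uv vu sU.
pose F i := if (i < m)%N then `]u i, v i[%classic else set0.
have mF i : measurable (F i) by rewrite /F; case: ifP.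
have -> : ((\sum_(i < m) (v i - u i))%:E = \sum_(i < m) leb (F i))%E.
  rewrite -sumEFin; apply: eq_bigr => i _; rewrite /F ltn_ord.
  rewrite lebesgue_measure_itv/= lte_fin; case: ltP => // vui.
  by congr EFin; apply/eqP; rewrite subr_eq0 eq_le vui uv.
have tF : trivIset setT F.
  have lt i j : (i < j)%N -> F i `&` F j = set0.
    move=> ij; rewrite /F; case: ifPn => im; last by rewrite set0I.
    case: ifPn => jm; last by rewrite setI0.
    apply/seteqP; split=> // x [] /=; rewrite !in_itv/= => /andP[_ xv] /andP[ux _].
    have := vu i j; rewrite ij jm => /(_ isT); lra.
  by apply/trivIsetP => i j _ _; rewrite neq_ltn => /orP[/lt//|/lt]; rewrite setIC.
rewrite -measure_bigsetU//; apply: le_measure; rewrite ?inE//.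
  by apply: bigsetU_measurable => i _; exact: mF.
by move=> t; rewrite -bigcup_mkord => -[i /= im]; rewrite /F im; exact: sU.
Qed.

Lemma is_derive0_bound t x : is_derive t (1 : R) x 0 -> forall e, 0 < e ->
  exists2 d, 0 < d & forall u v, t - d < u <= t -> t <= v < t + d ->
    `|x v - x u| <= e * (v - u).
Proof.
move=> [dx Dx] e e0.
have : (h^-1 *: ((x \o shift t) (h *: 1) - x t) @[h --> (0 : R)^']) --> (0 : R).
  by rewrite -[X in _ --> X]Dx; exact: dx.
move=> /cvgrPdist_lt /(_ _ e0) [d /= d0 hd].
have key (k : R) : `|k| < d -> `|x (t + k) - x t| <= e * `|k|.
  have [->|k0] := eqVneq k 0; first by rewrite addr0 subrr normr0 mulr0.
  move=> kd; have := hd k; rewrite /= sub0r normrN => /(_ kd k0).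
  rewrite sub0r normrN normrM normfV mulrC ltr_pdivrMr ?normr_gt0//.
  by rewrite [k%:A]mulr1 [k + t]addrC => /ltW.
exists d => // u v /andP[du ut] /andP[tv vd].
have hv : `|x v - x t| <= e * (v - t).
  have := key (v - t); rewrite subrKC ger0_norm ?subr_ge0// => -> //; lra.
have hu : `|x u - x t| <= e * (t - u).
  have := key (u - t); rewrite subrKC ler0_norm ?subr_le0// opprB => -> //; lra.
have -> : x v - x u = (x v - x t) - (x u - x t) by lra.
apply: (le_trans (ler_normB _ _)); lra.
Qed.

(** Around a point outside the exceptional null set the increments are small by
    differentiability; around the other points they are collected in an open set of
    small measure, where absolute continuity bounds their sum. *)
Lemma abs_continuous_derive0_cst a b x : a <= b -> real_abs_continuous a b x ->
  {ae leb, forall t, a < t < b -> is_derive t (1 : R) x 0} -> x b = x a.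
Proof.
move=> ab acx [N [mN N0 sN]].
apply/eqP; rewrite -subr_eq0 -normr_le0; apply/ler_addgt0Pr => e e0; rewrite add0r.
have e2 : 0 < e / 2 by lra.
have [d d0 hd] := acx _ e2.
pose N' := N `|` [set a; b].
have mab : measurable ([set a; b] : set (measurableTypeR R)).
  by apply: measurableU; exact: measurable_set1.
have ab0 : leb [set a; b] = 0%E.
  by apply: countable_lebesgue_measure0; exact: finite_set_countable.
have mN' : measurable N' by apply: measurableU.
have N'0 : leb N' = 0%E by exact: null_set_setU.
have [U [oU N'U Ud]] : exists U : set R,
    [/\ open U, N' `<=` U & (leb (U `\` N') < d%:E)%E].
  by apply: lebesgue_regularity_outer; [exact: mN'|rewrite [ltLHS]N'0 ltry|exact: d0].
have mU : measurable (U : set (measurableTypeR R)) by exact: open_measurable.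
have {}Ud : (leb U < d%:E)%E.
  rewrite -(setDUK N'U) setUC measureU0//; exact: measurableD.
pose e1 := e / 2 / (b - a + 1).
have b1 : 0 < b - a + 1 by lra.
have e10 : 0 < e1 by rewrite /e1 divr_gt0.
(* [P c]: the increment up to [c] is small, apart from the contributions of finitely many
   disjoint intervals inside [U]. *)
pose P c := exists (m : nat) (u v : nat -> R),
  [/\ forall i, (i < m)%N -> [/\ a <= u i, u i <= v i & v i <= c],
      forall i j, (i < j < m)%N -> v i <= u j,
      forall i, (i < m)%N -> `]u i, v i[ `<=` U &
      `|x c - x a| <= e1 * (c - a) + \sum_(i < m) `|x (v i) - x (u i)|].
have [|t /andP[at_ tb]|m [u [v [uv vu sU hx]]]] := @itv_induction a b P ab.
- exists 0, (fun=> a), (fun=> a); split => //.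
  by rewrite !subrr normr0 mulr0 big_ord0 addr0.
- (* At an exceptional point the interval [p, q] joins the list of intervals; elsewhere the
     list is kept. *)
  have [N't|nN't] := pselect (N' t).
    have [r /= r0 rU] : nbhs t U by exact: open_nbhs_nbhs (conj oU (N'U _ N't)).
    exists r => // p q ap qb /andP[rp pt] /andP[tq qr] [m [u [v [uv vu sU hx]]]].
    exists m.+1, (fun i => if (i < m)%N then u i else p),
                 (fun i => if (i < m)%N then v i else q).
    split.
    + move=> i; rewrite ltnS leq_eqVlt => /orP[/eqP ->|im].
        by rewrite ltnn; split => //; lra.
      by rewrite im; have [? ? ?] := uv _ im; split => //; lra.
    + move=> i j /andP[ij]; rewrite ltnS leq_eqVlt => /orP[/eqP jm|jm].
        by rewrite jm ltnn -jm ij; rewrite jm in ij; have [] := uv _ ij.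
      by rewrite jm (ltn_trans ij jm); apply: vu; rewrite ij.
    + move=> i; rewrite ltnS leq_eqVlt => /orP[/eqP ->|im].
        rewrite ltnn => y; rewrite /= in_itv/= => /andP[py yq].
        by apply: rU => /=; rewrite ltr_distlC; apply/andP; split; lra.
      by rewrite im; exact: sU.
    + rewrite big_ord_recr /= ltnn.
      under eq_bigr do rewrite ltn_ord.
      have -> : x q - x a = (x p - x a) + (x q - x p) by lra.
      apply: (le_trans (ler_normD _ _)).
      have : e1 * (p - a) <= e1 * (q - a) by rewrite ler_pM2l//; lra.
      lra.
  have atb : a < t < b.
    rewrite !lt_neqAle at_ tb !andbT; apply/andP; split; apply/eqP => tE.
      by apply: nN't; right; left.
    by apply: nN't; right; right.
  have Dt : is_derive t (1 : R) x 0.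
    by apply: contrapT => nD; apply: nN't; left; apply: sN => /= Dt; apply: nD; exact: Dt.
  have [r r0 hr] := is_derive0_bound Dt e10.
  exists r => // p q ap qb rp tq [m [u [v [uv vu sU hx]]]].
  exists m, u, v; split => //.
    by move=> i /uv[? ? ?]; split => //; lra.
  have -> : x q - x a = (x p - x a) + (x q - x p) by lra.
  apply: (le_trans (ler_normD _ _)).
  have := hr _ _ rp tq.
  have -> : e1 * (q - a) = e1 * (p - a) + e1 * (q - p) by ring.
  lra.
have sum_lt : \sum_(i < m) `|x (v i) - x (u i)| < e / 2.
  apply: (hd m (fun i => u i) (fun i => v i)).
  - by move=> i; exact: uv.
  - have lt (i j : 'I_m) : (i < j)%N -> `]u i, v i[ `&` `]u j, v j[ = set0.
      move=> ij; apply/seteqP; split=> // y [] /=.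
      rewrite !in_itv/= => /andP[_ yv] /andP[uy _].
      have := vu i j; rewrite ij ltn_ord => /(_ isT); lra.
    apply/trivIsetP => i j _ _.
    by rewrite neq_ltn => /orP[/lt//|/lt]; rewrite setIC.
  - rewrite -lte_fin; apply: le_lt_trans Ud.
    by apply: sum_disjoint_itv_le => // i /uv[].
apply: (le_trans hx).
have : e1 * (b - a) <= e / 2.
  by rewrite /e1 mulrAC ler_pdivrMr// ler_pM2l//; lra.
lra.
Qed.

End absolutely_continuous.

(** * The fundamental theorem of calculus for the completed Lebesgue measure *)


Section fundamental_theorem.
Variable R : realType.
Local Notation leb := (@lebesgue_measure R).
Local Notation cmu := (@completed_lebesgue_measure R).
Local Notation cT := (caratheodory_type (wlength (@idfun R))^*%mu).
Implicit Types (f g h x : R -> R) (a b c t : R).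

Lemma oint_borel_modification f g (N : set R) : locint f ->
  measurable_fun setT (g : measurableTypeR R -> R) ->
  measurable (N : set (measurableTypeR R)) -> leb N = 0%E ->
  (forall t, ~ N t -> f t = g t) ->
  [/\ locint g, forall a b, leb.-integrable `[a, b] (EFin \o g) &
    forall a b, a <= b -> oint a b f = \int[leb]_(t in `]a, b]) g t].
Proof.
move=> lf mg mN N0 fg.
have mfs D : measurable_fun D (fun t : cT => (f t)%:E).
  by apply/measurable_EFinP; apply: measurable_funTS; exact: locint_measurable.
have mgs D : measurable_fun D (fun t : cT => (g t)%:E).
  by apply/measurable_EFinP; apply: measurable_funTS; exact: borel_fun_completed.
have fgae D : ae_eq cmu D (fun t : cT => (f t)%:E) (fun t => (g t)%:E).
  exists N; split; [exact: borel_measurable_completed | exact: N0 |].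
  by move=> t /= h; apply: contrapT => Nt; apply: h => _; rewrite fg.
have lg : locint g.
  move=> a b; have mab := @itv_measurable_completed R `[a, b].
  apply/integrableP; split; first exact: mgs.
  have /integrableP[mfab] := lf a b.
  have mfn : measurable_fun (`[a, b] : set cT) (fun t => `|(f t)%:E|%E).
    exact: measurableT_comp.
  have mgn : measurable_fun (`[a, b] : set cT) (fun t => `|(g t)%:E|%E).
    by apply: measurableT_comp => //; exact: mgs.
  by rewrite (ae_eq_integral _ _ mab mfn mgn (ae_eq_abse (fgae _))).
have lebg a b : leb.-integrable `[a, b] (EFin \o g).
  have mn : measurable_fun setT ((fun t => `|g t|) : measurableTypeR R -> R).
    by apply: measurableT_comp.
  apply/integrableP; split.
    by apply/measurable_EFinP; exact: measurable_funTS.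
  have /integrableP[_] := lg a b.
  by rewrite (integral_completed mn).
split => // a b ab; rewrite oint_le// /Rintegral; congr fine.
rewrite -integral_completed//.
by apply: ae_eq_integral => //; exact: itv_measurable_completed.
Qed.

(** The differentiation theorem applies to a Borel modification of [f], from each base point
    [-n] and to the right of it; changing the base point adds a constant. *)
Lemma ae_is_derive_oint f a : locint f ->
  {ae leb, forall t, is_derive t (1 : R) (fun t => oint a t f) (f t)}.
Proof.
move=> lf.
have FF := ae_filter_ringOfSetsType leb.
have [g [mg [N [mN N0 fg]]]] := completed_borel_modification (locint_measurable lf).
have [lg lebg fgE] := oint_borel_modification lf mg mN N0 fg.
have locg : locally_integrable [set: R] g.
  split => //; first exact: openT.
  move=> K _ cK.
  have [M [_ /(_ (`|M| + 1)) KM]] := compact_bounded cK.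
  have KI : K `<=` `[- (`|M| + 1), `|M| + 1].
    move=> t Kt; rewrite /= in_itv/= -ler_norml; apply: KM => //.
    by rewrite (le_lt_trans (ler_norm M))// ltrDl.
  have mn : measurable_fun setT ((fun t => `|g t|) : measurableTypeR R -> R).
    by apply: measurableT_comp.
  have /integrableP[_] := lebg (- (`|M| + 1)) (`|M| + 1).
  apply: le_lt_trans; apply: ge0_subset_integral => //.
    exact: compact_measurable.
  by apply/measurable_EFinP; exact: measurable_funTS.
have Ng (n : nat) : {ae leb, forall t, - n%:R < t ->
    is_derive t (1 : R) (fun t => oint a t f) (g t)}.
  have gi (y : R) : leb.-integrable [set` Interval (BRight (- n%:R)) (BRight y)] (EFin \o g).
    apply: integrableS (lebg (- n%:R) y) => //; exact: subset_itv_oc_cc.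
  have := FTC1 gi locg; apply: filterS => t ht nt.
  have [|dF DF] := ht; first by rewrite /= lte_fin.
  have cst_d : is_derive t (1 : R) (fun=> oint a (- n%:R) f) 0 by exact: is_derive_cst.
  have F_d : is_derive t (1 : R) (fun s : R => \int[leb]_(t0 in `]- n%:R, s]) g t0) (g t).
    by apply: DeriveDef; [exact: dF | rewrite -derive1E; exact: DF].
  have := is_deriveD cst_d F_d; rewrite add0r; apply: near_eq_is_derive.
  near=> u; rewrite -[LHS]/(_ + _) (@oint_cat _ a (- n%:R) u)//; congr (_ + _).
  rewrite fgE// ltW//; near: u; exact: lt_nbhsr.
have {Ng} : {ae leb, forall t, forall n : nat, - n%:R < t ->
    is_derive t (1 : R) (fun t => oint a t f) (g t)}.
  exact: (@ae_foralln _ _ _ leb (fun n t => - n%:R < t ->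
    is_derive t (1 : R) (fun t => oint a t f) (g t))).
have Nae : {ae leb, forall t, ~ N t}.
  by exists N; split => // t /= /contrapT.
move: Nae; apply: filterS2 => t Nt /(_ (Num.truncn `|t|).+1) ht.
rewrite fg//; apply: ht; rewrite ltrNl.
by rewrite (le_lt_trans _ (truncnS_gt _))// -normrN ler_norm.
Unshelve. all: by end_near. Qed.

(** Absolute continuity of the integral: the integral of [g] over the union of the intervals
    is small as soon as the measure of this union is. *)
Lemma abs_continuous_le n (y : R -> 'cV[R]_n) g a b : locint g ->
  (forall t, 0 <= g t) ->
  (forall u v, a <= u -> u <= v -> v <= b -> euclid_norm (y v - y u) <= oint u v g) ->
  abs_continuous a b y.
Proof.
move=> lg g0 yg e e0.
have mab := @itv_measurable_completed R `[a, b].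
have gi : cmu.-integrable setT (EFin \o (g \_ `[a, b])).
  by rewrite -restrict_EFin; apply: (integrable_mkcond _ mab).1; exact: lg.
have [d [d0 hd]] := integral_normr_continuous gi e0.
exists d => // m u v uv tI sd.
pose F (i : 'I_m) := `]u i, v i]%classic.
have mF i : measurable (F i : set cT) by exact: itv_measurable_completed.
have tF : trivIset setT F.
  apply/trivIsetP => i j _ _ ij; apply/seteqP; split=> // t [] /=.
  rewrite /F /= !in_itv/= => /andP[ui vi] /andP[uj vj].
  move/trivIsetP : tI => /(_ i j I I ij) /seteqP[/(_ ((Num.max (u i) (u j) + t) / 2)) + _].
  have : Num.max (u i) (u j) < t by rewrite gt_max ui.
  have : u i <= Num.max (u i) (u j) by rewrite le_max lexx.
  have : u j <= Num.max (u i) (u j) by rewrite le_max lexx orbT.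
  move: (Num.max _ _) => w w1 w2 w3; apply; split; rewrite /= in_itv/=; apply/andP; split; lra.
pose D := \big[setU/set0]_(i <- index_enum 'I_m) F i.
have mD : measurable (D : set cT) by apply: bigsetU_measurable => i _; exact: mF.
have Dd : (cmu D < d%:E)%E.
  rewrite [ltLHS](measure_bigsetU_ord cmu xpredT mF tF).
  apply: le_lt_trans (_ : ((\sum_i (v i - u i))%:E < d%:E)%E); last by rewrite lte_fin.
  rewrite -sumEFin; apply: lee_sum => i _.
  rewrite [leLHS](_ : _ = leb (F i))// lebesgue_measure_itv/= lte_fin.
  by have [_ uvi _] := uv i; case: ltP => //; rewrite lee_fin subr_ge0.
apply: le_lt_trans (hd D mD Dd).
apply: (@le_trans _ _ (\sum_i oint (u i) (v i) g)).
  by apply: ler_sum => i _; have [au uvi vb] := uv i; exact: yg.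
have FI i : F i `<=` `[a, b].
  move=> t; rewrite /F /= !in_itv/= => /andP[ut tv]; have [au uvi vb] := uv i.
  by apply/andP; split; lra.
rewrite le_eqVlt; apply/orP; left; apply/eqP.
have -> : \int[cmu]_(t in D) `|(g \_ `[a, b]) t| = \int[cmu]_(t in D) g t.
  apply: eq_Rintegral => t /set_mem; rewrite /D -bigcup_seq => -[i /= _ Ft].
  have abt := FI i t Ft; by rewrite patchE mem_set// ger0_norm.
rewrite /Rintegral integral_bigsetU_EFin//.
- rewrite -sum_fine; last first.
    by move=> i _; apply: integrable_fin_num => //; exact: locint_oc.
  by apply: eq_bigr => i _; have [au uvi vb] := uv i; rewrite oint_le.
- exact: index_enum_uniq.
- exact: sub_trivIset tF.
- by apply/measurable_EFinP; apply: measurable_funTS; exact: locint_measurable.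
Qed.

End fundamental_theorem.

(** * The Euclidean norm *)


Section euclidean_norm.
Variables (R : realType) (n : nat).
Implicit Types (v w : 'cV[R]_n) (k : R).
Local Notation N := (@euclid_norm R n).

Let dot v w : R := \sum_i v i ord0 * w i ord0.

Let dotvv_ge0 v : 0 <= dot v v.
Proof. by apply: sumr_ge0 => i _; rewrite -expr2 sqr_ge0. Qed.

Lemma euclid_norm_ge0 v : 0 <= N v.
Proof. exact: sqrtr_ge0. Qed.

Lemma euclid_norm_sqr v : N v ^+ 2 = \sum_i v i ord0 * v i ord0.
Proof.
rewrite /euclid_norm sqr_sqrtr.
  by apply: eq_bigr => i _; rewrite expr2.
by apply: sumr_ge0 => i _; exact: sqr_ge0.
Qed.

Lemma euclid_norm_le v k : 0 <= k ->
  \sum_i v i ord0 * v i ord0 <= k ^+ 2 -> N v <= k.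
Proof. by move=> k0; rewrite -euclid_norm_sqr ler_pXn2r ?nnegrE// euclid_norm_ge0. Qed.

Lemma euclid_norm0 : N 0 = 0.
Proof.
apply/eqP; rewrite eq_le euclid_norm_ge0 andbT; apply: euclid_norm_le => //.
by rewrite big1 ?expr0n// => i _; rewrite mxE mulr0.
Qed.

Lemma coord_le_euclid_norm v i : `|v i ord0| <= N v.
Proof.
rewrite -(@ler_pXn2r _ 2)// ?nnegrE ?euclid_norm_ge0// euclid_norm_sqr.
rewrite real_normK ?num_real// (bigD1 i)//= expr2 lerDl.
by apply: sumr_ge0 => j _; rewrite -expr2 sqr_ge0.
Qed.

Lemma euclid_norm_eq0 v : N v = 0 -> v = 0.
Proof.
move=> v0; apply/colP => i; rewrite mxE; apply/eqP.
by rewrite -normr_le0 -v0 coord_le_euclid_norm.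
Qed.

Lemma euclid_normZ k v : N (k *: v) = `|k| * N v.
Proof.
apply/eqP; rewrite -(@eqrXn2 _ 2)// ?mulr_ge0 ?euclid_norm_ge0//.
rewrite exprMn !euclid_norm_sqr real_normK ?num_real// mulr_sumr; apply/eqP.
by apply: eq_bigr => i _; rewrite !mxE; ring.
Qed.

Lemma euclid_normN v : N (- v) = N v.
Proof. by rewrite -scaleN1r euclid_normZ normrN normr1 mul1r. Qed.

(** Cauchy-Schwarz: the vector [N w *: v - N v *: w] has a nonnegative square. *)
Lemma dot_le_euclid_norm v w : \sum_i v i ord0 * w i ord0 <= N v * N w.
Proof.
rewrite -/(dot v w).
have key (a b : R) : 0 <= a ^+ 2 * dot v v - 2 * a * b * dot v w + b ^+ 2 * dot w w.
  have -> : a ^+ 2 * dot v v - 2 * a * b * dot v w + b ^+ 2 * dot w w =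
    dot (a *: v - b *: w) (a *: v - b *: w).
    rewrite /dot !mulr_sumr -sumrB -big_split/=; apply: eq_bigr => i _.
    by rewrite !mxE; ring.
  exact: dotvv_ge0.
have Nv := euclid_norm_sqr v; have Nw := euclid_norm_sqr w.
rewrite -/(dot _ _) in Nv; rewrite -/(dot _ _) in Nw.
have v0 := euclid_norm_ge0 v; have w0 := euclid_norm_ge0 w.
have [vw|vw] := ltP 0 (N v * N w).
  have := key (N w) (N v); rewrite -Nv -Nw.
  have -> : N w ^+ 2 * N v ^+ 2 - 2 * N w * N v * dot v w + N v ^+ 2 * N w ^+ 2 =
     (N v * N w) * (2 * (N v * N w - dot v w)) by ring.
  rewrite pmulr_rge0// => ?; lra.
have : N v * N w = 0 by apply/eqP; rewrite eq_le vw mulr_ge0.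
move=> /eqP; rewrite mulf_eq0 => /orP[]/eqP/euclid_norm_eq0 e.
  by rewrite /dot big1 ?mulr_ge0// => i _; rewrite e mxE mul0r.
by rewrite /dot big1 ?mulr_ge0// => i _; rewrite e mxE mulr0.
Qed.

Lemma ler_euclid_normD v w : N (v + w) <= N v + N w.
Proof.
apply: euclid_norm_le; first by rewrite addr_ge0 ?euclid_norm_ge0.
have := dot_le_euclid_norm v w.
have -> : \sum_i (v + w) i ord0 * (v + w) i ord0 =
    N v ^+ 2 + N w ^+ 2 + 2 * \sum_i v i ord0 * w i ord0.
  rewrite !euclid_norm_sqr mulr_sumr -!big_split/=; apply: eq_bigr => i _.
  by rewrite !mxE; ring.
by rewrite sqrrD -mulr_natr; lra.
Qed.

Lemma ler_euclid_normB v w : N (v - w) <= N v + N w.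
Proof. by rewrite -(euclid_normN w) ler_euclid_normD. Qed.

Lemma euclid_distC v w : N (v - w) = N (w - v).
Proof. by rewrite -euclid_normN opprB. Qed.

Lemma ler_euclid_dist v w : N v - N w <= N (v - w).
Proof. by have := ler_euclid_normD (v - w) w; rewrite subrK; lra. Qed.

Lemma euclid_norm_le_sum v : N v <= \sum_i `|v i ord0|.
Proof.
have S0 : 0 <= \sum_i `|v i ord0| by exact: sumr_ge0.
apply: euclid_norm_le => //; rewrite expr2 mulr_suml; apply: ler_sum => i _.
rewrite (le_trans (ler_norm _))// normrM ler_wpM2l//.
by rewrite (bigD1 i)//= lerDl sumr_ge0.
Qed.

Lemma euclid_norm_le_coord v k : (forall i, `|v i ord0| <= k) -> N v <= n%:R * k.
Proof.
move=> vk; apply: (le_trans (euclid_norm_le_sum v)).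
apply: (@le_trans _ _ (\sum_(i < n) k)); first exact: ler_sum.
by rewrite sumr_const card_ord mulr_natl.
Qed.

Lemma norm_le_euclid_norm v : `|v| <= N v.
Proof.
rewrite [`|v|]mx_normrE; apply/bigmax_leP; split; first exact: euclid_norm_ge0.
by move=> [i j] _ /=; rewrite (ord1 j); exact: coord_le_euclid_norm.
Qed.

Lemma euclid_norm_le_norm v : N v <= n%:R * `|v|.
Proof.
apply: euclid_norm_le_coord => i.
rewrite [`|v|]mx_normrE; exact: (le_bigmax _ (fun ij => `|v ij.1 ij.2|) (i, ord0)).
Qed.

Lemma cvg_euclid_norm (T : Type) (F : set_system T) (FF : Filter F) (f : T -> 'cV[R]_n) (l : 'cV[R]_n) :
  (f @ F --> l) <-> (forall e, 0 < e -> \forall x \near F, N (f x - l) < e).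
Proof.
split=> [/cvgrPdist_lt h e e0|h].
  have n1 : 0 < n%:R + 1 :> R by rewrite ltr_wpDl.
  have := h _ (divr_gt0 e0 n1); apply: filterS => x.
  rewrite ltr_pdivlMr// distrC => hx; apply: le_lt_trans (euclid_norm_le_norm _) _.
  apply: le_lt_trans hx; rewrite mulrC ler_wpM2l//; lra.
apply/cvgrPdist_lt => e e0; apply: filterS (h _ e0) => x.
by apply: le_lt_trans; rewrite distrC norm_le_euclid_norm.
Qed.

Lemma continuous_euclid (y : R -> 'cV[R]_n) (t : R) : {for t, continuous y} <->
  (forall e, 0 < e -> exists2 d, 0 < d & forall s, `|s - t| < d -> N (y s - y t) < e).
Proof.
split=> [/cvg_euclid_norm h e e0|h].
  have [d /= d0 hd] := h e e0; exists d => // s st; apply: hd => /=.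
  by rewrite distrC.
apply/cvg_euclid_norm => e e0; have [d d0 hd] := h e e0.
by exists d => // s /=; rewrite distrC; exact: hd.
Qed.

Lemma continuous_euclid_norm (y : R -> 'cV[R]_n) : continuous y ->
  continuous (fun t => N (y t)).
Proof.
move=> cy t; apply/cvgrPdist_lt => e e0.
have /continuous_euclid/(_ e e0)[d d0 hd] := cy t.
exists d => // s /=; rewrite distrC => /hd; apply: le_lt_trans.
rewrite ler_norml; have := ler_euclid_dist (y s) (y t).
by have := ler_euclid_dist (y t) (y s); rewrite (euclid_distC (y t)); lra.
Qed.

Lemma continuous_coord (y : R -> 'cV[R]_n) i : continuous y ->
  continuous (fun t => y t i ord0).
Proof.
move=> cy t; apply/cvgrPdist_lt => e e0.
have /continuous_euclid/(_ e e0)[d d0 hd] := cy t.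
exists d => // s /=; rewrite distrC => /hd; apply: le_lt_trans.
by rewrite distrC; have := coord_le_euclid_norm (y s - y t) i; rewrite !mxE.
Qed.

Lemma coord_continuous_euclid (y : R -> 'cV[R]_n) :
  (forall i, continuous (fun t => y t i ord0)) -> continuous y.
Proof.
move=> cy t; apply/cvg_euclid_norm => e e0.
have n1 : 0 < n%:R + 1 :> R by rewrite ltr_wpDl.
have en := divr_gt0 e0 n1.
have : \forall s \near t, forall i, `|y s i ord0 - y t i ord0| < e / (n%:R + 1).
  apply: (@filter_forall R _ (fun i s => `|y s i ord0 - y t i ord0| < e / (n%:R + 1)) (nbhs t) (nbhs_filter t)) => i.
  have /cvgrPdist_lt/(_ _ en) := cy i t.
  by apply: filterS => s; rewrite distrC.
apply: filterS => s hs.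
apply: (@le_lt_trans _ _ (n%:R * (e / (n%:R + 1)))).
  by apply: euclid_norm_le_coord => i; rewrite !mxE ltW.
by rewrite mulrA ltr_pdivrMr// mulrC ltr_pM2l//; lra.
Qed.

End euclidean_norm.

(** * Integrals of vector-valued functions *)


Section vector_integrals.
Variables (R : realType) (n : nat).
Local Notation leb := (@lebesgue_measure R).
Implicit Types (f g : R -> 'cV[R]_n) (a b c t : R).
Local Notation N := (@euclid_norm R n).

Definition vlocint f := forall i, locint (fun t => f t i ord0).

Definition vint a b f : 'cV[R]_n := \col_i oint a b (fun t => f t i ord0).

Lemma vlocint_sum_norm f : vlocint f -> locint (fun t => \sum_i `|f t i ord0|).
Proof. by move=> lf; apply: locint_sum => i; exact: locint_norm. Qed.

Lemma vlocintD f g : vlocint f -> vlocint g -> vlocint (fun t => f t + g t).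
Proof. by move=> lf lg i; apply: eq_locint (locintD (lf i) (lg i)) => t; rewrite mxE. Qed.

Lemma vlocintZ k f : vlocint f -> vlocint (fun t => k *: f t).
Proof. by move=> lf i; apply: eq_locint (locintZ k (lf i)) => t; rewrite mxE. Qed.

Lemma vlocintB f g : vlocint f -> vlocint g -> vlocint (fun t => f t - g t).
Proof. by move=> lf lg i; apply: eq_locint (locintB (lf i) (lg i)) => t; rewrite !mxE. Qed.

Lemma vint_cat a b c f : vlocint f -> vint a c f = vint a b f + vint b c f.
Proof. by move=> lf; apply/colP => i; rewrite !mxE; exact: oint_cat. Qed.

Lemma vint_id a f : vint a a f = 0.
Proof. by apply/colP => i; rewrite !mxE oint_id. Qed.

Lemma vintC a b f : vint b a f = - vint a b f.
Proof. by apply/colP => i; rewrite !mxE ointC. Qed.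

Lemma vintD a b f g : vlocint f -> vlocint g ->
  vint a b (fun t => f t + g t) = vint a b f + vint a b g.
Proof.
move=> lf lg; apply/colP => i; rewrite !mxE -ointD//.
by congr oint; apply/funext => t; rewrite mxE.
Qed.

Lemma vintZ a b k f : vlocint f -> vint a b (fun t => k *: f t) = k *: vint a b f.
Proof.
move=> lf; apply/colP => i; rewrite !mxE -ointZ//.
by congr oint; apply/funext => t; rewrite mxE.
Qed.

Lemma vintB a b f g : vlocint f -> vlocint g ->
  vint a b (fun t => f t - g t) = vint a b f - vint a b g.
Proof.
move=> lf lg; rewrite vintD//; last first.
  by move=> i; apply: eq_locint (locintN (lg i)) => t; rewrite mxE.
congr (_ + _); rewrite -scaleN1r -vintZ//; congr vint; apply/funext => t.
by rewrite scaleN1r.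
Qed.

Lemma eq_vint a b f g : a <= b ->
  (forall t, a < t <= b -> f t = g t) -> vint a b f = vint a b g.
Proof. by move=> ab fg; apply/colP => i; rewrite !mxE; apply: eq_oint => // t /fg ->. Qed.

(** The inner product of the integral [v] with itself is the integral of the inner products
    of [v] with the values of [f], hence at most [N v * oint a b g]. Estimating coordinate by
    coordinate would cost a factor that depends on [n], and the contraction condition on the
    delay has no room for it. *)
Lemma norm_vint_le a b f (g : R -> R) : a <= b -> vlocint f -> locint g ->
  (forall t, a < t <= b -> N (f t) <= g t) -> N (vint a b f) <= oint a b g.
Proof.
move=> ab lf lg fg.
have I0 : 0 <= oint a b g.
  by apply: oint_ge0 => // t /fg; apply: le_trans; exact: euclid_norm_ge0.
set v := vint a b f.
have : N v ^+ 2 <= N v * oint a b g.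
  rewrite euclid_norm_sqr.
  have -> : \sum_i v i ord0 * v i ord0 =
      oint a b (fun t => \sum_i v i ord0 * f t i ord0).
    rewrite oint_sum => [|i]; last exact: locintZ.
    by apply: eq_bigr => i _; rewrite ointZ//; congr (_ * _); rewrite mxE.
  rewrite -ointZ//; apply: le_oint => //.
  - by apply: locint_sum => i; exact: locintZ.
  - exact: locintZ.
  move=> t tab; apply: (le_trans (dot_le_euclid_norm _ _)).
  by rewrite ler_wpM2l ?euclid_norm_ge0// fg.
have := euclid_norm_ge0 v; rewrite le_eqVlt => /predU1P[<-//|v0].
by rewrite expr2 ler_pM2l.
Qed.

Lemma vlocint_mulmx p (B : 'M[R]_(p, n)) f i :
  vlocint f -> locint (fun t => (B *m f t) i ord0).
Proof.
move=> lf.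
apply: (@eq_locint _ (fun t => \sum_j B i j * f t j ord0)).
  by move=> t; rewrite mxE.
by apply: locint_sum => j; exact: locintZ.
Qed.

Lemma abs_continuous_continuous_within a b (y : R -> 'cV[R]_n) :
  abs_continuous a b y -> forall t e, a <= t <= b -> 0 < e ->
  exists2 d, 0 < d & forall s, a <= s <= b -> `|s - t| < d -> N (y s - y t) < e.
Proof.
move=> acy t e /andP[at_ tb] e0; have [d d0 hd] := acy e e0; exists d => // s /andP[as_ sb] st.
have tI (u v : 'I_1 -> R) : trivIset setT (fun i => `]u i, v i[%classic).
  by apply/trivIsetP => i j; rewrite (ord1 i) (ord1 j).
have [ts|/ltW ts] := leP t s.
  have := hd 1%N (fun=> t) (fun=> s); rewrite !big_ord1; apply => //.
  by rewrite -[ltLHS]ger0_norm ?subr_ge0.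
have := hd 1%N (fun=> s) (fun=> t); rewrite !big_ord1 euclid_distC; apply => //.
by rewrite -[ltLHS]ger0_norm ?subr_ge0// distrC.
Qed.

Lemma abs_continuous_coord a b (y : R -> 'cV[R]_n) i : abs_continuous a b y ->
  real_abs_continuous a b (fun t => y t i ord0).
Proof.
move=> acy e e0; have [d d0 hd] := acy e e0; exists d => // m u v uv tI sd.
apply: le_lt_trans (hd m u v uv tI sd); apply: ler_sum => j _.
by have := coord_le_euclid_norm (y (v j) - y (u j)) i; rewrite !mxE.
Qed.

Lemma abs_continuous_vint a b (y : R -> 'cV[R]_n) f : vlocint f ->
  (forall u v, a <= u -> u <= v -> v <= b -> y v - y u = vint u v f) ->
  abs_continuous a b y.
Proof.
move=> lf yf; apply: (abs_continuous_le (vlocint_sum_norm lf)).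
  by move=> t; exact: sumr_ge0.
move=> u v au uv vb; rewrite yf//; apply: norm_vint_le => //.
  exact: vlocint_sum_norm.
by move=> t _; exact: euclid_norm_le_sum.
Qed.

Lemma is_derive_coord (t : R) (y : R -> 'cV[R]_n) (v : 'cV[R]_n) :
  is_derive t (1 : R) y v <->
  forall i, is_derive t (1 : R) (fun t => y t i ord0) (v i ord0).
Proof.
split=> [[dy Dy] i|h].
  have /derivable_mxP/(_ i ord0) dyi := dy.
  by apply: DeriveDef => //; rewrite -Dy derive_mx// mxE.
have dy : derivable y t 1.
  by apply/derivable_mxP => i j; rewrite (ord1 j); have [] := h i.
apply: DeriveDef => //; rewrite derive_mx//; apply/colP => i; rewrite mxE.
by have [] := h i.
Qed.

Lemma ae_is_derive_vint a f : vlocint f ->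
  {ae leb, forall t, is_derive t (1 : R) (fun t => vint a t f) (f t)}.
Proof.
move=> lf.
have FF := ae_filter_ringOfSetsType leb.
have : {ae leb, forall t, forall i,
    is_derive t (1 : R) (fun t => oint a t (fun t => f t i ord0)) (f t i ord0)}.
  by apply: (@filter_forall R _ (fun i t => is_derive t (1 : R)
    (fun t => oint a t (fun t => f t i ord0)) (f t i ord0)) (almost_everywhere leb) FF) => i;
   exact: ae_is_derive_oint.
apply: filterS => t h; apply/is_derive_coord => i.
by have := h i; congr (is_derive _ _ _ _); apply/funext => s; rewrite mxE.
Qed.

End vector_integrals.

(** * Uniform continuity and Darboux integrals against a monotone integrator *)


Section uniform_continuity.
Variables (R : realType) (n : nat).

Definition unif_cont_on (a b : R) (f : R -> 'cV[R]_n) := forall e, 0 < e ->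
  exists2 d, 0 < d & forall x y, a <= x <= b -> a <= y <= b -> `|x - y| < d ->
    euclid_norm (f x - f y) < e.

Lemma continuous_unif_cont_on a b f : continuous f -> unif_cont_on a b f.
Proof.
move=> cf e e0; have [ba|ab] := ltP b a.
  by exists 1 => // x y /andP[ax xb]; have := le_trans ax xb; rewrite leNgt ba.
have e2 : 0 < e / 2 by lra.
apply: (@itv_induction R a b (fun c => exists2 d, 0 < d & forall x y,
  a <= x <= c -> a <= y <= c -> `|x - y| < d -> euclid_norm (f x - f y) < e)) => //.
  exists 1 => // x y /andP[ax xa] /andP[ay ya] _.
  have -> : x = a by apply/eqP; rewrite eq_le xa.
  have -> : y = a by apply/eqP; rewrite eq_le ya.
  by rewrite subrr euclid_norm0.
move=> t tab; have /continuous_euclid/(_ _ e2)[r r0 hr] := cf t.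
have close x y : `|x - t| < r -> `|y - t| < r -> euclid_norm (f x - f y) < e.
  move=> /hr hx /hr hy; have -> : f x - f y = (f x - f t) - (f y - f t).
    by rewrite opprB addrA subrK.
  apply: (le_lt_trans (ler_euclid_normB _ _)); lra.
exists (r / 2); first lra.
move=> u v au vb ut tv [d d0 hd]; exists (Num.min d (r / 2)).
  by rewrite lt_min d0; lra.
have wl x y : a <= x <= v -> a <= y <= v -> x <= y -> y - x < Num.min d (r / 2) ->
    euclid_norm (f x - f y) < e.
  move=> xv yv xy; rewrite lt_min => /andP[xd xr].
  have [yu|uy] := leP y u.
    apply: hd; [lra|lra|]; by rewrite distrC ger0_norm; lra.
  by apply: close; rewrite ltr_norml; lra.
move=> x y xv yv; have [xy|/ltW yx] := leP x y.
  by rewrite distrC ger0_norm ?subr_ge0//; exact: wl.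
by rewrite euclid_distC ger0_norm ?subr_ge0//; exact: wl.
Qed.

End uniform_continuity.

Section monotone_integrator.
Variable R : realType.
Variables (f g : R -> R).

(** The values of lower Darboux sums of [f] against [g]. They are generated by concatenation
    from single intervals, so that joining two sums is a constructor and cutting one at a
    point is an induction, with no bookkeeping of partitions. *)
Inductive lower_sum : R -> R -> R -> Prop :=
| lower_sum_step c d m : c <= d -> (forall x, c <= x <= d -> m <= f x) ->
    lower_sum c d (m * (g d - g c))
| lower_sum_cat c d e v w : lower_sum c d v -> lower_sum d e w ->
    lower_sum c e (v + w).

Lemma lower_sum_itv c d v : lower_sum c d v -> c <= d.
Proof. by elim=> // {}c {}d e {}v w _ cd _ de; exact: le_trans de. Qed.

Variables (a b : R).
Hypothesis g_mono : forall x y, a <= x -> x <= y -> y <= b -> g x <= g y.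
Variables (B : R).
Hypothesis f_bound : forall x, a <= x <= b -> `|f x| <= B.

Lemma lower_sum_le c d v M : lower_sum c d v -> a <= c -> d <= b ->
  (forall x, c <= x <= d -> f x <= M) -> v <= M * (g d - g c).
Proof.
elim=> [{}c {}d m cd mf ac db fM|{}c {}d e {}v w sv ihv sw ihw ac eb fM].
  rewrite ler_wpM2r ?subr_ge0 ?g_mono// (le_trans (mf c _)) ?fM ?lexx//.
have cd := lower_sum_itv sv; have de := lower_sum_itv sw.
have -> : M * (g e - g c) = M * (g d - g c) + M * (g e - g d) by ring.
apply: lerD; [apply: ihv => //|apply: ihw => //].
- exact: le_trans eb.
- by move=> x /andP[cx xd]; rewrite fM// cx (le_trans xd).
- exact: le_trans cd.
- by move=> x /andP[dx xe]; rewrite fM// xe andbT (le_trans cd).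
Qed.

Definition darboux c d := sup [set v | lower_sum c d v].

Lemma darboux_has_sup c d : a <= c -> c <= d -> d <= b ->
  has_sup [set v | lower_sum c d v].
Proof.
move=> ac cd db; have fB x : c <= x <= d -> `|f x| <= B.
  by move=> /andP[cx xd]; rewrite f_bound// (le_trans ac)//= (le_trans xd).
split.
  exists (- B * (g d - g c)); apply: lower_sum_step => // x /fB.
  by rewrite ler_norml => /andP[].
exists (B * (g d - g c)) => v sv; apply: (lower_sum_le sv) => // x /fB.
by rewrite ler_norml => /andP[].
Qed.

Lemma darboux_le c d M : a <= c -> c <= d -> d <= b ->
  (forall x, c <= x <= d -> f x <= M) -> darboux c d <= M * (g d - g c).
Proof.
move=> ac cd db fM; apply: ge_sup; first by have [] := darboux_has_sup ac cd db.
by move=> v sv; exact: lower_sum_le.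
Qed.

Lemma darboux_ge c d m : a <= c -> c <= d -> d <= b ->
  (forall x, c <= x <= d -> m <= f x) -> m * (g d - g c) <= darboux c d.
Proof.
move=> ac cd db mf; apply: sup_upper_bound; first exact: darboux_has_sup.
exact: lower_sum_step.
Qed.

Lemma lower_sum_split c e v d : lower_sum c e v -> c <= d -> d <= e ->
  exists v1 v2, [/\ lower_sum c d v1, lower_sum d e v2 & v = v1 + v2].
Proof.
move=> s; elim: s d => [{}c {}e m ce mf d cd de|{}c p {}e {}v w sv ihv sw ihw d cd de].
  exists (m * (g d - g c)), (m * (g e - g d)); split; last ring.
    by apply: lower_sum_step => // x /andP[cx xd]; rewrite mf// cx (le_trans xd).
  by apply: lower_sum_step => // x /andP[dx xe]; rewrite mf// xe (le_trans cd).
have [dp|/ltW pd] := leP d p.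
  have [v1 [v2 [s1 s2 ->]]] := ihv d cd dp; exists v1, (v2 + w).
  by rewrite addrA; split => //; exact: lower_sum_cat sw.
have [v1 [v2 [s1 s2 ->]]] := ihw d pd de; exists (v + v1), v2.
by rewrite addrA; split => //; exact: lower_sum_cat s1.
Qed.

Lemma darboux_cat c d e : a <= c -> c <= d -> d <= e -> e <= b ->
  darboux c e = darboux c d + darboux d e.
Proof.
move=> ac cd de eb.
have hce := darboux_has_sup ac (le_trans cd de) eb.
have hcd := darboux_has_sup ac cd (le_trans de eb).
have hde := darboux_has_sup (le_trans ac cd) de eb.
apply/eqP; rewrite eq_le; apply/andP; split.
  apply: ge_sup; first by case: hce.
  move=> v /lower_sum_split/(_ cd de)[v1 [v2 [s1 s2 ->]]].
  by apply: lerD; apply: sup_upper_bound.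
rewrite -lerBrDr; apply: ge_sup; first by case: hcd.
move=> v sv; rewrite lerBrDr addrC -lerBrDr; apply: ge_sup; first by case: hde.
move=> w sw; rewrite lerBrDr addrC; apply: sup_upper_bound => //.
exact: lower_sum_cat sw.
Qed.

Lemma darboux_bound : a <= b -> `|darboux a b| <= B * (g b - g a).
Proof.
move=> ab; rewrite ler_norml darboux_le// ?andbT; last first.
  by move=> x /f_bound; rewrite ler_norml => /andP[].
by rewrite -mulNr darboux_ge// => x /f_bound; rewrite ler_norml => /andP[].
Qed.

(** Since the Darboux integral is additive, one interval of the partition can be treated at
    a time. There both terms lie between [(f (xi 0) - e) * (g p - g c)] and
    [(f (xi 0) + e) * (g p - g c)]. *)
Lemma darboux_riemann_sum e d : 0 <= e ->
  (forall x y, a <= x <= b -> a <= y <= b -> `|x - y| < d -> `|f x - f y| <= e) ->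
  forall (s : seq R) c (xi : nat -> R), a <= c -> itv_partition c b s ->
   (forall i, (i < size s)%N ->
         nth b (c :: s) i.+1 - nth b (c :: s) i < d /\
         nth b (c :: s) i <= xi i <= nth b (c :: s) i.+1) ->
   `|\sum_(0 <= i < size s) (g (nth b (c :: s) i.+1) - g (nth b (c :: s) i)) * f (xi i)
      - darboux c b| <= e * (g b - g c).
Proof.
move=> e0 unif; elim=> [|p s ih] c xi ac part hxi.
  have -> : c = b by move: part => -[_ /= /eqP].
  have h0 x : f x * (g b - g b) = 0 by rewrite subrr mulr0.
  have cb : c = b by move: part => -[_ /= /eqP].
  have -> : darboux b b = 0.
    apply/eqP; rewrite eq_le -(h0 b) darboux_ge ?darboux_le ?lexx//.
    + by rewrite -cb.
    + by move=> x /andP[? ?]; have -> : x = b by apply/eqP; rewrite eq_le; apply/andP.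
    + by rewrite -cb.
    + by move=> x /andP[? ?]; have -> : x = b by apply/eqP; rewrite eq_le; apply/andP.
  by rewrite big_geq// !subrr normr0 mulr0.
have [/andP[cp ps] lastb] := part.
have part' : itv_partition p b s by split.
have pb : p <= b by exact: itv_partition_le part'.
have ap : a <= p by rewrite (le_trans ac)// ltW.
rewrite /= big_nat_recl//=.
rewrite (darboux_cat ac (ltW cp) pb)//.
have := ih p (xi \o succn) ap part' (fun i => hxi i.+1).
have [/= pc /andP[cx xp]] := hxi 0%N isT.
have cpg : 0 <= g p - g c by rewrite subr_ge0 g_mono// ltW.
have near_ x : c <= x <= p -> `|f (xi 0%N) - f x| <= e.
  move=> /andP[? ?]; apply: unif; [lra|lra|]; rewrite ltr_norml; lra.
have : `|(g p - g c) * f (xi 0%N) - darboux c p| <= e * (g p - g c).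
  rewrite ler_norml; apply/andP; split.
    have : darboux c p <= (f (xi 0%N) + e) * (g p - g c).
      apply: darboux_le => // [|x /near_]; first exact: ltW.
      rewrite ler_norml; lra.
    rewrite mulrDl; lra.
  have : (f (xi 0%N) - e) * (g p - g c) <= darboux c p.
    apply: darboux_ge => // [|x /near_]; first exact: ltW.
    rewrite ler_norml; lra.
  rewrite mulrBl; lra.
move=> h1 h2.
have -> : e * (g b - g c) = e * (g p - g c) + e * (g b - g p) by ring.
set S := \sum_(_ <= _ < _) _ in h2 *.
have -> : (g p - g c) * f (xi 0%N) + S - (darboux c p + darboux p b) =
   ((g p - g c) * f (xi 0%N) - darboux c p) + (S - darboux p b) by ring.
by apply: (le_trans (ler_normD _ _)); exact: lerD.
Qed.

End monotone_integrator.

(** * The Riemann-Stieltjes integral of a continuous function *)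


Lemma choice2 (I J Y : Type) (P : I -> J -> Y -> Prop) :
  (forall i j, exists y, P i j y) -> exists f, forall i j, P i j (f i j).
Proof.
move=> h; have h' i := choice (h i).
by exists (fun i => projT1 (h' i)) => i; exact: (projT2 (h' i)).
Qed.

Section stieltjes_integral_theory.
Variables (R : realType).
Variables (a b : R) (ab : a < b).

Lemma jordan_decomposition (g : R -> R) : bounded_variation a b g ->
  exists pq : (R -> R) * (R -> R),
    [/\ forall x y, a <= x -> x <= y -> y <= b -> pq.1 x <= pq.1 y,
        forall x y, a <= x -> x <= y -> y <= b -> pq.2 x <= pq.2 y &
        forall x, a <= x <= b -> g x = pq.1 x - pq.2 x].
Proof.
move=> bvg; exists (fine \o pos_tv a g, fine \o neg_tv a g).
have mono (h : R -> R) : bounded_variation a b h ->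
    forall x y, a <= x -> x <= y -> y <= b -> fine (neg_tv a h x) <= fine (neg_tv a h y).
  move=> bvh x y ax xy yb; apply: (fine_neg_tv_nondecreasing bvh) => //.
    by rewrite in_itv/= ax (le_trans xy).
  by rewrite in_itv/= yb (le_trans ax).
split => /= [||x axb].
- exact: (mono _ (bounded_variationN bvg)).
- exact: mono.
- by have := bounded_variation_pos_neg_tvE bvg; apply; rewrite in_itv.
Qed.

Lemma itv_partition_nth_itv (s : seq R) i : itv_partition a b s -> (i <= size s)%N ->
  a <= nth b (a :: s) i <= b.
Proof. by move=> part im; rewrite itv_partition_nth_ge ?itv_partition_nth_le. Qed.

Definition scalar_integrand (f : R -> R) B :=
  (forall e, 0 < e -> exists2 d, 0 < d & forall x y, a <= x <= b -> a <= y <= b ->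
     `|x - y| < d -> `|f x - f y| < e) /\
  (forall x, a <= x <= b -> `|f x| <= B).

Definition is_scalar_stieltjes (g f : R -> R) I := forall e, 0 < e ->
  exists2 d, 0 < d & forall (s : seq R) (xi : nat -> R), itv_partition a b s ->
    (forall i, (i < size s)%N ->
       nth b (a :: s) i.+1 - nth b (a :: s) i < d /\
       nth b (a :: s) i <= xi i <= nth b (a :: s) i.+1) ->
    `|\sum_(0 <= i < size s)
        (g (nth b (a :: s) i.+1) - g (nth b (a :: s) i)) * f (xi i) - I| < e.

(** An integrator of bounded variation is a difference of two nondecreasing functions;
    [C] is the sum of their increments over [a, b]. *)
Lemma scalar_stieltjes_exists (g : R -> R) : bounded_variation a b g ->
  exists2 C, 0 <= C & forall (f : R -> R) B, scalar_integrand f B ->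
    exists2 I, `|I| <= C * B & is_scalar_stieltjes g f I.
Proof.
move=> /jordan_decomposition[[p q] /= [pm qm gE]].
have V0 : 0 <= (p b - p a) + (q b - q a).
  by rewrite addr_ge0// subr_ge0 ?pm ?qm ?lexx// ltW.
exists ((p b - p a) + (q b - q a)) => // f B [unif fB].
exists (darboux f p a b - darboux f q a b).
  apply: (le_trans (ler_normB _ _)); rewrite mulrDl [X in _ <= X + _]mulrC [X in _ <= _ + X]mulrC.
  by apply: lerD; apply: darboux_bound => //; exact: ltW.
move=> e e0; pose e1 := e / ((p b - p a) + (q b - q a) + 1).
have V1 : 0 < (p b - p a) + (q b - q a) + 1 by lra.
have e10 : 0 < e1 by rewrite divr_gt0.
have [d d0 hd] := unif _ e10; exists d => // s xi part hxi.
have hd' x y : a <= x <= b -> a <= y <= b -> `|x - y| < d -> `|f x - f y| <= e1.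
  by move=> ax ay xy; rewrite ltW// hd.
have hp := darboux_riemann_sum pm fB (ltW e10) hd' (lexx a) part hxi.
have hq := darboux_riemann_sum qm fB (ltW e10) hd' (lexx a) part hxi.
have -> : \sum_(0 <= i < size s)
    (g (nth b (a :: s) i.+1) - g (nth b (a :: s) i)) * f (xi i) =
  \sum_(0 <= i < size s) (p (nth b (a :: s) i.+1) - p (nth b (a :: s) i)) * f (xi i) -
  \sum_(0 <= i < size s) (q (nth b (a :: s) i.+1) - q (nth b (a :: s) i)) * f (xi i).
  rewrite -sumrB; apply: eq_big_nat => i /andP[_ im].
  rewrite (gE (nth b (a :: s) i.+1)) ?(gE (nth b (a :: s) i)); first ring.
    by apply: itv_partition_nth_itv => //; exact: ltnW.
  exact: itv_partition_nth_itv.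
set Sp := \sum_(_ <= _ < _) _ in hp *; set Sq := \sum_(_ <= _ < _) _ in hq *.
have -> : Sp - Sq - (darboux f p a b - darboux f q a b) =
  (Sp - darboux f p a b) - (Sq - darboux f q a b) by ring.
apply: (le_lt_trans (ler_normB _ _)).
have : e1 * (p b - p a + (q b - q a)) < e.
  by rewrite /e1 mulrAC ltr_pdivrMr// ltr_pM2l//; lra.
rewrite mulrDr; lra.
Qed.

Variable n : nat.
Implicit Types (G : R -> 'M[R]_n) (f : R -> 'cV[R]_n).

(** Entry by entry, from the scalar case. The bound [C] shows that the functional
    [f |-> I] has a finite operator norm. *)
Lemma stieltjes_exists G : (forall i j, bounded_variation a b (fun x => G x i j)) ->
  exists2 C, 0 <= C & forall f B, unif_cont_on a b f ->
    (forall x, a <= x <= b -> euclid_norm (f x) <= B) ->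
    exists2 I, euclid_norm I <= C * B & is_stieltjes_integral a b G f I.
Proof.
move=> bvG.
have ex1 (i j : 'I_n) : exists C : R, 0 <= C /\ forall (f : R -> R) B,
    scalar_integrand f B ->
    exists2 I, `|I| <= C * B & is_scalar_stieltjes (fun x => G x i j) f I.
  by have [C C0 hC] := scalar_stieltjes_exists (bvG i j); exists C.
have [C hC] := choice2 ex1.
exists (\sum_i \sum_j C i j).
  by apply: sumr_ge0 => i _; apply: sumr_ge0 => j _; have [] := hC i j.
move=> f B unif fB.
have fj (j : 'I_n) : scalar_integrand (fun x => f x j ord0) B.
  split=> [e e0|x axb]; last exact: le_trans (coord_le_euclid_norm _ _) (fB x axb).
  have [d d0 hd] := unif e e0; exists d => // x y ax ay xy.
  apply: le_lt_trans (hd x y ax ay xy).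
  by have := coord_le_euclid_norm (f x - f y) j; rewrite !mxE.
have ex2 (i j : 'I_n) : exists I : R, `|I| <= C i j * B /\
    is_scalar_stieltjes (fun x => G x i j) (fun x => f x j ord0) I.
  by have [_ /(_ _ _ (fj j))[I hI1 hI2]] := hC i j; exists I.
have [I hI] := choice2 ex2.
exists (\col_i \sum_j I i j).
  apply: (le_trans (euclid_norm_le_sum _)); rewrite mulr_suml; apply: ler_sum => i _.
  rewrite mxE mulr_suml; apply: (le_trans (ler_norm_sum _ _ _)).
  by apply: ler_sum => j _; have [] := hI i j.
move=> e e0; pose e1 := e / ((n * n)%:R + 1).
have V1 : 0 < (n * n)%:R + 1 :> R by rewrite ltr_wpDl.
have e10 : 0 < e1 by rewrite divr_gt0.
have ex3 (i j : 'I_n) : exists d : R, 0 < d /\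
      forall (s : seq R) (xi : nat -> R), itv_partition a b s ->
      (forall k, (k < size s)%N ->
         nth b (a :: s) k.+1 - nth b (a :: s) k < d /\
         nth b (a :: s) k <= xi k <= nth b (a :: s) k.+1) ->
      `|\sum_(0 <= k < size s)
          (G (nth b (a :: s) k.+1) i j - G (nth b (a :: s) k) i j) * f (xi k) j ord0 - I i j| < e1.
  by have [_ /(_ _ e10)[d d0 hd]] := hI i j; exists d.
have [d hd] := choice2 ex3.
pose dm := \big[Num.min/1]_(ij : 'I_n * 'I_n) d ij.1 ij.2.
exists dm.
  by apply: lt_bigmin => // -[i j] _ /=; have [] := hd i j.
move=> s xi part hxi.
have dmd i j : dm <= d i j.
  exact: (@bigmin_le _ _ _ 1 (i, j) (fun ij => d ij.1 ij.2)).
have small i j : `|\sum_(0 <= k < size s)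
   (G (nth b (a :: s) k.+1) i j - G (nth b (a :: s) k) i j) * f (xi k) j ord0 - I i j| <= e1.
  have [_ h] := hd i j; apply/ltW/h => // k ks; have [h1 h2] := hxi k ks; split => //.
  exact: lt_le_trans (dmd i j).
apply: (le_lt_trans (euclid_norm_le_sum _)).
apply: (@le_lt_trans _ _ ((n * n)%:R * e1)); last first.
  by rewrite /e1 mulrA ltr_pdivrMr// mulrC ltr_pM2l//; lra.
apply: (@le_trans _ _ (\sum_(i < n) \sum_(j < n) e1)); last first.
  by rewrite !sumr_const !card_ord -mulrnA mulr_natl.
apply: ler_sum => i _.
have -> : (stieltjes_sum a b G f s xi - \col_i0 (\sum_j I i0 j)) i ord0 =
  \sum_j (\sum_(0 <= k < size s)
   (G (nth b (a :: s) k.+1) i j - G (nth b (a :: s) k) i j) * f (xi k) j ord0 - I i j).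
  rewrite sumrB !mxE; congr (_ - _).
  rewrite /stieltjes_sum summxE exchange_big/=; apply: eq_bigr => k _.
  by rewrite mxE; apply: eq_bigr => j _; rewrite !mxE.
by apply: (le_trans (ler_norm_sum _ _ _)); exact: ler_sum.
Qed.

Lemma fine_partition d : 0 < d -> exists s : seq R, itv_partition a b s /\
  forall i, (i < size s)%N -> 0 <= nth b (a :: s) i.+1 - nth b (a :: s) i < d.
Proof.
move=> d0.
have key : forall (k : nat) c, c < b -> b - c <= k%:R * (d / 2) ->
   exists s : seq R, itv_partition c b s /\
  forall i, (i < size s)%N -> 0 <= nth b (c :: s) i.+1 - nth b (c :: s) i < d.
  elim=> [|k ih] c cb; first by rewrite mul0r; lra.
  rewrite -natr1 mulrDl mul1r => bk.
  have [bd|db] := ltP (b - c) d.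
    exists [:: b]; split; first exact: itv_partition1.
    by case=> //= _; rewrite subr_ge0 ltW.
  have [||s [[ps ls] hs]] := ih (c + d / 2); [lra|lra|].
  exists (c + d / 2 :: s); split.
    by split => //=; rewrite ps andbT; lra.
  by case=> [_ /=|i /hs//]; lra.
pose k := (Num.truncn ((b - a) / (d / 2))).+1.
apply: (key k) => //; rewrite -ler_pdivrMr; last lra.
by rewrite ltW// truncnS_gt.
Qed.

(** Two integrals are approximated by a common sum, as arbitrarily fine partitions exist. *)
Lemma stieltjes_integral_unique G f I J :
  is_stieltjes_integral a b G f I -> is_stieltjes_integral a b G f J -> I = J.
Proof.
move=> hI hJ; apply/eqP; rewrite -subr_eq0; apply/eqP/euclid_norm_eq0/eqP.
rewrite eq_le euclid_norm_ge0 andbT; apply/ler_addgt0Pr => e e0; rewrite add0r.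
have e2 : 0 < e / 2 by lra.
have [d1 d10 h1] := hI _ e2; have [d2 d20 h2] := hJ _ e2.
have d0 : 0 < Num.min d1 d2 by rewrite lt_min d10.
have [s [part hs]] := fine_partition d0.
pose xi i := nth b (a :: s) i.
have h1' := h1 s xi part; have h2' := h2 s xi part.
have -> : I - J = (stieltjes_sum a b G f s xi - J) - (stieltjes_sum a b G f s xi - I).
  by rewrite opprB [RHS]addrC addrA subrK.
apply: (le_trans (ler_euclid_normB _ _)).
have := h1' _; have := h2' _.
have A i : (i < size s)%N -> nth b (a :: s) i <= xi i <= nth b (a :: s) i.+1.
  by move=> /hs; rewrite /xi lexx/=; lra.
have k1 : euclid_norm (stieltjes_sum a b G f s xi - I) < e / 2.
  apply: h1' => i im; split; last exact: A.
  by have /andP[_] := hs i im; rewrite lt_min => /andP[].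
have k2 : euclid_norm (stieltjes_sum a b G f s xi - J) < e / 2.
  apply: h2' => i im; split; last exact: A.
  by have /andP[_] := hs i im; rewrite lt_min => /andP[].
lra.
Qed.

Lemma is_stieltjes_integralP G k f g I J :
  is_stieltjes_integral a b G f I -> is_stieltjes_integral a b G g J ->
  is_stieltjes_integral a b G (fun x => k *: f x + g x) (k *: I + J).
Proof.
move=> hI hJ e e0; have e1 : 0 < e / 2 / (`|k| + 1).
  by apply: divr_gt0; [lra|rewrite ltr_wpDl].
have e2 : 0 < e / 2 by lra.
have [d1 d10 h1] := hI _ e1; have [d2 d20 h2] := hJ _ e2.
exists (Num.min d1 d2); first by rewrite lt_min d10.
move=> s xi part hs.
have -> : stieltjes_sum a b G (fun x => k *: f x + g x) s xi - (k *: I + J) =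
   k *: (stieltjes_sum a b G f s xi - I) + (stieltjes_sum a b G g s xi - J).
  rewrite scalerBr addrACA -opprD; congr (_ - _).
  rewrite /stieltjes_sum scaler_sumr -big_split/=; apply: eq_bigr => i _.
  by rewrite mulmxDr scalemxAr.
apply: (le_lt_trans (ler_euclid_normD _ _)); rewrite euclid_normZ.
have {}h1 : euclid_norm (stieltjes_sum a b G f s xi - I) < e / 2 / (`|k| + 1).
  by apply: h1 => // i /hs[]; rewrite lt_min => /andP[].
have {}h2 : euclid_norm (stieltjes_sum a b G g s xi - J) < e / 2.
  by apply: h2 => // i /hs[]; rewrite lt_min => /andP[].
have k1 : 0 < `|k| + 1 by rewrite ltr_wpDl.
have : `|k| * euclid_norm (stieltjes_sum a b G f s xi - I) <= e / 2.
  move: h1; rewrite ltr_pdivlMr// => /ltW; apply: le_trans.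
  by rewrite mulrC ler_wpM2l ?euclid_norm_ge0//; lra.
lra.
Qed.

Lemma is_stieltjes_integral_cst G c :
  is_stieltjes_integral a b G (fun=> c) ((G b - G a) *m c).
Proof.
move=> e e0; exists 1 => // s xi part _.
suff -> : stieltjes_sum a b G (fun=> c) s xi = (G b - G a) *m c.
  by rewrite subrr euclid_norm0.
rewrite /stieltjes_sum -mulmx_suml telescope_sumr//.
by rewrite (itv_partition_nth_size b part).
Qed.

Lemma eq_is_stieltjes_integral G f g I : (forall x, a <= x <= b -> f x = g x) ->
  is_stieltjes_integral a b G f I -> is_stieltjes_integral a b G g I.
Proof.
move=> fg hI e e0; have [d d0 hd] := hI e e0; exists d => // s xi part hs.
have -> : stieltjes_sum a b G g s xi = stieltjes_sum a b G f s xi.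
  apply: eq_big_nat => i /andP[_ im]; rewrite fg//.
  have [_ /andP[h1 h2]] := hs i im.
  have := itv_partition_nth_itv part im; have := itv_partition_nth_itv part (ltnW im).
  by move=> /andP[h3 _] /andP[_ h4]; rewrite (le_trans h3 h1) (le_trans h2 h4).
exact: hd.
Qed.

Lemma stieltjes_integralE G f I : is_stieltjes_integral a b G f I ->
  stieltjes_integral a b G f = I.
Proof.
move=> hI; apply: (@stieltjes_integral_unique G f) => //.
exact: (@xgetPex _ 0 [set I | is_stieltjes_integral a b G f I] (ex_intro _ I hI)).
Qed.

End stieltjes_integral_theory.

(** * Histories and the delay operator *)


Section segments.
Variables (R : realType) (n : nat) (r : R).
Hypothesis r_gt0 : 0 < r.
Local Notation N := (@euclid_norm R n).
Implicit Types (phi psi : cseg n r) (y : R -> 'cV[R]_n).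

Lemma mem_seg th : (th \in `[- r, 0]) = (- r <= th <= 0).
Proof. by rewrite in_itv. Qed.

Lemma segment_exists y : continuous y ->
  exists phi : cseg n r, forall th, - r <= th <= 0 -> phi th = y th.
Proof.
move=> cy; pose f th := if th \in `[- r, 0] then y th else 0.
have fP : f \in @cseg_pred R n r.
  apply/asboolP; split.
    apply: (@subspace_eq_continuous _ _ _ y); last exact: continuous_subspaceT.
    by move=> th /set_mem /= hth; rewrite /from_subspace /f /= hth.
  by move=> th; rewrite /f => /negbTE ->.
by exists (Cseg fP) => th hth; rewrite /= /f mem_seg hth.
Qed.

(** The retraction of the line onto [- r, 0]. Composing with it turns a history, which jumps
    to 0 outside [- r, 0], into a continuous function on the line. *)
Definition clamp (t : R) := Num.max (- r) (Num.min t 0).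

Lemma clamp_itv t : - r <= clamp t <= 0.
Proof. by rewrite /clamp le_max lexx /= ge_max ge_min lexx orbT andbT oppr_le0 ltW. Qed.

Lemma clamp_id t : - r <= t <= 0 -> clamp t = t.
Proof. by move=> /andP[t1 t2]; rewrite /clamp (min_idPl t2) (max_idPr t1). Qed.

Lemma clamp_dist s t : `|clamp s - clamp t| <= `|s - t|.
Proof.
rewrite ler_norml /clamp !maxEle !minEle.
have := ler_norm (s - t); have := ler_norm (t - s); rewrite (distrC t).
by do ! case: ifPn => [|/negP/negP]; rewrite -?ltNge; lra.
Qed.

Lemma cseg_continuous_clamp phi : continuous (phi \o clamp).
Proof.
move=> t; apply/continuous_euclid => e e0.
have /asboolP[cphi _] := cseg_funP phi.
have /subspace_continuousP := cphi => /(_ (clamp t)) /=.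
have ht := clamp_itv t; rewrite in_itv => /(_ ht)/cvg_euclid_norm.
move=> /(_ e e0); rewrite near_withinE => -[d /= d0 hd].
exists d => // s st; apply: hd; last by rewrite in_itv clamp_itv.
by rewrite /= distrC (le_lt_trans (clamp_dist _ _)).
Qed.

Lemma segP phi psi : (forall th, - r <= th <= 0 -> phi th = psi th) -> phi = psi.
Proof.
move=> h; apply/val_inj/funext => th /=.
have [/h//|hth] := boolP (- r <= th <= 0).
have /asboolP[_ p0] := cseg_funP phi; have /asboolP[_ q0] := cseg_funP psi.
by rewrite p0 ?q0// mem_seg.
Qed.

Lemma segZ k phi th : (k *: phi) th = k *: phi th.
Proof. by []. Qed.

Lemma seg0 th : (0 : cseg n r) th = 0.
Proof. by []. Qed.

Let nonempty phi : [set N (phi th) | th in `[- r, 0]] !=set0.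
Proof. by exists (N (phi 0)), 0 => //=; rewrite in_itv/= lexx oppr_le0 ltW. Qed.

Lemma sup_norm_le phi B : (forall th, - r <= th <= 0 -> N (phi th) <= B) ->
  sup_norm phi <= B.
Proof.
by move=> h; apply: ge_sup => // _ [th /= hth <-]; apply: h; rewrite in_itv in hth.
Qed.

Lemma le_sup_norm phi th : - r <= th <= 0 -> N (phi th) <= sup_norm phi.
Proof.
move=> hth; apply: sup_upper_bound; last first.
  by exists th => //=; rewrite in_itv.
split => //.
have [M M0 hM] := continuous_bounded_itv (- r) 0
  (continuous_euclid_norm (@cseg_continuous_clamp phi)).
exists M => _ [s /= hs <-]; rewrite in_itv/= in hs.
have := hM s hs; rewrite /= clamp_id//; apply: le_trans; exact: ler_norm.
Qed.

Lemma sup_norm_ge0 phi : 0 <= sup_norm phi.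
Proof.
apply: le_trans (euclid_norm_ge0 (phi 0)) _; apply: le_sup_norm.
by rewrite lexx oppr_le0 ltW.
Qed.

End segments.

Section delay_operator.
Variables (R : realType) (n : nat) (r : R) (eta : R -> R -> 'M[R]_n).
Hypothesis r_gt0 : 0 < r.
Hypothesis eta_bv : forall t i j, bounded_variation (- r) 0 (fun th => eta t th i j).
Local Notation N := (@euclid_norm R n).
Implicit Types (f g y : R -> 'cV[R]_n).

Let r_lt0 : - r < 0. Proof. by rewrite oppr_lt0. Qed.

Let max_norm f : continuous f ->
  exists2 B, 0 <= B & forall th, - r <= th <= 0 -> N (f th) <= B.
Proof.
move=> cf; have [B B0 hB] := continuous_bounded_itv (- r) 0 (continuous_euclid_norm cf).
by exists B => // th /hB; apply: le_trans; exact: ler_norm.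
Qed.

Lemma delay_opP t f : continuous f ->
  is_stieltjes_integral (- r) 0 (eta t) f (delay_op r eta t f).
Proof.
move=> cf; have [C C0 hC] := stieltjes_exists r_lt0 (eta_bv t).
have [B B0 hB] := max_norm cf.
have [I _ hI] := hC f B (continuous_unif_cont_on (- r) 0 cf) hB.
by rewrite /delay_op (stieltjes_integralE r_lt0 hI).
Qed.

Lemma eq_delay_op t f g : continuous f -> (forall th, - r <= th <= 0 -> f th = g th) ->
  delay_op r eta t g = delay_op r eta t f.
Proof.
move=> cf fg; apply: stieltjes_integralE => //.
by apply: eq_is_stieltjes_integral fg _; exact: delay_opP.
Qed.

Lemma delay_op_linear t k f g : continuous f -> continuous g ->
  delay_op r eta t (fun th => k *: f th + g th) =
  k *: delay_op r eta t f + delay_op r eta t g.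
Proof.
move=> cf cg; apply: stieltjes_integralE => //.
by apply: is_stieltjes_integralP; exact: delay_opP.
Qed.

Lemma delay_op_cst t c : delay_op r eta t (fun=> c) = (eta t 0 - eta t (- r)) *m c.
Proof. by apply: stieltjes_integralE => //; exact: is_stieltjes_integral_cst. Qed.

Lemma delay_op_cseg t (phi : cseg n r) :
  delay_op r eta t phi = delay_op r eta t (phi \o @clamp R r).
Proof.
apply: eq_delay_op; first exact: cseg_continuous_clamp.
by move=> th hth; rewrite /= clamp_id.
Qed.

Lemma delay_op_norm_fin_num t : (delay_op_norm r eta t \is a fin_num)%E.
Proof.
have [C C0 hC] := stieltjes_exists r_lt0 (eta_bv t).
have h (phi : cseg n r) : sup_norm phi <= 1 -> N (delay_op r eta t phi) <= C.
  move=> phi1; rewrite delay_op_cseg.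
  have cphi := cseg_continuous_clamp r_gt0 (phi := phi).
  have [|I NI hI] := hC (phi \o @clamp R r) 1 (continuous_unif_cont_on (- r) 0 cphi).
    move=> th hth; apply: le_trans phi1; apply: le_sup_norm => //; exact: clamp_itv.
  by rewrite /delay_op (stieltjes_integralE r_lt0 hI); rewrite mulr1 in NI.
rewrite ge0_fin_numE.
  apply: (@le_lt_trans _ _ C%:E); last by rewrite ltry.
  by apply: ge_ereal_sup => _ [phi /= /h hphi <-]; rewrite lee_fin.
apply: (@le_trans _ _ (N (delay_op r eta t (0 : cseg n r)))%:E).
  by rewrite lee_fin euclid_norm_ge0.
apply: ereal_sup_ubound; exists 0 => //=.
by apply: sup_norm_le => // th _; rewrite seg0 euclid_norm0.
Qed.

Definition delay_bound t : R := fine (delay_op_norm r eta t).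

Lemma delay_bound_ge0 t : 0 <= delay_bound t.
Proof.
rewrite fine_ge0//; apply: (@le_trans _ _ (N (delay_op r eta t (0 : cseg n r)))%:E).
  by rewrite lee_fin euclid_norm_ge0.
apply: ereal_sup_ubound; exists 0 => //=.
by apply: sup_norm_le => // th _; rewrite seg0 euclid_norm0.
Qed.

(** Division by [B] moves the history into the unit ball that defines the operator norm; for
    [B = 0] the history vanishes. *)
Lemma delay_op_le t f B : continuous f -> (forall th, - r <= th <= 0 -> N (f th) <= B) ->
  N (delay_op r eta t f) <= delay_bound t * B.
Proof.
move=> cf fB.
have B0 : 0 <= B.
  by apply: le_trans (euclid_norm_ge0 (f 0)) (fB _ _); rewrite lexx oppr_le0 ltW.
move: B0; rewrite le_eqVlt => /predU1P[B0|B0].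
  have f0 th : - r <= th <= 0 -> 0 = f th.
    move=> /fB; rewrite -B0 => h; apply/esym/euclid_norm_eq0/eqP.
    by rewrite eq_le h euclid_norm_ge0.
  have c0 : continuous (fun _ : R => 0 : 'cV[R]_n) by move=> x; exact: cvg_cst.
  by rewrite (eq_delay_op t c0 f0) delay_op_cst mulmx0 euclid_norm0 -B0 mulr0.
have [phi hphi] := segment_exists r cf.
have e1 : delay_op r eta t phi = delay_op r eta t f.
  by apply: eq_delay_op => // th hth; rewrite hphi.
have cphi := cseg_continuous_clamp r_gt0 (phi := phi).
have c0 : continuous (fun _ : R => 0 : 'cV[R]_n) by move=> x; exact: cvg_cst.
have e2 : delay_op r eta t (B^-1 *: phi) = B^-1 *: delay_op r eta t f.
  rewrite delay_op_cseg -e1 (delay_op_cseg t phi).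
  transitivity (delay_op r eta t (fun th => B^-1 *: (phi \o @clamp R r) th + 0)).
    by congr delay_op; apply/funext => th /=; rewrite addr0.
  by rewrite delay_op_linear// delay_op_cst mulmx0 addr0.
have : ((N (delay_op r eta t (B^-1 *: phi)))%:E <= delay_op_norm r eta t)%E.
  apply: ereal_sup_ubound; exists (B^-1 *: phi) => //=.
  apply: sup_norm_le => // th hth; rewrite segZ euclid_normZ hphi//.
  by rewrite gtr0_norm ?invr_gt0// mulrC ler_pdivrMr// mul1r fB.
rewrite -(fineK (delay_op_norm_fin_num t)) lee_fin e2 euclid_normZ -/(delay_bound t).
by rewrite gtr0_norm ?invr_gt0// mulrC ler_pdivrMr.
Qed.

End delay_operator.

(** * Local integrability of the delay term along a function *)


Lemma continuous_linear_comb (R : realType) n k (f g : R -> 'cV[R]_n) :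
  continuous f -> continuous g -> continuous (fun s => k *: f s + g s).
Proof.
move=> cf cg x.
exact: (@cvgD _ _ _ (nbhs x) _ (fun s => k *: f s) g _ _ (cvgZl_tmp (k := k) (cf x)) (cg x)).
Qed.

Lemma continuousB_euclid (R : realType) n (f g : R -> 'cV[R]_n) :
  continuous f -> continuous g -> continuous (fun s => f s - g s).
Proof.
move=> cf cg; have -> : (fun s => f s - g s) = (fun s => (-1) *: g s + f s).
  by apply/funext => s; rewrite scaleN1r addrC.
exact: continuous_linear_comb.
Qed.

Section delay_functional.
Variables (R : realType) (n : nat) (r : R) (eta : R -> R -> 'M[R]_n).
Local Notation cmu := (@completed_lebesgue_measure R).
Local Notation leb := (@lebesgue_measure R).
Local Notation cT := (caratheodory_type (wlength (@idfun R))^*%mu).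
Hypothesis r_gt0 : 0 < r.
Hypothesis eta_bv : forall t i j, bounded_variation (- r) 0 (fun th => eta t th i j).
Hypothesis eta_meas : forall (phi : cseg n r) i,
        lebesgue_measurable_fun (fun t => delay_op r eta t phi i ord0).
Hypothesis eta_int : loc_integrable (delay_op_norm r eta).
Local Notation N := (@euclid_norm R n).
Implicit Types (f g y : R -> 'cV[R]_n).

Lemma continuous_history y (t : R) : continuous y -> continuous (fun th => y (t + th)).
Proof.
move=> cy s; apply: (continuous_comp (g := y)); last exact: cy.
by apply: continuousD; [exact: cst_continuous|exact: cvg_id].
Qed.

Lemma delay_bound_locint : locint (delay_bound r eta).
Proof.
move=> a b; have := eta_int a b; congr (cmu.-integrable _ _).
by apply/funext => t; rewrite fineK//; exact: delay_op_norm_fin_num.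
Qed.

Lemma delay_op_frozen_measurable y i : continuous y ->
  lebesgue_measurable_fun (fun t => delay_op r eta t y i ord0).
Proof.
move=> cy; have [phi hphi] := segment_exists r cy.
have -> : (fun t => delay_op r eta t y i ord0) = (fun t => delay_op r eta t phi i ord0).
  by apply/funext => t; rewrite (@eq_delay_op _ _ _ _ r_gt0 eta_bv t y phi)// => th /hphi.
exact: eta_meas.
Qed.

(** By hypothesis the functional is measurable in [t] on a fixed history. So the history is
    frozen on intervals of length [1 / k.+1], which leaves a function that is measurable on
    countably many pieces, and uniform continuity gives pointwise convergence. *)
Lemma delay_op_measurable y i : continuous y ->
  lebesgue_measurable_fun (fun t => delay_op r eta t (fun th => y (t + th)) i ord0).
Proof.
move=> cy.
pose q (k : nat) (t : R) : R := (Num.floor (t * k.+1%:R))%:~R / k.+1%:R.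
pose F k t := delay_op r eta t (fun th => y (q k t + th)) i ord0.
have k0 (k : nat) : 0 < k.+1%:R :> R by rewrite ltr0n.
have qP k t : q k t <= t < q k t + k.+1%:R^-1.
  rewrite /q ler_pdivrMr// ge_floor /= -[X in _ + X]mul1r -mulrDl ltr_pdivlMr//.
  by have := floorD1_gt (t * k.+1%:R); rewrite intrD.
have mF k : lebesgue_measurable_fun (F k).
  move=> _ Y mY; rewrite setTI.
  have -> : F k @^-1` Y = \bigcup_(j : int) ([set t : R | Num.floor (t * k.+1%:R) = j] `&`
     (fun t => delay_op r eta t (fun th => y (j%:~R / k.+1%:R + th)) i ord0) @^-1` Y).
    apply/seteqP; split=> [t /= Ft|t [j _ /= [jE]]]; last by rewrite /F /q jE.
    by exists (Num.floor (t * k.+1%:R)).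
  apply: countable_bigcupT_measurable => [|j]; first exact: countableP.
  apply: measurableI.
    have -> : [set t : R | Num.floor (t * k.+1%:R) = j] =
        `[j%:~R / k.+1%:R, (j + 1)%:~R / k.+1%:R[%classic.
      apply/seteqP; split=> t /=; rewrite in_itv/= ler_pdivrMr// ltr_pdivlMr//.
        by move=> <-; rewrite ge_floor floorD1_gt.
      by move=> h; apply/eqP; rewrite floor_eq.
    exact: itv_measurable_completed.
  rewrite -[X in measurable X]setTI.
  have mj := delay_op_frozen_measurable i (continuous_history (t := j%:~R / k.+1%:R) cy).
  by have := mj measurableT Y mY.
apply: (measurable_fun_cvg mF) => t _.
apply/cvgrPdist_lt => e e0.
have B0 := delay_bound_ge0 eta r_gt0 t.
pose e1 := e / (delay_bound r eta t + 1).
have e10 : 0 < e1 by rewrite divr_gt0//; lra.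
have [d d0 hd] := continuous_unif_cont_on (t - r - 1) t cy e10.
near=> k; rewrite /F.
have kd : k.+1%:R^-1 < d by near: k; exact: near_infty_natSinv_lt (PosNum d0).
have k1 : k.+1%:R^-1 <= 1 :> R by rewrite invf_le1// ler1n.
set v := delay_op _ _ _ _; set w := delay_op _ _ _ _.
have -> : v i ord0 - w i ord0 = (v - w) i ord0 by rewrite !mxE.
apply: (le_lt_trans (coord_le_euclid_norm _ _)).
have -> : v - w = delay_op r eta t (fun th => (-1) *: y (q k t + th) + y (t + th)).
  have cq := continuous_history (t := q k t) cy; have ct := continuous_history (t := t) cy.
  by rewrite (delay_op_linear r_gt0 eta_bv t (-1) cq ct) scaleN1r addrC.
apply: (@le_lt_trans _ _ (delay_bound r eta t * e1)).
  apply: (delay_op_le r_gt0 eta_bv).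
    by apply: continuous_linear_comb; exact: continuous_history.
  move=> th /andP[rth th0]; rewrite scaleN1r addrC.
  have /andP[q1] := qP k t.
  move: kd k1; move: (k.+1%:R^-1) => z zd z1 q2.
  have := hd (t + th) (q k t + th); rewrite ltr_norml => h; apply/ltW/h; lra.
have b1 : 0 < delay_bound r eta t + 1 by lra.
by rewrite /e1 mulrA ltr_pdivrMr// mulrC mulrDr mulr1 ltrDl.
Unshelve. all: by end_near. Qed.

Lemma delay_op_vlocint y : continuous y ->
  vlocint (fun t => delay_op r eta t (fun th => y (t + th))).
Proof.
move=> cy i a b; have mab := @itv_measurable_completed R `[a, b].
have [M M0 hM] := continuous_bounded_itv (a - r) b (continuous_euclid_norm cy).
apply: (le_integrable mab) (locintZ M delay_bound_locint a b).
  by apply/measurable_EFinP; apply: measurable_funTS; exact: delay_op_measurable.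
move=> t; rewrite /= in_itv/= => /andP[at_ tb]; rewrite lee_fin.
apply: (le_trans (coord_le_euclid_norm _ _)).
apply: (le_trans _ (ler_norm _)); rewrite mulrC.
apply: (delay_op_le r_gt0 eta_bv); first exact: continuous_history.
move=> th /andP[h1 h2]; apply: le_trans (ler_norm _) (hM _ _); lra.
Qed.

Lemma delay_bound_window (r0 M : R) : 0 < r0 ->
  (ereal_sup (range (fun t : R => (r0^-1)%:E *
         \int[cmu]_(u in `[t, (t + r0)%R]) delay_op_norm r eta u)) <= M%:E)%E ->
  forall t, oint t (t + r0) (delay_bound r eta) <= M * r0.
Proof.
move=> r00 hs t.
have : ((r0^-1)%:E * \int[cmu]_(u in `[t, (t + r0)%R]) delay_op_norm r eta u <= M%:E)%E.
  by apply: le_trans hs; apply: ereal_sup_ubound; exists t.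
have -> : delay_op_norm r eta = EFin \o delay_bound r eta.
  by apply/funext => u; rewrite /= fineK//; exact: delay_op_norm_fin_num.
have mi D : measurable_fun D (fun t : cT => (delay_bound r eta t)%:E).
  by apply/measurable_EFinP; apply: measurable_funTS; exact/locint_measurable/delay_bound_locint.
have If := integrable_fin_num (@itv_measurable_completed R _) (delay_bound_locint t (t + r0)).
rewrite -(fineK If) -EFinM lee_fin mulrC ler_pdivrMr// => h.
have tr : t <= t + r0 by rewrite lerDl ltW.
apply: le_trans h; rewrite oint_le// /Rintegral; apply: fine_le => //.
  apply: integrable_fin_num; first exact: itv_measurable_completed.
  exact/locint_oc/delay_bound_locint.
apply: ge0_subset_integral => //.
- exact: itv_measurable_completed.
- exact: itv_measurable_completed.
- by move=> u _; rewrite lee_fin delay_bound_ge0.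
- exact: subset_itv_oc_cc.
Qed.

End delay_functional.

(** * Exponentially weighted integrals and contractions in weighted norms *)


Ltac vring := by apply/colP => ?; rewrite !mxE; ring.

Section window_bounds.
Variables (R : realType) (b : R -> R) (r0 m : R).
Hypothesis b_locint : locint b.
Hypothesis b_ge0 : forall t, 0 <= b t.
Hypothesis r0_gt0 : 0 < r0.
Hypothesis b_window : forall t, oint t (t + r0) b <= m.

Definition decay_const (e : R) := m / (1 - expR (- e * r0)).

Lemma oint_nneg_le a c d : a <= c -> c <= d -> oint a c b <= oint a d b.
Proof.
by move=> ac cd; rewrite (oint_cat a c d)// lerDl; apply: oint_ge0.
Qed.

Lemma window_le a c : a <= c -> c <= a + r0 -> oint a c b <= m.
Proof. by move=> ac cr; apply: le_trans (b_window a); exact: oint_nneg_le. Qed.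

Lemma window_ge0 : 0 <= m.
Proof. by apply: le_trans (b_window 0); apply: oint_ge0 => //; rewrite add0r ltW. Qed.

Lemma decay_const_ge0 e : 0 < e -> 0 <= decay_const e.
Proof.
move=> e0; rewrite divr_ge0 ?window_ge0// subr_ge0 ltW// expR_lt1.
by rewrite mulNr oppr_lt0 mulr_gt0.
Qed.

Lemma decay_constE e : 0 < e -> m + expR (- e * r0) * decay_const e = decay_const e.
Proof.
move=> e0; rewrite /decay_const; have : 1 - expR (- e * r0) != 0.
  by rewrite gt_eqF// subr_gt0 expR_lt1 mulNr oppr_lt0 mulr_gt0.
by move=> h; field.
Qed.

Let expR_locint (h : R -> R) : continuous h -> locint (fun u => expR (h u) * b u).
Proof.
move=> ch; apply: locint_mul_continuous => // t.
by apply: continuous_comp; [exact: ch|exact: continuous_expR].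
Qed.

Lemma locint_expl e t : locint (fun u => expR (- e * (t - u)) * b u).
Proof.
apply: expR_locint => u; apply: cvgM; first exact: cvg_cst.
by apply: cvgB; [exact: cvg_cst|exact: cvg_id].
Qed.

Lemma locint_expr e t : locint (fun u => expR (- e * (u - t)) * b u).
Proof.
apply: expR_locint => u; apply: cvgM; first exact: cvg_cst.
by apply: cvgB; [exact: cvg_id|exact: cvg_cst].
Qed.

(** Cutting the half-line into windows gives a geometric series of ratio
    [expR (- e * r0)]; [decay_const e] is its sum. *)
Lemma oint_decay_left e a t : 0 < e -> a <= t ->
  oint a t (fun u => expR (- e * (t - u)) * b u) <= decay_const e.
Proof.
move=> e0.
have r00 := r0_gt0; have C0 := decay_const_ge0 e0; have CE := decay_constE e0; have m0 := window_ge0.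
have last t' a' : a' <= t' -> t' <= a' + r0 ->
    oint a' t' (fun u => expR (- e * (t' - u)) * b u) <= m.
  move=> at' tr; apply: le_trans (window_le at' tr); apply: le_oint => //.
    exact: locint_expl.
  move=> u /andP[_ ut]; rewrite ler_piMl// expR_le1 mulNr oppr_le0 mulr_ge0// ?subr_ge0//.
  exact: ltW.
have key : forall (k : nat) t, a <= t -> t - a <= k%:R * r0 ->
    oint a t (fun u => expR (- e * (t - u)) * b u) <= decay_const e.
  elim=> [|k ih] {}t at_ tk.
    have -> : t = a by apply/eqP; rewrite eq_le at_ andbT -subr_le0 (le_trans tk)// mul0r.
    by rewrite oint_id.
  have q0 : 0 <= expR (- e * r0) * decay_const e by rewrite mulr_ge0// expR_ge0.
  have [tr|rt] := leP t (a + r0).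
    by apply: (le_trans (last t a at_ tr)); rewrite -CE lerDl.
  rewrite (oint_cat a (t - r0) t); last exact: locint_expl.
  rewrite -CE addrC; apply: lerD; first by apply: last; lra.
  have -> : (fun u => expR (- e * (t - u)) * b u) =
      (fun u => expR (- e * r0) * (expR (- e * (t - r0 - u)) * b u)).
    by apply/funext => u; rewrite mulrA -expRD; congr (expR _ * _); ring.
  rewrite ointZ; last exact: locint_expl.
  rewrite ler_wpM2l ?expR_ge0// ih//; first lra.
  by rewrite -natr1 mulrDl mul1r in tk; lra.
move=> at_; apply: (key (Num.truncn ((t - a) / r0)).+1) => //.
by rewrite -ler_pdivrMr// ltW// truncnS_gt.
Qed.

Lemma oint_decay_right e t c : 0 < e -> t <= c ->
  oint t c (fun u => expR (- e * (u - t)) * b u) <= decay_const e.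
Proof.
move=> e0.
have r00 := r0_gt0; have C0 := decay_const_ge0 e0; have CE := decay_constE e0; have m0 := window_ge0.
have last t' c' : t' <= c' -> c' <= t' + r0 ->
    oint t' c' (fun u => expR (- e * (u - t')) * b u) <= m.
  move=> tc cr; apply: le_trans (window_le tc cr); apply: le_oint => //.
    exact: locint_expr.
  move=> u /andP[tu _]; rewrite ler_piMl// expR_le1 mulNr oppr_le0 mulr_ge0 ?subr_ge0//.
    exact: ltW.
  exact: ltW.
have key : forall (k : nat) t, t <= c -> c - t <= k%:R * r0 ->
    oint t c (fun u => expR (- e * (u - t)) * b u) <= decay_const e.
  elim=> [|k ih] {}t tc tk.
    have -> : t = c by apply/eqP; rewrite eq_le tc /= -subr_le0 (le_trans tk)// mul0r.
    by rewrite oint_id.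
  have q0 : 0 <= expR (- e * r0) * decay_const e by rewrite mulr_ge0// expR_ge0.
  have [cr|rc] := leP c (t + r0).
    by apply: (le_trans (last t c tc cr)); rewrite -CE lerDl.
  rewrite (oint_cat t (t + r0) c); last exact: locint_expr.
  rewrite -CE; apply: lerD; first by apply: last; lra.
  have -> : (fun u => expR (- e * (u - t)) * b u) =
      (fun u => expR (- e * r0) * (expR (- e * (u - (t + r0))) * b u)).
    by apply/funext => u; rewrite mulrA -expRD; congr (expR _ * _); ring.
  rewrite ointZ; last exact: locint_expr.
  rewrite ler_wpM2l ?expR_ge0// ih//; first lra.
  by rewrite -natr1 mulrDl mul1r in tk; lra.
move=> tc; apply: (key (Num.truncn ((c - t) / r0)).+1) => //.
by rewrite -ler_pdivrMr// ltW// truncnS_gt.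
Qed.

End window_bounds.

Section weighted_fixpoint.
Variables (R : realType) (n : nat).
Local Notation N := (@euclid_norm R n).
Implicit Types (x y : R -> 'cV[R]_n).

Lemma geometric_limit (u : nat -> R) (c B : R) : 0 <= c ->
  (forall k j, `|u (k + j)%N - u k| <= c ^+ k * B) ->
  exists l, forall k, `|l - u k| <= c ^+ k * B.
Proof.
move=> c0 hu.
have B0 k : 0 <= c ^+ k * B by apply: le_trans (hu k 0%N).
have key k m : u k - c ^+ k * B <= u m + c ^+ m * B.
  have [km|/ltnW mk] := leqP k m.
    have := hu k (m - k)%N; rewrite subnKC// ler_norml; have := B0 m; lra.
  have := hu m (k - m)%N; rewrite subnKC// ler_norml; have := B0 k; lra.
exists (sup (range (fun k => u k - c ^+ k * B))) => k.
have hs : has_sup (range (fun k => u k - c ^+ k * B)).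
  split; first by exists (u 0%N - c ^+ 0 * B), 0%N.
  by exists (u 0%N + c ^+ 0 * B) => _ [j _ <-].
have h1 : u k - c ^+ k * B <= sup (range (fun k => u k - c ^+ k * B)).
  by apply: sup_upper_bound => //; exists k.
have h2 : sup (range (fun k => u k - c ^+ k * B)) <= u k + c ^+ k * B.
  by apply: ge_sup; [by case: hs|move=> _ [j _ <-]].
rewrite ler_norml; lra.
Qed.

Lemma geometric_limit_euclid (u : nat -> 'cV[R]_n) (c B : R) : 0 <= c ->
  (forall k j, N (u (k + j)%N - u k) <= c ^+ k * B) ->
  exists l, forall k, N (l - u k) <= c ^+ k * (n%:R * B).
Proof.
move=> c0 hu.
have ex i : exists l, forall k, `|l - u k i ord0| <= c ^+ k * B.
  apply: (@geometric_limit (fun k => u k i ord0)) => // k j; apply: le_trans (hu k j).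
  by have := coord_le_euclid_norm (u (k + j)%N - u k) i; rewrite !mxE.
have [l hl] := choice ex; exists (\col_i l i) => k.
rewrite mulrCA; apply: euclid_norm_le_coord => i; rewrite !mxE; exact: hl.
Qed.

Lemma exprn_small (c B e : R) : 0 <= c -> c < 1 -> 0 < e -> exists k : nat, c ^+ k * B < e.
Proof.
move=> c0 c1 e0.
have [B0|B0] := leP B 0; first by exists 0%N; rewrite expr0 mul1r (le_lt_trans B0).
have : (c ^+ k @[k --> \oo]) --> (0 : R) by apply: cvg_expr; rewrite ger0_norm.
move=> /cvgrPdist_lt /(_ _ (divr_gt0 e0 B0)) [k _ /(_ k (leqnn k))] /= h.
exists k; move: h; rewrite sub0r normrN ger0_norm ?exprn_ge0//.
by rewrite ltr_pdivlMr.
Qed.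

(** Banach's fixed point theorem, where [S x a] says that [x] has size at most [a]. The weight
    [rho] makes small size imply locally uniform smallness. Sizes are closed under
    approximation at two points at a time: this is the form shared by bounds on the values
    of a function and bounds on its oscillation. *)
Lemma weighted_fixpoint (S : (R -> 'cV[R]_n) -> R -> Prop)
    (F : (R -> 'cV[R]_n) -> (R -> 'cV[R]_n)) (rho : R -> R) (c a : R) (x0 : R -> 'cV[R]_n) :
  0 <= c -> c < 1 -> continuous rho ->
  (forall x b, S x b -> forall t, N (x t) <= b * rho t) ->
  (forall b, 0 <= b -> S (fun=> 0) b) ->
  (forall x y b d, S x b -> S y d -> S (fun t => x t + y t) (b + d)) ->
  (forall x b, (forall t s e, 0 < e -> exists y, [/\ S y b, N (x t - y t) < e &
      N (x s - y s) < e]) -> S x b) ->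
  (forall x, continuous x -> continuous (F x)) ->
  (forall x y b, continuous x -> continuous y ->
     S (fun t => x t - y t) b -> S (fun t => F x t - F y t) (c * b)) ->
  continuous x0 -> 0 <= a -> S (fun t => F x0 t - x0 t) a ->
  exists x, [/\ continuous x, F x = x & S (fun t => x t - x0 t) (a / (1 - c))].
Proof.
move=> c0 c1 crho Sb S0 SD Slim Fc Fctr cx0 a0 S1.
pose w k := iter k F x0.
have cw k : continuous (w k) by elim: k => //= k; exact: Fc.
pose A := a / (1 - c).
have A0 : 0 <= A by rewrite divr_ge0// subr_ge0 ltW.
have AE : c * A + a = A by rewrite /A; field; rewrite subr_eq0 eq_sym lt_eqF.
have step k : S (fun t => w k.+1 t - w k t) (c ^+ k * a).
  elim: k => [|k ih]; first by rewrite expr0 mul1r.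
  by rewrite exprS -mulrA; exact: Fctr ih.
have diff j : forall k, S (fun t => w (k + j)%N t - w k t) (c ^+ k * A).
  elim: j => [|j ih] k.
    have -> : (fun t => w (k + 0)%N t - w k t) = fun=> 0.
      by apply/funext => t; rewrite addn0 subrr.
    by apply: S0; rewrite mulr_ge0// exprn_ge0.
  have := SD _ _ _ _ (ih k.+1) (step k).
  have -> : c ^+ k.+1 * A + c ^+ k * a = c ^+ k * A by rewrite exprSr -mulrA -mulrDr AE.
  by congr S; apply/funext => t; rewrite addSnnS addrA subrK.
have ex t : exists l, forall k, N (l - w k t) <= c ^+ k * (n%:R * (A * rho t)).
  apply: (@geometric_limit_euclid (fun k => w k t)) => // k j.
  by rewrite mulrA; exact: (Sb _ _ (diff j k) t).
have [x hx] := choice ex.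
have rho0 t : 0 <= A * rho t.
  by have := Sb _ _ (S0 A A0) t; apply: le_trans; exact: euclid_norm_ge0.
have Sx k : S (fun t => x t - w k t) (c ^+ k * A).
  apply: Slim => t s e e0.
  have [j hj] := exprn_small (n%:R * (A * rho t) + n%:R * (A * rho s)) c0 c1 e0.
  have ckj : c ^+ (k + j) <= c ^+ j.
    by rewrite exprD ler_piMl ?exprn_ge0// exprn_ile1// ltW.
  have cj0 : 0 <= c ^+ j by exact: exprn_ge0.
  have nn t' : 0 <= n%:R * (A * rho t') by rewrite mulr_ge0.
  have small t' : n%:R * (A * rho t') <= n%:R * (A * rho t) + n%:R * (A * rho s) ->
      N (x t' - w k t' - (w (k + j)%N t' - w k t')) < e.
    move=> ht'; have -> : x t' - w k t' - (w (k + j)%N t' - w k t') = x t' - w (k + j)%N t'.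
      vring.
    apply: le_lt_trans hj; apply: (le_trans (hx t' _)).
    by apply: le_trans (ler_wpM2l cj0 ht'); exact: ler_wpM2r.
  exists (fun t => w (k + j)%N t - w k t); split; first exact: diff.
    by apply: small; rewrite lerDl.
  by apply: small; rewrite lerDr.
have cx : continuous x.
  move=> t; apply/continuous_euclid => e e0.
  have e3 : 0 < e / 3 by lra.
  have [k hk] := exprn_small (A * (rho t + 1)) c0 c1 e3.
  have /cvgrPdist_lt/(_ 1 ltr01)[d1 /= d10 h1] := crho t.
  have /continuous_euclid/(_ _ e3)[d2 d20 h2] := cw k t.
  exists (Num.min d1 d2); first by rewrite lt_min d10.
  move=> s; rewrite lt_min => /andP[s1 s2].
  have hs := h2 s s2; have := h1 s; rewrite /= distrC => /(_ s1); rewrite ltr_norml => hr.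
  have near_ u : rho u <= rho t + 1 -> N (x u - w k u) < e / 3.
    move=> hu; apply: le_lt_trans hk; apply: (le_trans (Sb _ _ (Sx k) u)).
    by rewrite -mulrA ler_wpM2l ?exprn_ge0// ler_wpM2l.
  have n1 : N (x s - w k s) < e / 3 by apply: near_; lra.
  have n2 : N (x t - w k t) < e / 3 by apply: near_; lra.
  have -> : x s - x t = (x s - w k s) + (w k s - w k t) - (x t - w k t).
    vring.
  apply: (le_lt_trans (ler_euclid_normB _ _)).
  have := ler_euclid_normD (x s - w k s) (w k s - w k t); lra.
exists x; split => //; last by have := Sx 0%N; rewrite expr0 mul1r.
apply/funext => t; apply/eqP; rewrite -subr_eq0; apply/eqP/euclid_norm_eq0/eqP.
rewrite eq_le euclid_norm_ge0 andbT; apply/ler_addgt0Pr => e e0; rewrite add0r.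
have [k hk] := exprn_small ((c + c) * (A * rho t)) c0 c1 e0.
have h1 := Sb _ _ (Fctr _ _ _ cx (cw k) (Sx k)) t.
have h2 := Sb _ _ (Sx k.+1) t.
have -> : F x t - x t = (F x t - F (w k) t) - (x t - w k.+1 t) by vring.
apply: (le_trans (ler_euclid_normB _ _)); apply/ltW.
apply: le_lt_trans hk; rewrite mulrDl mulrDr !mulrA.
by apply: lerD; [apply: le_trans h1 _|apply: le_trans h2 _]; rewrite ?exprSr ?mulrA// (mulrC c).
Qed.

(** The contraction argument for the integral equation [x = x0 + G x] with a linear [G],
    in the supremum norm with weight [rho]. *)
Lemma weighted_linear_fixpoint (G : (R -> 'cV[R]_n) -> R -> 'cV[R]_n) (rho : R -> R)
    (c a : R) (x0 : R -> 'cV[R]_n) :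
  0 <= c -> c < 1 -> continuous rho -> (forall t, 0 < rho t) ->
  (forall x, continuous x -> continuous (G x)) ->
  (forall x y, continuous x -> continuous y ->
     forall t, G (fun s => x s - y s) t = G x t - G y t) ->
  (forall x b, 0 <= b -> continuous x -> (forall t, N (x t) <= b * rho t) ->
     forall t, N (G x t) <= c * b * rho t) ->
  continuous x0 -> (forall t, N (x0 t) <= a * rho t) ->
  exists x, [/\ continuous x, forall t, x t = x0 t + G x t &
    forall t, N (x t) <= a / (1 - c) * rho t].
Proof.
move=> c0 c1 crho rho0 Gc GB Gctr cx0 x0a.
pose S x b := forall t, N (x t) <= b * rho t.
have S_ge0 x b : S x b -> 0 <= b.
  by move=> /(_ 0)/(le_trans (euclid_norm_ge0 _)); rewrite pmulr_lge0.
have a0 := S_ge0 x0 a x0a.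
pose F x t := 1 *: x0 t + G x t.
have [||||||||||||x [cx Fx Sx]] := @weighted_fixpoint S F rho c (c * a) x0.
- exact: c0.
- exact: c1.
- exact: crho.
- by [].
- by move=> b b0 t; rewrite euclid_norm0 mulr_ge0// ltW.
- by move=> x y b d hx hy t; rewrite mulrDl (le_trans (ler_euclid_normD _ _))// lerD.
- move=> x b h t; apply/ler_addgt0Pr => e e0; have [y [Sy h1 _]] := h t t e e0.
  have := Sy t; have := ler_euclid_normD (y t) (x t - y t); rewrite addrC subrK; lra.
- by move=> x cx; apply: continuous_linear_comb => //; exact: Gc.
- move=> x y b cx cy Sxy t.
  have -> : F x t - F y t = G (fun s => x s - y s) t.
    by rewrite GB// /F opprD addrACA subrr add0r.
  by apply: Gctr => //; [exact: S_ge0 Sxy|exact: continuousB_euclid].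
- exact: cx0.
- exact: mulr_ge0.
- move=> t; have -> : F x0 t - x0 t = G x0 t by rewrite /F scale1r addrAC subrr add0r.
  exact: Gctr.
exists x; split=> // t; first by rewrite -[in LHS]Fx /F scale1r.
have -> : a / (1 - c) = a + c * a / (1 - c) by field; rewrite subr_eq0 eq_sym lt_eqF.
have := ler_euclid_normD (x0 t) (x t - x0 t); rewrite addrC subrK => h.
by rewrite mulrDl (le_trans h)// lerD.
Qed.

Lemma geometric_vanish (c B : R) (v : 'cV[R]_n) : 0 <= c -> c < 1 ->
  (forall k, N v <= c ^+ k * B) -> v = 0.
Proof.
move=> c0 c1 h; apply/euclid_norm_eq0/eqP; rewrite eq_le euclid_norm_ge0 andbT.
apply/ler_addgt0Pr => e e0; rewrite add0r; have [k hk] := exprn_small B c0 c1 e0.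
exact: le_trans (h k) (ltW hk).
Qed.

End weighted_fixpoint.

(** * The initial value problem for a functional equation with delay *)


Section weights.
Variable R : realType.

Lemma expR_inv_le_half : expR (- 1) <= 1 / 2 :> R.
Proof.
have h : (2 : R) <= expR 1 by have := @expR_ge1Dx R 1; rewrite (_ : 1 + 1 = 2).
rewrite expRN div1r lef_pV2 ?posrE ?expR_gt0//.
Qed.

(** With weights that grow at the rate [1 / r0], integrating a coefficient whose integrals over
    windows are at most [1 / 4] is a contraction by the factor [1 / 2]. *)
Lemma decay_const_le_half (r0 m : R) : 0 < r0 -> 0 <= m -> m <= 1 / 4 ->
  decay_const r0 m (r0^-1) <= 1 / 2.
Proof.
move=> r00 m0 m4; rewrite /decay_const mulNr mulVf ?gt_eqF//.
have := expR_inv_le_half; set q := expR _ => q2.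
rewrite ler_pdivrMr; lra.
Qed.

Lemma continuous_expR_comp (h : R -> R) : continuous h -> continuous (fun t => expR (h t)).
Proof. by move=> ch t; apply: continuous_comp; [exact: ch|exact: continuous_expR]. Qed.

End weights.

Section primitives.
Variables (R : realType) (n : nat).
Local Notation N := (@euclid_norm R n).

Lemma continuous_vint (f : R -> 'cV[R]_n) a : vlocint f -> continuous (fun t => vint a t f).
Proof.
move=> lf t; apply/continuous_euclid => e e0.
have ac : abs_continuous (t - 1) (t + 1) (fun t => vint a t f).
  apply: (abs_continuous_vint (f := f)) => // u v _ _ _.
  by rewrite (vint_cat a u v lf) addrAC subrr add0r.
have [|d d0 hd] := abs_continuous_continuous_within ac (t := t) _ e0; first lra.
exists (Num.min d 1); first by rewrite lt_min d0 ltr01.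
move=> s; rewrite lt_min => /andP[sd]; rewrite ltr_norml => s1.
by apply: hd => //; lra.
Qed.

End primitives.

Section initial_value_problem.
Variables (R : realType) (n : nat) (r r0 m : R) (b : R -> R).
Variable L : R -> (R -> 'cV[R]_n) -> 'cV[R]_n.
Local Notation N := (@euclid_norm R n).
Hypothesis r_ge0 : 0 <= r.
Hypothesis r0_gt0 : 0 < r0.
Hypothesis b_locint : locint b.
Hypothesis b_ge0 : forall t, 0 <= b t.
Hypothesis b_window : forall t, oint t (t + r0) b <= m.
Hypothesis m_small : m <= 1 / 4.
Hypothesis L_linear : forall t (k : R) (x y : R -> 'cV[R]_n), continuous x -> continuous y ->
  L t (fun s => k *: x s + y s) = k *: L t x + L t y.
Hypothesis L_bound : forall t (y : R -> 'cV[R]_n) B, continuous y ->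
  (forall s, t - r <= s <= t -> N (y s) <= B) -> N (L t y) <= b t * B.
Hypothesis L_vlocint : forall y : R -> 'cV[R]_n, continuous y -> vlocint (fun t => L t y).
Implicit Types (x y phi : R -> 'cV[R]_n) (s t : R).

Lemma functionalB t x y : continuous x -> continuous y ->
  L t (fun s => x s - y s) = L t x - L t y.
Proof.
move=> cx cy; transitivity (L t (fun s => (-1) *: y s + x s)).
  by congr L; apply/funext => s; rewrite scaleN1r addrC.
by rewrite L_linear// scaleN1r addrC.
Qed.

Let g := r0^-1.
Let g_gt0 : 0 < g. Proof. by rewrite invr_gt0. Qed.

Let growth_le s y a t : 0 <= a -> s <= t -> continuous y ->
  (forall u, u <= t -> s - r <= u -> N (y u) <= a * expR (g * (Num.max u s - s))) ->
  N (vint s t (fun u => L u y)) <= 1 / 2 * a * expR (g * (t - s)).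
Proof.
move=> a0 st cy hy.
have ll := locint_expl b_locint g t.
apply: (@le_trans _ _ (oint s t (fun u => (a * expR (g * (t - s))) * (expR (- g * (t - u)) * b u)))).
  apply: norm_vint_le => //; [exact: L_vlocint|exact: locintZ|].
  move=> u /andP[su ut].
  have -> : a * expR (g * (t - s)) * (expR (- g * (t - u)) * b u) = b u * (a * expR (g * (u - s))).
    transitivity (b u * (a * (expR (g * (t - s)) * expR (- g * (t - u))))); first ring.
    by rewrite -expRD; congr (_ * (_ * expR _)); ring.
  apply: L_bound => // v /andP[v1 v2].
  apply: (le_trans (hy v _ _)); [lra|lra|].
  by rewrite ler_wpM2l// ler_expR ler_pM2l// lerD2r ge_max v2 ltW.
rewrite ointZ// -mulrA [1 / 2 * _]mulrC; apply: ler_wpM2l.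
  by rewrite mulr_ge0// expR_ge0.
apply: (le_trans (oint_decay_left b_locint b_ge0 r0_gt0 b_window g_gt0 st)).
apply: decay_const_le_half => //.
exact: (window_ge0 b_ge0 r0_gt0 b_window).
Qed.

Let weight_ge1 s t : 1 <= expR (g * (Num.max t s - s)).
Proof. by rewrite -expR0 ler_expR mulr_ge0 ?(ltW g_gt0)// subr_ge0 le_max lexx orbT. Qed.

(** The weight is constant up to time [s], where the solution is prescribed. *)
Lemma ivp_exists s phi B : continuous phi -> (forall t, t <= s -> N (phi t) <= B) ->
  exists y, [/\ continuous y, forall t, t <= s -> y t = phi t,
    forall t, s <= t -> y t = phi s + vint s t (fun u => L u y) &
    forall t, s <= t -> N (y t) <= 2 * B * expR (g * (t - s))].
Proof.
move=> cphi phiB.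
have cmin : continuous (fun t => Num.min t s).
  by move=> t; apply: continuous_min; [exact: cvg_id|exact: cvg_cst].
have cmax : continuous (fun t => Num.max t s).
  by move=> t; apply: continuous_max; [exact: cvg_id|exact: cvg_cst].
pose x0 t := phi (Num.min t s).
pose G x t := vint s (Num.max t s) (fun u => L u x).
pose rho t := expR (g * (Num.max t s - s)).
have B0 : 0 <= B by apply: le_trans (phiB s (lexx s)); exact: euclid_norm_ge0.
have [||||||||| x [cx xE xB]] := @weighted_linear_fixpoint R n G rho (1 / 2) B x0.
- lra.
- lra.
- apply: continuous_expR_comp => t; apply: cvgM; first exact: cvg_cst.
  by apply: cvgB; [exact: cmax|exact: cvg_cst].
- by move=> t; exact: expR_gt0.
- move=> x cx t; apply: (continuous_comp (cmax t) (g := fun t => vint s t (fun u => L u x))).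
  exact/continuous_vint/L_vlocint.
- move=> x y cx cy t; rewrite /G -vintB; [|exact: L_vlocint|exact: L_vlocint].
  by congr vint; apply/funext => u; exact: functionalB.
- move=> x a a0 cx xa t; have st : s <= Num.max t s by rewrite le_max lexx orbT.
  by apply: growth_le => // u _ _; exact: xa.
- by move=> t; apply: (continuous_comp (cmin t)); exact: cphi.
- move=> t; apply: (@le_trans _ _ B); first by apply: phiB; rewrite ge_min lexx orbT.
  by apply: ler_peMr => //; exact: weight_ge1.
exists x; split; first exact: cx.
- by move=> t st; rewrite xE /x0 /G (min_idPl st) (max_idPr st) vint_id addr0.
- by move=> t st; rewrite xE /x0 /G (min_idPr st) (max_idPl st).
move=> t st; have := xB t; rewrite /rho (max_idPl st).
by rewrite (_ : 1 - 1 / 2 = 2^-1) ?invrK 1?(mulrC B)//; lra.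
Qed.

(** Inserting a bound for [y] into the equation halves it. *)
Lemma ivp_unique s y : continuous y -> (forall t, s - r <= t <= s -> y t = 0) ->
  (forall t, s <= t -> y t = vint s t (fun u => L u y)) -> forall t, s <= t -> y t = 0.
Proof.
move=> cy y0 ys t st.
have [B B0 hB] := continuous_bounded_itv (s - r) t (continuous_euclid_norm cy).
have [c0 c1] : 0 <= 1 / 2 :> R /\ 1 / 2 < 1 :> R by split; lra.
suff key (k : nat) u : u <= t -> s - r <= u ->
    N (y u) <= (1 / 2) ^+ k * B * expR (g * (Num.max u s - s)).
  apply: (@geometric_vanish _ _ (1 / 2) (B * expR (g * (Num.max t s - s)))) => // k.
  by have rr := r_ge0; rewrite mulrA; apply: key => //; lra.
elim: k u => [|k ih] u ut ru.
  rewrite expr0 mul1r; apply: (@le_trans _ _ B); last by apply: ler_peMr => //; exact: weight_ge1.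
  by apply: le_trans (ler_norm _) (hB _ _); rewrite ru.
have [us|su] := leP u s.
  by rewrite y0 ?us ?ru// euclid_norm0 mulr_ge0 ?expR_ge0// mulr_ge0// exprn_ge0.
rewrite exprS -(mulrA (1 / 2)) ys; last exact: ltW.
apply: growth_le => //.
- by rewrite mulr_ge0// exprn_ge0.
- exact: ltW.
by move=> v vu rv; apply: ih => //; exact: le_trans ut.
Qed.

End initial_value_problem.

(** * Primitives and the product rule *)


Section scalar_primitives.
Variable R : realType.
Local Notation leb := (@lebesgue_measure R).
Implicit Types (a b c t : R).

Lemma real_abs_continuous_le (x g : R -> R) a b : locint g -> (forall t, 0 <= g t) ->
  (forall u v, a <= u -> u <= v -> v <= b -> `|x v - x u| <= oint u v g) ->
  real_abs_continuous a b x.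
Proof.
move=> lg g0 xg.
pose y t : 'cV[R]_1 := \col_i x t.
have acy : abs_continuous a b y.
  apply: (abs_continuous_le lg g0) => u v au uv vb; apply: le_trans (xg u v au uv vb).
  by apply: (le_trans (euclid_norm_le_sum _)); rewrite big_ord1 !mxE.
have := abs_continuous_coord ord0 acy; congr real_abs_continuous.
by apply/funext => t; rewrite mxE.
Qed.

(** The difference between [x] and the integral of [f] is absolutely continuous with zero
    derivative almost everywhere. *)
Lemma oint_derivative (x f : R -> R) a b : a <= b -> locint f ->
  real_abs_continuous a b x ->
  {ae leb, forall t, a < t < b -> is_derive t (1 : R) x (f t)} ->
  x b - x a = oint a b f.
Proof.
move=> ab lf acx Dx.
have FF := ae_filter_ringOfSetsType leb.
pose h t := x t - oint a t f.
suff : h b = h a by rewrite /h oint_id; lra.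
have aci : real_abs_continuous a b (fun t => oint a t f).
  apply: (@real_abs_continuous_le _ (fun t => `|f t|)) => //; first exact: locint_norm.
  move=> u v _ uv _; rewrite (oint_cat a u v)// addrAC subrr add0r.
  by apply: norm_oint_le => //; exact: locint_norm.
apply: abs_continuous_derive0_cst => //.
  move=> e e0; have e2 : 0 < e / 2 by lra.
  have [d1 d10 h1] := acx _ e2; have [d2 d20 h2] := aci _ e2.
  exists (Num.min d1 d2); first by rewrite lt_min d10.
  move=> m u v uv tI; rewrite lt_min => /andP[s1 s2].
  have := h1 m u v uv tI s1; have := h2 m u v uv tI s2 => k2 k1.
  apply: (@le_lt_trans _ _ (\sum_j `|x (v j) - x (u j)| +
     \sum_j `|oint a (v j) f - oint a (u j) f|)); last lra.
  rewrite -big_split /=; apply: ler_sum => j _; rewrite /h.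
  have -> : forall p q r s : R, p - q - (r - s) = (p - r) - (q - s) by move=> *; ring.
  exact: ler_normB.
have := ae_is_derive_oint a lf; move: Dx; apply: filterS2 => t hx hf tab.
by have := is_deriveB (hx tab) hf; rewrite subrr.
Qed.

(** Locally absolutely continuous functions with their derivative, in integrated form: unlike
    the almost everywhere derivative, this is manipulated without exceptional sets. *)
Definition prim (x f : R -> R) := locint f /\ forall s t, x t - x s = oint s t f.

Lemma prim_le x f : prim x f -> forall u v, u <= v ->
  `|x v - x u| <= oint u v (fun t => `|f t|).
Proof. by move=> [lf xf] u v uv; rewrite xf; apply: norm_oint_le => //; exact: locint_norm. Qed.

Lemma prim_continuous x f : prim x f -> continuous x.
Proof.
move=> [lf xf].
have -> : x = fun t => vint 0 t (fun t => \col_(i < 1) f t) ord0 ord0 + x 0.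
  apply/funext => t; rewrite mxE; have -> : x t = (x t - x 0) + x 0 by ring.
  rewrite xf; congr (oint _ _ _ + _); apply/funext => s; by rewrite mxE.
move=> t; apply: cvgD; last exact: cvg_cst.
apply: (continuous_coord (y := fun t => vint 0 t (fun t => \col_(i < 1) f t))).
by apply: continuous_vint => i; apply: eq_locint lf => s; rewrite mxE.
Qed.

Lemma prim_ae_is_derive x f : prim x f -> {ae leb, forall t, is_derive t (1 : R) x (f t)}.
Proof.
move=> [lf xf]; have FF := ae_filter_ringOfSetsType leb.
have := ae_is_derive_oint 0 lf; apply: filterS => t Dt.
have cd : is_derive t (1 : R) (fun=> x 0) 0 by exact: is_derive_cst.
have := is_deriveD cd Dt; rewrite add0r; congr (is_derive _ _ _ _).
by apply/funext => s; rewrite -[LHS]/(x 0 + oint 0 s f) -xf; ring.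
Qed.

Lemma prim_sum (I : Type) (r : seq I) (x f : I -> R -> R) : (forall i, prim (x i) (f i)) ->
  prim (fun t => \sum_(i <- r) x i t) (fun t => \sum_(i <- r) f i t).
Proof.
move=> xf; have lf i : locint (f i) by have [] := xf i.
split; first exact: locint_sum.
move=> s t; rewrite oint_sum// -sumrB; apply: eq_bigr => i _.
by have [_ ->] := xf i.
Qed.

(** The product is absolutely continuous, because the factors are and are bounded on compact
    intervals; its derivative is given by the product rule almost everywhere. *)
Lemma primM x y f g : prim x f -> prim y g ->
  prim (fun t => x t * y t) (fun t => f t * y t + x t * g t).
Proof.
move=> px py; have cx := prim_continuous px; have cy := prim_continuous py.
have [lf xf] := px; have [lg yg] := py.
have lq : locint (fun t => f t * y t + x t * g t).
  apply: locintD; last exact: locint_mul_continuous.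
  by apply: eq_locint (locint_mul_continuous cy lf) => t; rewrite mulrC.
split=> // s t.
suff key a b : a <= b -> x b * y b - x a * y a = oint a b (fun t => f t * y t + x t * g t).
  have [/key//|/ltW/key ts] := leP s t.
  by rewrite ointC -ts opprB.
move=> ab; apply: (@oint_derivative (fun t => x t * y t)) => //.
  have [B B0 xB] := continuous_bounded_itv a b cx.
  have [C C0 yC] := continuous_bounded_itv a b cy.
  apply: (@real_abs_continuous_le _ (fun t => B * `|g t| + C * `|f t|)).
  - by apply: locintD; apply: locintZ; exact: locint_norm.
  - by move=> u; rewrite addr_ge0// mulr_ge0.
  move=> u v au uv vb.
  have -> : x v * y v - x u * y u = x v * (y v - y u) + y u * (x v - x u) by ring.
  apply: (le_trans (ler_normD _ _)); rewrite !normrM.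
  rewrite ointD; [|by apply: locintZ; exact: locint_norm|by apply: locintZ; exact: locint_norm].
  rewrite !ointZ; try exact: locint_norm.
  by apply: lerD; apply: ler_pM => //; [apply: xB; lra|exact: (prim_le py)|apply: yC; lra|exact: (prim_le px)].
have FF := ae_filter_ringOfSetsType leb.
have := prim_ae_is_derive px; have := prim_ae_is_derive py; apply: filterS2 => u hy hx _.
have := is_deriveM hx hy; rewrite -![_ *: _]/(_ * _).
by rewrite addrC (mulrC (y u)).
Qed.

End scalar_primitives.

Lemma vint_derivative (R : realType) n (a b : R) (y f : R -> 'cV[R]_n) :
  a <= b -> vlocint f -> abs_continuous a b y ->
  {ae lebesgue_measure, forall t, a < t < b -> is_derive t (1 : R) y (f t)} ->
  y b - y a = vint a b f.
Proof.
move=> ab lf acy Dy; apply/colP => i; rewrite !mxE.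
apply: (oint_derivative (x := fun t => y t i ord0)) => //; first exact: abs_continuous_coord.
have FF := ae_filter_ringOfSetsType (@lebesgue_measure R).
by apply: filterS Dy => t Dy /Dy/is_derive_coord.
Qed.

Section matrix_primitives.
Variable R : realType.

Definition mprim p q (U U' : R -> 'M[R]_(p, q)) :=
  forall i j, prim (fun t => U t i j) (fun t => U' t i j).

Lemma eq_mprim p q (U U' V' : R -> 'M[R]_(p, q)) : U' =1 V' -> mprim U U' -> mprim U V'.
Proof. by move=> e; have -> : V' = U' by apply/funext. Qed.

Lemma mprimM p q s (U U' : R -> 'M[R]_(p, q)) (V V' : R -> 'M[R]_(q, s)) :
  mprim U U' -> mprim V V' ->
  mprim (fun t => U t *m V t) (fun t => U' t *m V t + U t *m V' t).
Proof.
move=> hU hV i j.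
have := prim_sum (index_enum 'I_q) (fun k => primM (hU i k) (hV k j)).
congr prim; apply/funext => t; rewrite !mxE//.
by rewrite big_split.
Qed.

Lemma mprim_cst p q (U U' : R -> 'M[R]_(p, q)) : mprim U U' -> (forall t, U' t = 0) ->
  forall s t, U t = U s.
Proof.
move=> hU U0 s t; apply/matrixP => i j; apply/eqP; rewrite -subr_eq0; have [_ ->] := hU i j.
have -> : (fun t => U' t i j) = fun=> 0 by apply/funext => u; rewrite U0 mxE.
by rewrite oint_cst mul0r.
Qed.

Lemma mprim_vint n (y f : R -> 'cV[R]_n) : vlocint f ->
  (forall s t, y t - y s = vint s t f) -> mprim y f.
Proof.
move=> lf yf i j; rewrite (ord1 j); split; first exact: lf.
by move=> s t; have /colP/(_ i) := yf s t; rewrite !mxE.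
Qed.

Lemma vint_mprim n (y f : R -> 'cV[R]_n) : mprim y f ->
  vlocint f /\ forall s t, y t - y s = vint s t f.
Proof.
move=> h; split=> [i|s t]; first by have [] := h i ord0.
by apply/colP => i; rewrite !mxE; have [_ ->] := h i ord0.
Qed.

Lemma mprim_lin n k (x y f g : R -> 'cV[R]_n) : mprim x f -> mprim y g ->
  mprim (fun t => k *: x t + y t) (fun t => k *: f t + g t).
Proof.
move=> /vint_mprim[lf xE] /vint_mprim[lg yE].
have lkf : vlocint (fun t => k *: f t) by exact: vlocintZ.
apply: mprim_vint => [|s t]; first exact: vlocintD.
have -> : k *: x t + y t - (k *: x s + y s) = k *: (x t - x s) + (y t - y s).
  by apply/colP => i; rewrite !mxE; ring.
by rewrite xE yE -vintZ// -vintD.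
Qed.

Lemma mprimB n (x y f g : R -> 'cV[R]_n) : mprim x f -> mprim y g ->
  mprim (fun t => x t - y t) (fun t => f t - g t).
Proof.
move=> px py; have := mprim_lin (-1) py px; congr mprim; apply/funext => t;
by rewrite scaleN1r addrC.
Qed.

Lemma mprim_continuous n (y f : R -> 'cV[R]_n) : mprim y f -> continuous y.
Proof. by move=> h; apply: coord_continuous_euclid => i; exact: (prim_continuous (h i ord0)). Qed.

End matrix_primitives.

(** * Linear ordinary differential equations *)


Section linear_ode.
Variables (R : realType) (n : nat) (r0 m : R) (b : R -> R).
Local Notation N := (@euclid_norm R n).
Local Notation leb := (@lebesgue_measure R).
Hypothesis r0_gt0 : 0 < r0.
Hypothesis b_locint : locint b.
Hypothesis b_ge0 : forall t, 0 <= b t.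
Hypothesis b_window : forall t, oint t (t + r0) b <= m.
Hypothesis m_small : m <= 1 / 4.

Lemma vlocint_matrix_mul (B : R -> 'M[R]_n) (x : R -> 'cV[R]_n) :
  (forall i j, locint (fun t => B t i j)) -> continuous x -> vlocint (fun t => B t *m x t).
Proof.
move=> lB cx i; apply: (@eq_locint _ (fun t => \sum_j x t j ord0 * B t i j)).
  by move=> t; rewrite mxE; apply: eq_bigr => j _; rewrite mulrC.
by apply: locint_sum => j; apply: locint_mul_continuous => //; exact: continuous_coord.
Qed.

Let g := r0^-1.
Let g_gt0 : 0 < g. Proof. by rewrite invr_gt0. Qed.

Lemma ode_exists (B : R -> 'M[R]_n) (v : 'cV[R]_n) :
  (forall i j, locint (fun t => B t i j)) ->
  (forall t w, N (B t *m w) <= b t * N w) ->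
  exists2 x, x 0 = v & mprim x (fun t => B t *m x t).
Proof.
move=> lB hB.
have bl := b_locint; have bg := b_ge0; have r00 := r0_gt0; have bw := b_window.
have m0 := window_ge0 bg r00 bw.
pose rho (t : R) := expR (g * `|t|).
have crho : continuous rho.
  apply: continuous_expR_comp => t; apply: cvgM; first exact: cvg_cst.
  exact: (@norm_continuous _ R^o).
have lBx x : continuous x -> vlocint (fun u => B u *m x u) by exact: vlocint_matrix_mul.
pose G (x : R -> 'cV[R]_n) t := vint 0 t (fun u => B u *m x u).
have half : decay_const r0 m g <= 1 / 2 by apply: decay_const_le_half.
have step x a : 0 <= a -> continuous x -> (forall t, N (x t) <= a * rho t) ->
    forall t, N (G x t) <= 1 / 2 * a * rho t.
  move=> a0 cx Sx t; have a1 : 0 <= a * rho t by rewrite mulr_ge0// expR_ge0.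
  have -> : 1 / 2 * a * rho t = (a * rho t) * (1 / 2) by ring.
  have bx u : N (B u *m x u) <= b u * (a * rho u).
    by apply: (le_trans (hB u _)); rewrite ler_wpM2l.
  have [t0|t0] := leP 0 t.
    have ll := locint_expl bl g t.
    apply: (@le_trans _ _ (oint 0 t (fun u => (a * rho t) * (expR (- g * (t - u)) * b u)))).
      apply: norm_vint_le => //; [exact: lBx|exact: locintZ|].
      move=> u /andP[u0 ut]; apply: (le_trans (bx u)).
      rewrite le_eqVlt; apply/orP; left; apply/eqP.
      transitivity (b u * (a * (expR (g * `|t|) * expR (- g * (t - u))))); last first.
        by rewrite /rho; ring.
      by rewrite -expRD /rho (ger0_norm t0) (ger0_norm (ltW u0)); congr (_ * (_ * expR _)); ring.
    rewrite ointZ//; apply: ler_wpM2l => //; apply: le_trans half.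
    exact: oint_decay_left.
  rewrite /G vintC euclid_normN.
  have ll := locint_expr bl g t.
  apply: (@le_trans _ _ (oint t 0 (fun u => (a * rho t) * (expR (- g * (u - t)) * b u)))).
    apply: norm_vint_le => //; [exact: ltW|exact: lBx|exact: locintZ|].
    move=> u /andP[u0 ut]; apply: (le_trans (bx u)).
    rewrite le_eqVlt; apply/orP; left; apply/eqP.
    transitivity (b u * (a * (expR (g * `|t|) * expR (- g * (u - t))))); last first.
      by rewrite /rho; ring.
    by rewrite -expRD /rho (ler0_norm (ltW t0)) (ler0_norm ut); congr (_ * (_ * expR _)); ring.
  rewrite ointZ//; apply: ler_wpM2l => //; apply: le_trans half.
  by apply: oint_decay_right => //; exact: ltW.
have [||||||||| x [cx xE _]] := @weighted_linear_fixpoint R n G rho (1 / 2) (N v) (fun=> v).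
- lra.
- lra.
- exact: crho.
- by move=> t; exact: expR_gt0.
- by move=> x cx; exact/continuous_vint/lBx.
- move=> x y cx cy t; rewrite /G -vintB; [|exact: lBx|exact: lBx].
  by congr vint; apply/funext => u; rewrite mulmxBr.
- exact: step.
- by move=> t; exact: cvg_cst.
- move=> t; apply: ler_peMr; first exact: euclid_norm_ge0.
  by rewrite -expR0 ler_expR; apply: mulr_ge0; [exact: ltW|exact: normr_ge0].
exists x; first by rewrite xE /G vint_id addr0.
apply: mprim_vint; first exact: lBx.
move=> s t; rewrite (xE t) (xE s) /G (vint_cat 0 s t (lBx x cx)); vring.
Qed.

Variable A : R -> 'M[R]_n.
Hypothesis A_locint : forall i j, locint (fun t => A t i j).
Hypothesis A_bound : forall t w, N (A t *m w) <= b t * N w.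

(** The adjoint equation has the same bound: [N z ^+ 2] is the inner product of [w] with
    [A t *m z]. *)
Lemma trmx_bound t w : N (- (A t)^T *m w) <= b t * N w.
Proof.
rewrite mulNmx euclid_normN; set z := (A t)^T *m w.
have : N z ^+ 2 <= N z * (b t * N w).
  rewrite euclid_norm_sqr.
  have -> : \sum_i z i ord0 * z i ord0 = \sum_i w i ord0 * (A t *m z) i ord0.
    transitivity ((z^T *m z) ord0 ord0).
      by rewrite [RHS]mxE; apply: eq_bigr => i _; rewrite [z^T _ _]mxE.
    rewrite {1}/z trmx_mul trmxK -mulmxA [LHS]mxE; apply: eq_bigr => i _.
    by rewrite [w^T _ _]mxE.
  apply: (le_trans (dot_le_euclid_norm _ _)).
  have := A_bound t z; have := euclid_norm_ge0 w => w0 h.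
  have -> : N z * (b t * N w) = N w * (b t * N z) by ring.
  exact: ler_wpM2l.
have := euclid_norm_ge0 z; rewrite le_eqVlt => /predU1P[<- _|z0].
  by rewrite mulr_ge0 ?euclid_norm_ge0.
by rewrite expr2 ler_pM2l.
Qed.

(** Solving the adjoint equation yields the inverse of a fundamental matrix directly: the
    derivative of the product of the two matrices vanishes. *)
Lemma fundamental_matrices : exists XY : (R -> 'M[R]_n) * (R -> 'M[R]_n),
  [/\ mprim XY.1 (fun t => A t *m XY.1 t), mprim XY.2 (fun t => - (XY.2 t *m A t)) &
      forall t, XY.2 t *m XY.1 t = 1%:M].
Proof.
have exX (j : 'I_n) := ode_exists (delta_mx j ord0 : 'cV[R]_n) A_locint A_bound.
have [xs hx] : exists xs : 'I_n -> R -> 'cV[R]_n, forall j,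
    xs j 0 = delta_mx j ord0 /\ mprim (xs j) (fun t => A t *m xs j t).
  suff /choice[xs hxs] : forall j : 'I_n, exists x : R -> 'cV[R]_n,
      x 0 = delta_mx j ord0 /\ mprim x (fun t => A t *m x t) by exists xs.
  by move=> j; have [x x0 px] := exX j; exists x.
have lA' i j : locint (fun t => (- (A t)^T) i j).
  by apply: eq_locint (locintN (A_locint j i)) => t; rewrite !mxE.
have exY (j : 'I_n) := ode_exists (delta_mx j ord0 : 'cV[R]_n) lA' trmx_bound.
have [ys hy] : exists ys : 'I_n -> R -> 'cV[R]_n, forall j,
    ys j 0 = delta_mx j ord0 /\ mprim (ys j) (fun t => - (A t)^T *m ys j t).
  suff /choice[ys hys] : forall j : 'I_n, exists y : R -> 'cV[R]_n,
      y 0 = delta_mx j ord0 /\ mprim y (fun t => - (A t)^T *m y t) by exists ys.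
  by move=> j; have [y y0 py] := exY j; exists y.
pose X t : 'M[R]_n := \matrix_(i, j) xs j t i ord0.
pose Y t : 'M[R]_n := \matrix_(i, j) ys i t j ord0.
have pX : mprim X (fun t => A t *m X t).
  move=> i j; have [_ /(_ i ord0)] := hx j; congr prim; apply/funext => t.
    by rewrite mxE.
  by rewrite !mxE; apply: eq_bigr => k _; rewrite !mxE.
have pY : mprim Y (fun t => - (Y t *m A t)).
  move=> i j; have [_ /(_ j ord0)] := hy i; congr prim; apply/funext => t.
    by rewrite mxE.
  rewrite !mxE -sumrN; apply: eq_bigr => k _; rewrite !mxE; ring.
exists (X, Y); split => //= t.
have := mprim_cst (mprimM pY pX) _ 0 t; rewrite /= => ->; last first.
  by move=> s; rewrite mulNmx mulmxA addNr.
apply/matrixP => i j; rewrite !mxE (bigD1 i)//= big1 => [|k ki].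
  by rewrite !mxE (hx j).1 (hy i).1 !mxE !eqxx !andbT mul1r addr0.
by rewrite !mxE (hy i).1 !mxE (negbTE ki) mul0r.
Qed.

Variables X Y : R -> 'M[R]_n.
Hypothesis X_prim : mprim X (fun t => A t *m X t).
Hypothesis Y_prim : mprim Y (fun t => - (Y t *m A t)).
Hypothesis YX : forall t, Y t *m X t = 1%:M.

Lemma fundamental_matrixV t : X t *m Y t = 1%:M.
Proof. exact/mulmx1C/YX. Qed.

(** [Y t *m x t] has zero derivative. *)
Lemma ode_primE (x : R -> 'cV[R]_n) : mprim x (fun t => A t *m x t) -> forall s t, x t = X t *m (Y s *m x s).
Proof.
move=> px s t.
have : Y t *m x t = Y s *m x s.
  apply: (mprim_cst (mprimM Y_prim px)) => u.
  by rewrite mulNmx mulmxA addNr.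
by move=> <-; rewrite mulmxA fundamental_matrixV mul1mx.
Qed.

Lemma ode_prim (w : 'cV[R]_n) : mprim (fun t => X t *m w) (fun t => A t *m (X t *m w)).
Proof.
have pw : mprim (fun=> w) (fun=> 0).
  move=> i j; split; first by apply: eq_locint (locint_cst 0) => t; rewrite mxE.
  move=> s t; have -> : (fun _ : R => (0 : 'cV[R]_n) i j) = fun=> 0 by apply/funext => u; rewrite mxE.
  by rewrite oint_cst mul0r subrr.
by apply: eq_mprim (mprimM X_prim pw) => t; rewrite mulmx0 addr0 mulmxA.
Qed.

Lemma ode_solutionP s v (x : R -> 'cV[R]_n) : ode_solution A s v x <->
  x s = v /\ mprim x (fun t => A t *m x t).
Proof.
split=> [[xs acx Dx]|[xs px]].
  split=> //; have cx : continuous x.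
    move=> t; apply/continuous_euclid => e e0.
    have tt : t - 1 <= t + 1 by lra.
    have [|d d0 hd] := abs_continuous_continuous_within (acx _ _ tt) (t := t) _ e0; first lra.
    exists (Num.min d 1); first by rewrite lt_min d0 ltr01.
    move=> u; rewrite lt_min => /andP[ud]; rewrite ltr_norml => s1.
    by apply: hd => //; lra.
  have lAx : vlocint (fun t => A t *m x t) by exact: vlocint_matrix_mul.
  apply: mprim_vint => //.
  have key p q : p <= q -> x q - x p = vint p q (fun t => A t *m x t).
    move=> pq; apply: vint_derivative => //; first exact: acx.
    have FF := ae_filter_ringOfSetsType leb.
    by apply: filterS Dx => t + _.
  move=> p q; have [/key//|/ltW/key qp] := leP p q.
  by rewrite vintC -qp opprB.
have [lAx xE] := vint_mprim px.
split=> // [p q _|].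
  by apply: (abs_continuous_vint lAx) => u w _ _ _; exact: xE.
have FF := ae_filter_ringOfSetsType leb.
have : {ae leb, forall t, forall i,
    is_derive t (1 : R) (fun t => x t i ord0) ((A t *m x t) i ord0)}.
  apply: (@filter_forall R _ (fun i t => is_derive t (1 : R)
    (fun t => x t i ord0) ((A t *m x t) i ord0)) (almost_everywhere leb) FF) => i.
  exact: (prim_ae_is_derive (px i ord0)).
by apply: filterS => t h; apply/is_derive_coord.
Qed.

Lemma ode_evolutionE t s v : ode_evolution A t s v = X t *m (Y s *m v).
Proof.
rewrite /ode_evolution; set W := [set w | _].
have W0 : W (X t *m (Y s *m v)).
  exists (fun t => X t *m (Y s *m v)) => //; apply/ode_solutionP; split.
    by rewrite mulmxA fundamental_matrixV mul1mx.
  exact: ode_prim.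
have [x /ode_solutionP[xs px] ->] := @xgetPex _ 0 W (ex_intro _ _ W0).
by rewrite (ode_primE px s t) xs.
Qed.

Lemma variation_of_constants (f : R -> 'cV[R]_n) (c : 'cV[R]_n) : vlocint f ->
  vlocint (fun t => Y t *m f t) /\
  mprim (fun t => X t *m (c + vint 0 t (fun u => Y u *m f u)))
    (fun t => A t *m (X t *m (c + vint 0 t (fun u => Y u *m f u))) + f t).
Proof.
move=> lf.
have lYf : vlocint (fun t => Y t *m f t).
  move=> i; apply: (@eq_locint _ (fun t => \sum_j Y t i j * f t j ord0)).
    by move=> t; rewrite mxE.
  apply: locint_sum => j; apply: locint_mul_continuous => //.
  exact: (prim_continuous (Y_prim i j)).
split=> //.
have pv : mprim (fun t => c + vint 0 t (fun u => Y u *m f u)) (fun t => Y t *m f t).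
  apply: mprim_vint => // s t; rewrite (vint_cat 0 s t lYf); vring.
apply: eq_mprim (mprimM X_prim pv) => t.
by rewrite !mulmxA fundamental_matrixV mul1mx.
Qed.

End linear_ode.

(** * Bounded solutions of an ordinary differential equation with a dichotomy *)


Section operator_norm.
Variables (R : realType) (X : lmodType R) (NX : X -> R).
Hypothesis NX_homogeneous : forall (k : R) x, NX (k *: x) = `|k| * NX x.
Hypothesis NX_ge0 : forall x, 0 <= NX x.
Hypothesis NX_eq0 : forall x, NX x = 0 -> x = 0.

Lemma op_norm_le_homogeneous (f : X -> X) (C : R) :
  (forall k x, f (k *: x) = k *: f x) -> (op_norm NX NX f <= C%:E)%E ->
  forall x, NX (f x) <= C * NX x.
Proof.
move=> fZ fC x; have [x0|x0] := eqVneq (NX x) 0.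
  have f0 : f 0 = 0 by rewrite -(scale0r x) fZ !scale0r.
  by rewrite (NX_eq0 x0) f0 -(NX_eq0 x0) x0 mulr0.
have xgt0 : 0 < NX x by rewrite lt_neqAle eq_sym x0 NX_ge0.
have : ((NX (f ((NX x)^-1 *: x)))%:E <= C%:E)%E.
  apply: le_trans fC; apply: ereal_sup_ubound; exists ((NX x)^-1 *: x) => //=.
  by rewrite NX_homogeneous gtr0_norm ?invr_gt0// mulVf.
rewrite lee_fin fZ NX_homogeneous gtr0_norm ?invr_gt0// mulrC.
by rewrite ler_pdivrMr.
Qed.

Lemma op_norm_ub (f : X -> X) (C : R) : 0 <= C ->
  (forall x, NX (f x) <= C * NX x) -> (op_norm NX NX f <= C%:E)%E.
Proof.
move=> C0 fC; apply: ge_ereal_sup => _ [x /= x1 <-]; rewrite lee_fin.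
by apply: (le_trans (fC x)); rewrite ler_piMr.
Qed.

Lemma backward_evolutionE (T : R -> R -> X -> X) (P : R -> X -> X) t s x :
  set_bij (null_space (P t)) (null_space (P s)) (T s t) -> null_space (P t) x ->
  backward_evolution T P t s (T s t x) = x.
Proof.
by move=> [_ Tinj _] Px; apply: pinvKV => //; rewrite inE.
Qed.

End operator_norm.

Section bounded_solutions.
Variables (R : realType) (n : nat) (alpha K : R) (A X Y : R -> 'M[R]_n) (P0 : 'M[R]_n).
Local Notation N := (@euclid_norm R n).
Hypothesis K_gt0 : 0 < K.
Hypothesis X_prim : mprim X (fun t => A t *m X t).
Hypothesis Y_prim : mprim Y (fun t => - (Y t *m A t)).
Hypothesis YX : forall t, Y t *m X t = 1%:M.
Hypothesis stable_bound : forall t u v, u <= t ->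
  N (X t *m (P0 *m (Y u *m v))) <= K * expR (- alpha * (t - u)) * N v.
Hypothesis unstable_bound : forall t u v, t <= u ->
  N (X t *m ((1%:M - P0) *m (Y u *m v))) <= K * expR (- alpha * (u - t)) * N v.

Lemma mulmx_bound p (B : 'M[R]_(p, n)) : exists2 C, 0 <= C &
  forall v, euclid_norm (B *m v) <= C * N v.
Proof.
exists (\sum_i \sum_j `|B i j|).
  by apply: sumr_ge0 => i _; exact: sumr_ge0.
move=> v; apply: (le_trans (euclid_norm_le_sum _)); rewrite mulr_suml; apply: ler_sum => i _.
rewrite mxE mulr_suml; apply: (le_trans (ler_norm_sum _ _ _)); apply: ler_sum => j _.
by rewrite normrM ler_wpM2l// coord_le_euclid_norm.
Qed.

Lemma vint_mulmx p (B : 'M[R]_(p, n)) a c f : vlocint f ->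
  B *m vint a c f = vint a c (fun t => B *m f t).
Proof.
move=> lf; apply/colP => i; rewrite !mxE.
have -> : (fun t => (B *m f t) i ord0) = fun t => \sum_j B i j * f t j ord0.
  by apply/funext => t; rewrite mxE.
rewrite oint_sum => [|j]; last exact: locintZ.
by apply: eq_bigr => j _; rewrite ointZ// !mxE.
Qed.

(** The stable component of [x t] is the image of the one at [t - k], the unstable component
    that of the one at [t + k], with [k] arbitrarily large. *)
Lemma bounded_ode_solution_eq0 (x : R -> 'cV[R]_n) B : 0 < alpha ->
  mprim x (fun t => A t *m x t) -> (forall t, N (x t) <= B) -> forall t, x t = 0.
Proof.
move=> a0 px xB t.
have B0 : 0 <= B by apply: le_trans (xB 0); exact: euclid_norm_ge0.
have Yx s : Y s *m x s = Y t *m x t.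
  apply: (mprim_cst (mprimM Y_prim px)) => u; by rewrite mulNmx mulmxA addNr.
have [c0 c1] : 0 <= expR (- alpha) /\ expR (- alpha) < 1.
  by rewrite expR_ge0 expR_lt1 oppr_lt0.
have ce (k : nat) : expR (- alpha) ^+ k = expR (- alpha * k%:R).
  by rewrite mulrC expRM_natl.
have XY := fundamental_matrixV YX t.
have s0 : X t *m (P0 *m (Y t *m x t)) = 0.
  apply: (@geometric_vanish _ _ (expR (- alpha)) (K * B)) => // k.
  have tk : t - k%:R <= t by rewrite gerBl.
  rewrite -(Yx (t - k%:R)); apply: (le_trans (stable_bound _ tk)).
  rewrite ce (_ : t - (t - k%:R) = k%:R); last ring.
  rewrite mulrAC [leRHS]mulrC; apply: ler_wpM2r; first exact: expR_ge0.
  by rewrite ler_pM2l.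
have u0 : X t *m ((1%:M - P0) *m (Y t *m x t)) = 0.
  apply: (@geometric_vanish _ _ (expR (- alpha)) (K * B)) => // k.
  have tk : t <= t + k%:R by rewrite lerDl.
  rewrite -(Yx (t + k%:R)); apply: (le_trans (unstable_bound _ tk)).
  rewrite ce (_ : t + k%:R - t = k%:R); last ring.
  rewrite mulrAC [leRHS]mulrC; apply: ler_wpM2r; first exact: expR_ge0.
  by rewrite ler_pM2l.
have : X t *m (P0 *m (Y t *m x t)) + X t *m ((1%:M - P0) *m (Y t *m x t)) = 0.
  by rewrite s0 u0 addr0.
by rewrite -mulmxDr -mulmxDl addrC subrK mul1mx mulmxA XY mul1mx.
Qed.

Variables (beta r0 m : R) (b rho : R -> R).
Hypothesis beta_ge0 : 0 <= beta.
Hypothesis beta_lt : beta < alpha.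
Hypothesis r0_gt0 : 0 < r0.
Hypothesis b_locint : locint b.
Hypothesis b_ge0 : forall t, 0 <= b t.
Hypothesis b_window : forall t, oint t (t + r0) b <= m.
Hypothesis rho_ge0 : forall t, 0 <= rho t.
Hypothesis rho_slow : forall t u, rho u <= expR (beta * `|t - u|) * rho t.

Let e := alpha - beta.
Let e_gt0 : 0 < e. Proof. by rewrite subr_gt0. Qed.
Let C := decay_const r0 m e.
Let C_ge0 : 0 <= C.
Proof. by apply: decay_const_ge0 => //; exact: window_ge0 b_window. Qed.

Variable f : R -> 'cV[R]_n.
Hypothesis f_locint : vlocint f.
Hypothesis f_bound : forall t, N (f t) <= b t * rho t.

Let Yf_locint : vlocint (fun u => Y u *m f u).
Proof. by have [] := variation_of_constants X_prim Y_prim YX 0 f_locint. Qed.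

Let stable_part a t tau : a <= t -> t <= tau ->
  N (X tau *m (P0 *m vint a t (fun u => Y u *m f u))) <=
  K * rho tau * expR (- e * (tau - t)) * C.
Proof.
move=> at_ ttau; rewrite vint_mulmx// vint_mulmx; last first.
  by move=> i; exact: vlocint_mulmx.
have ll := locint_expl b_locint e t.
apply: (@le_trans _ _ (oint a t (fun u => K * rho tau * expR (- e * (tau - t)) *
    (expR (- e * (t - u)) * b u)))); last first.
  rewrite ointZ//; apply: ler_wpM2l; first by rewrite !mulr_ge0 ?expR_ge0// ltW.
  exact: (oint_decay_left b_locint b_ge0 r0_gt0 b_window e_gt0 at_).
apply: norm_vint_le => //; last 2 first.
  - exact: locintZ.
  - move=> u /andP[au ut]; have utau : u <= tau by lra.
    apply: (le_trans (stable_bound _ utau)).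
    have -> : K * rho tau * expR (- e * (tau - t)) * (expR (- e * (t - u)) * b u) =
      K * expR (- alpha * (tau - u)) * (b u * (expR (beta * `|tau - u|) * rho tau)).
      have -> : K * expR (- alpha * (tau - u)) * (b u * (expR (beta * `|tau - u|) * rho tau)) =
        K * rho tau * (expR (- alpha * (tau - u)) * expR (beta * `|tau - u|)) * b u by ring.
      have -> : K * rho tau * expR (- e * (tau - t)) * (expR (- e * (t - u)) * b u) =
        K * rho tau * (expR (- e * (tau - t)) * expR (- e * (t - u))) * b u by ring.
      rewrite -!expRD ger0_norm ?subr_ge0//; congr (_ * expR _ * _); rewrite /e; ring.
    apply: ler_wpM2l; first by rewrite mulr_ge0 ?expR_ge0// ltW.
    by apply: (le_trans (f_bound u)); apply: ler_wpM2l.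
by move=> i; apply: vlocint_mulmx => j; exact: vlocint_mulmx.
Qed.

Let unstable_part t c tau : tau <= t -> t <= c ->
  N (X tau *m ((1%:M - P0) *m vint t c (fun u => Y u *m f u))) <=
  K * rho tau * expR (- e * (t - tau)) * C.
Proof.
move=> taut tc; rewrite vint_mulmx// vint_mulmx; last first.
  by move=> i; exact: vlocint_mulmx.
have ll := locint_expr b_locint e t.
apply: (@le_trans _ _ (oint t c (fun u => K * rho tau * expR (- e * (t - tau)) *
    (expR (- e * (u - t)) * b u)))); last first.
  rewrite ointZ//; apply: ler_wpM2l; first by rewrite !mulr_ge0 ?expR_ge0// ltW.
  exact: (oint_decay_right b_locint b_ge0 r0_gt0 b_window e_gt0 tc).
apply: norm_vint_le => //; last 2 first.
  - exact: locintZ.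
  - move=> u /andP[tu uc]; have utau : tau <= u by lra.
    apply: (le_trans (unstable_bound _ utau)).
    have -> : K * rho tau * expR (- e * (t - tau)) * (expR (- e * (u - t)) * b u) =
      K * expR (- alpha * (u - tau)) * (b u * (expR (beta * `|tau - u|) * rho tau)).
      have -> : K * expR (- alpha * (u - tau)) * (b u * (expR (beta * `|tau - u|) * rho tau)) =
        K * rho tau * (expR (- alpha * (u - tau)) * expR (beta * `|tau - u|)) * b u by ring.
      have -> : K * rho tau * expR (- e * (t - tau)) * (expR (- e * (u - t)) * b u) =
        K * rho tau * (expR (- e * (t - tau)) * expR (- e * (u - t))) * b u by ring.
      rewrite -!expRD ler0_norm ?subr_le0//; congr (_ * expR _ * _); rewrite /e; ring.
    apply: ler_wpM2l; first by rewrite mulr_ge0 ?expR_ge0// ltW.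
    by apply: (le_trans (f_bound u)); apply: ler_wpM2l.
by move=> i; apply: vlocint_mulmx => j; exact: vlocint_mulmx.
Qed.

(** The solution is the Green operator of the dichotomy applied to [f]: the stable part of [f]
    is integrated from the past, the unstable part from the future. In place of integrals
    over half-lines it is the limit of the solutions [X t *m v k t] driven by [f] on
    [-k, k], which all satisfy the bound for [t] in [-k, k]. *)
Lemma ode_admissible : exists2 w, mprim w (fun t => A t *m w t + f t) &
  forall t, N (w t) <= 2 * K * C * rho t.
Proof.
pose h u := Y u *m f u.
pose v (k : nat) t := P0 *m vint (- k%:R) t h - (1%:M - P0) *m vint t k%:R h.
have hl : vlocint h by exact: Yf_locint.
have vE k t : v k t = v k 0 + vint 0 t h.
  rewrite /v (vint_cat (- k%:R) 0 t hl) (vint_cat 0 t k%:R hl).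
  move: (vint (- k%:R) 0 h) (vint 0 t h) (vint t k%:R h) => v1 v2 v3.
  rewrite mulmxDr mulmxDr !mulmxBl !mul1mx; vring.
have vB (k : nat) t : - k%:R <= t -> t <= k%:R -> N (X t *m v k t) <= 2 * K * C * rho t.
  move=> kt tk; rewrite /v mulmxBr; apply: (le_trans (ler_euclid_normB _ _)).
  have := stable_part kt (lexx t); have := unstable_part (lexx t) tk.
  rewrite subrr mulr0 expR0 mulr1 -/h => h1 h2.
  apply: (le_trans (lerD h2 h1)); rewrite le_eqVlt; apply/orP; left; apply/eqP; ring.
pose d (k : nat) := X 0 *m v k 0.
have dB k j : N (d (k + j)%N - d k) <= expR (- e) ^+ k * (2 * K * C * rho 0).
  have ce : expR (- e) ^+ k = expR (- e * k%:R) by rewrite mulrC expRM_natl.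
  have kj : k%:R <= (k + j)%:R :> R by rewrite ler_nat leq_addr.
  have k0 : 0 <= k%:R :> R by [].
  have -> : d (k + j)%N - d k = X 0 *m (P0 *m vint (- (k + j)%:R) (- k%:R) h) -
      X 0 *m ((1%:M - P0) *m vint k%:R (k + j)%:R h).
    rewrite /d /v (vint_cat (- (k + j)%:R) (- k%:R) 0 hl) (vint_cat 0 k%:R (k + j)%:R hl).
    move: (vint (- (k + j)%:R) (- k%:R) h) (vint (- k%:R) 0 h) (vint 0 k%:R h)
      (vint k%:R (k + j)%:R h) => v1 v2 v3 v4.
    rewrite -!mulmxBr; congr (_ *m _); rewrite !mulmxDr; vring.
  apply: (le_trans (ler_euclid_normB _ _)).
  have h1 : N (X 0 *m (P0 *m vint (- (k + j)%:R) (- k%:R) h)) <=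
     K * rho 0 * expR (- e * (0 - - k%:R)) * C by apply: stable_part; lra.
  have h2 : N (X 0 *m ((1%:M - P0) *m vint k%:R (k + j)%:R h)) <=
     K * rho 0 * expR (- e * (k%:R - 0)) * C by apply: unstable_part; lra.
  rewrite ce; move: h1 h2; rewrite sub0r opprK subr0 => h1 h2.
  apply: (le_trans (lerD h1 h2)); rewrite le_eqVlt; apply/orP; left; apply/eqP; ring.
have [c0 c1] : 0 <= expR (- e) /\ expR (- e) < 1 by rewrite expR_ge0 expR_lt1 oppr_lt0.
have [l hl'] := geometric_limit_euclid c0 dB.
pose w t := X t *m (Y 0 *m l + vint 0 t h).
exists w; first by have [] := variation_of_constants X_prim Y_prim YX (Y 0 *m l) f_locint.
move=> t; apply/ler_addgt0Pr => e1 e10.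
have [D D0 hD] := mulmx_bound (X t *m Y 0).
have [k0 hk0] := exprn_small (D * (n%:R * (2 * K * C * rho 0))) c0 c1 e10.
pose k := maxn k0 (Num.truncn `|t|).+1.
have tk : `|t| <= k%:R.
  apply: le_trans (_ : ((Num.truncn `|t|).+1)%:R <= _); last by rewrite ler_nat leq_maxr.
  by rewrite ltW// truncnS_gt.
have -> : w t = X t *m v k t + (X t *m Y 0) *m (l - d k).
  have YX0 : Y 0 *m (X 0 *m v k 0) = v k 0 by rewrite mulmxA YX mul1mx.
  rewrite vE /d /w -(mulmxA (X t)) mulmxBr YX0 -mulmxDr; congr (_ *m _); vring.
apply: (le_trans (ler_euclid_normD _ _)); apply: lerD.
  by apply: vB; move: tk; rewrite ler_norml; lra.
apply: (le_trans (hD _)); apply: le_trans (ltW hk0).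
rewrite mulrCA; apply: ler_wpM2l => //; apply: (le_trans (hl' k)).
apply: ler_wpM2r; first by apply: mulr_ge0 => //; do 2 (apply: mulr_ge0 => //); apply: mulr_ge0 => //; exact: ltW.
have km : (k0 <= k)%N by rewrite leq_maxl.
by rewrite -(subnKC km) exprD ler_piMr ?exprn_ge0// exprn_ile1// ltW.
Qed.

End bounded_solutions.

(** * Bounded solutions of the delay equation *)


Lemma regroup_difference (R : realType) n (p q l l' u v f : 'cV[R]_n) :
  p - q + (l - l' - (u - v)) = p + (l - u + f) - (q + (l' - v + f)).
Proof. vring. Qed.

Lemma regroup_fixpoint (R : realType) n (p l f : 'cV[R]_n) : p + (l - p + f) = l + f.
Proof. vring. Qed.

Section delay_admissibility.
Variables (R : realType) (n : nat) (alpha K : R) (A X Y : R -> 'M[R]_n) (P0 : 'M[R]_n).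
Local Notation N := (@euclid_norm R n).
Hypothesis alpha_gt0 : 0 < alpha.
Hypothesis K_gt0 : 0 < K.
Hypothesis X_prim : mprim X (fun t => A t *m X t).
Hypothesis Y_prim : mprim Y (fun t => - (Y t *m A t)).
Hypothesis YX : forall t, Y t *m X t = 1%:M.
Hypothesis stable_bound : forall t u v, u <= t ->
  N (X t *m (P0 *m (Y u *m v))) <= K * expR (- alpha * (t - u)) * N v.
Hypothesis unstable_bound : forall t u v, t <= u ->
  N (X t *m ((1%:M - P0) *m (Y u *m v))) <= K * expR (- alpha * (u - t)) * N v.
Variables (r r0 m : R) (b : R -> R).
Variable L : R -> (R -> 'cV[R]_n) -> 'cV[R]_n.
Hypothesis r_ge0 : 0 <= r.
Hypothesis r_le : r <= r0.
Hypothesis r0_gt0 : 0 < r0.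
Hypothesis b_locint : locint b.
Hypothesis b_ge0 : forall t, 0 <= b t.
Hypothesis b_window : forall t, oint t (t + r0) b <= m.
Hypothesis L_linear : forall t (k : R) (x y : R -> 'cV[R]_n), continuous x -> continuous y ->
  L t (fun s => k *: x s + y s) = k *: L t x + L t y.
Hypothesis L_bound : forall t (y : R -> 'cV[R]_n) B, continuous y ->
  (forall s, t - r <= s <= t -> N (y s) <= B) -> N (L t y) <= b t * B.
Hypothesis L_vlocint : forall y : R -> 'cV[R]_n, continuous y -> vlocint (fun t => L t y).
Hypothesis L_cst : forall t c, L t (fun=> c) = A t *m c.
Hypothesis A_locint : forall i j, locint (fun t => A t i j).

Variable beta : R.
Hypothesis beta_ge0 : 0 <= beta.
Hypothesis beta_lt : beta < alpha.

(** Weights that vary by at most the factor [exp (beta * |t - u|)]; the estimates for all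
    decay rates, and for merely bounded functions, come from one choice of weight each. *)
Definition slow_weight (rho : R -> R) := [/\ forall t, 0 <= rho t,
  forall t u, rho u <= expR (beta * `|t - u|) * rho t, continuous rho &
  exists B, forall t, rho t <= B].

Definition oscillation_le (x : R -> 'cV[R]_n) (h : R -> R) :=
  forall t s, t - r <= s <= t -> N (x s - x t) <= h t.

(** The norm of the Green operator from the inhomogeneities of window mass [mg] to the
    functions with weight. *)
Definition gain (mg : R) := 2 * K * decay_const r0 mg (alpha - beta).

Lemma slow_weightZ a rho : 0 <= a -> slow_weight rho -> slow_weight (fun t => a * rho t).
Proof.
move=> a0 [p s c [B hB]]; split.
- by move=> t; rewrite mulr_ge0.
- by move=> t u; rewrite mulrCA ler_wpM2l.
- by move=> t; apply: cvgM; [exact: cvg_cst|exact: c].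
- by exists (a * B) => t; rewrite ler_wpM2l.
Qed.

Lemma coefficient_bound t v : N (A t *m v) <= b t * N v.
Proof. by rewrite -L_cst; apply: L_bound => // s; exact: cvg_cst. Qed.

Lemma gain_ge0 mg : 0 <= mg -> 0 <= gain mg.
Proof.
move=> mg0; rewrite /gain /decay_const !mulr_ge0 ?invr_ge0 ?(ltW K_gt0)// subr_ge0 expR_le1.
by rewrite mulNr oppr_le0 mulr_ge0 ?subr_ge0 ?(ltW r0_gt0)// ltW.
Qed.

(** By uniqueness a bounded solution is the one given by the Green operator. Over one delay it
    changes at most by the integral of the norm of its derivative [A t *m z t + g t] over a
    window, so that its oscillation is small with [r0] even if its values are not. *)
Lemma bounded_response (z g : R -> 'cV[R]_n) (bg rho : R -> R) mg B :
  slow_weight rho -> locint bg -> (forall t, 0 <= bg t) ->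
  (forall t, oint t (t + r0) bg <= mg) -> vlocint g ->
  (forall t, N (g t) <= bg t * rho t) ->
  mprim z (fun t => A t *m z t + g t) -> (forall t, N (z t) <= B) ->
  (forall t, N (z t) <= gain mg * rho t) /\
  oscillation_le z (fun t => (gain mg * m + mg) * expR (beta * r0) * rho t).
Proof.
move=> [rho0 rhos crho [Br hBr]] lbg bg0 bgw lg gB pz zB.
have [w pw hw] := ode_admissible K_gt0 X_prim Y_prim YX stable_bound unstable_bound
  beta_lt r0_gt0 lbg bg0 bgw rho0 rhos lg gB.
have mg0 := window_ge0 bg0 r0_gt0 bgw; have g0 := gain_ge0 mg0.
have zw t : z t = w t.
  apply/eqP; rewrite -subr_eq0; apply/eqP.
  apply: (bounded_ode_solution_eq0 K_gt0 Y_prim YX stable_bound unstable_bound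
    (x := fun t => z t - w t) (B := B + gain mg * Br)) => //.
    apply: eq_mprim (mprimB pz pw) => u.
    by rewrite mulmxBr opprD addrACA subrr addr0.
  move=> u; apply: (le_trans (ler_euclid_normB _ _)); apply: lerD => //.
  by apply: (le_trans (hw u)); rewrite ler_wpM2l.
have zrho t : N (z t) <= gain mg * rho t by rewrite zw; exact: hw.
split=> // t s /andP[ts st].
have [lz zE] := vint_mprim pz.
rewrite euclid_distC zE.
have m0 := window_ge0 b_ge0 r0_gt0 b_window.
pose E := expR (beta * r0) * rho t.
have E0 : 0 <= E by rewrite mulr_ge0 ?expR_ge0.
apply: (@le_trans _ _ (oint s t (fun u => gain mg * E * b u + E * bg u))).
  apply: norm_vint_le => //; first by apply: locintD; exact: locintZ.
  move=> u /andP[su ut].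
  have rE : rho u <= E.
    apply: (le_trans (rhos t u)); apply: ler_wpM2r => //; rewrite ler_expR ler_wpM2l//.
    rewrite ger0_norm ?subr_ge0//; have rr := r_le; lra.
  apply: (le_trans (ler_euclid_normD _ _)); apply: lerD.
    apply: (le_trans (coefficient_bound _ _)); rewrite mulrC; apply: ler_wpM2r => //.
    by apply: (le_trans (zrho u)); rewrite ler_wpM2l.
  by apply: (le_trans (gB u)); rewrite mulrC ler_wpM2r.
rewrite ointD; [|exact: locintZ|exact: locintZ]; rewrite !ointZ//.
have tr : t <= s + r0 by have rr := r_le; lra.
have h1 : oint s t b <= m by exact: (window_le b_locint b_ge0 b_window st tr).
have h2 : oint s t bg <= mg by exact: (window_le lbg bg0 bgw st tr).
have -> : (gain mg * m + mg) * expR (beta * r0) * rho t = gain mg * E * m + E * mg.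
  by rewrite /E; ring.
by apply: lerD; apply: ler_wpM2l => //; exact: mulr_ge0.
Qed.

Let functionalB' t (x y : R -> 'cV[R]_n) : continuous x -> continuous y ->
  L t (fun s => x s - y s) = L t x - L t y.
Proof. exact: (functionalB L_linear). Qed.

(** On the constant history [x t] the delay functional gives [A t *m x t], so the defect is
    governed by the oscillation of [x] over one delay only. *)
Lemma defect_bound (x : R -> 'cV[R]_n) (h : R -> R) t : continuous x ->
  oscillation_le x h -> N (L t x - A t *m x t) <= b t * h t.
Proof.
move=> cx hx; have cc : continuous (fun _ : R => x t) by move=> s; exact: cvg_cst.
rewrite -L_cst -functionalB'//; apply: L_bound; last exact: hx.
exact: continuousB_euclid.
Qed.

Lemma defect_locint (x : R -> 'cV[R]_n) : continuous x ->
  vlocint (fun t => L t x - A t *m x t).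
Proof.
by move=> cx; apply: vlocintB; [exact: L_vlocint|exact: vlocint_matrix_mul].
Qed.

Variable c : R.
Hypothesis c_gt0 : 0 < c.
Hypothesis c_lt1 : c < 1.
Hypothesis c_contraction : (gain m * m + m) * expR (beta * r0) <= c.

Lemma defect_response (z x : R -> 'cV[R]_n) (rho : R -> R) a B : 0 <= a ->
  slow_weight rho -> continuous x -> oscillation_le x (fun t => a * rho t) ->
  mprim z (fun t => A t *m z t + (L t x - A t *m x t)) -> (forall t, N (z t) <= B) ->
  (forall t, N (z t) <= gain m * (a * rho t)) /\
  oscillation_le z (fun t => c * a * rho t).
Proof.
move=> a0 rhow cx hx pz zB.
have [h1 h2] := bounded_response (slow_weightZ a0 rhow) b_locint b_ge0 b_window
  (defect_locint cx) (fun t => defect_bound t cx hx) pz zB.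
split=> // t s ts; apply: (le_trans (h2 t s ts)); rewrite -(mulrA c).
by apply: ler_wpM2r => //; case: rhow => rho0 _ _ _; exact: mulr_ge0.
Qed.

(** The solution is its own response, so its oscillation is at most [c] times itself, hence 0;
    then the defect vanishes, and so does the solution. *)
Lemma bounded_delay_solution_eq0 (w : R -> 'cV[R]_n) B : beta = 0 ->
  mprim w (fun t => L t w) -> (forall t, N (w t) <= B) -> forall t, w t = 0.
Proof.
move=> b00 pw wB.
have B0 : 0 <= B by apply: le_trans (wB 0); exact: euclid_norm_ge0.
have rho1 : slow_weight (fun=> 1).
  split=> //; [by move=> t u; rewrite b00 mul0r expR0 mulr1|by move=> t; exact: cvg_cst|].
  by exists 1.
have cw := mprim_continuous pw.
have pw' : mprim w (fun t => A t *m w t + (L t w - A t *m w t)).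
  by apply: eq_mprim pw => t; rewrite addrC subrK.
have c0 := ltW c_gt0.
have osc (k : nat) : oscillation_le w (fun t => c ^+ k * (2 * B) * 1).
  elim: k => [|k ih] t s ts.
    rewrite expr0 mul1r mulr1; apply: (le_trans (ler_euclid_normB _ _)).
    by have := wB t; have := wB s; lra.
  have a0 : 0 <= c ^+ k * (2 * B) by rewrite mulr_ge0 ?exprn_ge0//; lra.
  have [_ /(_ t s ts)] := defect_response a0 rho1 cw ih pw' wB.
  by rewrite exprS !mulrA.
move=> t; apply: (@geometric_vanish _ _ c (gain m * (2 * B))) => // k.
have a0 : 0 <= c ^+ k * (2 * B) by rewrite mulr_ge0 ?exprn_ge0//; lra.
have [/(_ t) + _] := defect_response a0 rho1 cw (osc k) pw' wB.
by rewrite mulr1 mulrCA.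
Qed.

(** The map that sends [x] to the bounded response [z] of the ordinary differential equation to
    the defect of [x] plus [f] contracts oscillations. The size of [x] therefore measures
    the oscillation, and the values with the relative weight [kap], large enough for the
    contraction factor [c] to hold for them, too. *)
Lemma delay_admissible mf : 0 <= mf -> exists2 D, 0 <= D &
  forall (rho bf : R -> R) (f : R -> 'cV[R]_n),
  slow_weight rho -> locint bf -> (forall t, 0 <= bf t) ->
  (forall t, oint t (t + r0) bf <= mf) -> vlocint f ->
  (forall t, N (f t) <= bf t * rho t) ->
  exists2 w, mprim w (fun t => L t w + f t) & forall t, N (w t) <= D * rho t.
Proof.
move=> mf0; have m0 := window_ge0 b_ge0 r0_gt0 b_window.
have gm0 := gain_ge0 m0; have gf0 := gain_ge0 mf0; have c0 := ltW c_gt0.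
pose kap := gain m / c + 1.
have kap1 : 1 <= kap by rewrite /kap lerDr divr_ge0.
have kap0 : 0 <= kap by exact: le_trans kap1.
pose a0 := gain mf + (gain mf * m + mf) * expR (beta * r0).
have a02 : 0 <= (gain mf * m + mf) * expR (beta * r0).
  by rewrite mulr_ge0 ?expR_ge0// addr_ge0// mulr_ge0.
have a00 : 0 <= a0 by rewrite addr_ge0.
exists (a0 / (1 - c) * kap).
  by rewrite mulr_ge0// divr_ge0// subr_ge0 ltW.
move=> rho bf f rhow lbf bf0 bfw lf fB.
have [rho0 rhos crho [Br hBr]] := rhow.
pose S (x : R -> 'cV[R]_n) a := (forall t, N (x t) <= a * (kap * rho t)) /\
   oscillation_le x (fun t => a * rho t).
pose spec x z := mprim z (fun t => A t *m z t + (L t x - A t *m x t + f t)) /\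
  exists B, forall t, N (z t) <= B.
(* Only functions of finite size have a response. The others are sent to 0, and [F] still
   contracts, because two functions at finite distance are of the same kind. *)
pose F (x : R -> 'cV[R]_n) : R -> 'cV[R]_n :=
  if `[< exists a, S x a >] then xget (fun=> 0) [set z | spec x z] else fun=> 0.
have SF x a : continuous x -> S x a -> 0 <= a -> spec x (F x).
  move=> cx Sx a0'; rewrite /F; case: asboolP => [_|[]]; last by exists a.
  have [_ ox] := Sx; apply: (@xgetPex _ (fun=> 0) [set z | spec x z]).
  have ll : locint (fun t => a * b t + bf t) by apply: locintD => //; exact: locintZ.
  have l0 t : 0 <= a * b t + bf t by rewrite addr_ge0// mulr_ge0.
  have lw t : oint t (t + r0) (fun t => a * b t + bf t) <= a * m + mf.
    rewrite ointD//; last exact: locintZ.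
    by rewrite ointZ//; apply: lerD => //; exact: ler_wpM2l.
  have gl : vlocint (fun t => L t x - A t *m x t + f t).
    by apply: vlocintD => //; exact: defect_locint.
  have gB t : N (L t x - A t *m x t + f t) <= (a * b t + bf t) * rho t.
    apply: (le_trans (ler_euclid_normD _ _)); rewrite mulrDl; apply: lerD => //.
    by apply: (le_trans (defect_bound t cx ox)); rewrite mulrCA mulrA.
  have [z pz hz] := ode_admissible K_gt0 X_prim Y_prim YX stable_bound unstable_bound
    beta_lt r0_gt0 ll l0 lw rho0 rhos gl gB.
  exists z; split => //; exists (gain (a * m + mf) * Br) => t.
  apply: (le_trans (hz t)); apply: ler_wpM2l => //; apply: gain_ge0.
  by rewrite addr_ge0// mulr_ge0.
have SD x y a d : S x a -> S y d -> S (fun t => x t + y t) (a + d).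
  move=> [x1 x2] [y1 y2]; split=> [t|t s ts].
    by rewrite mulrDl (le_trans (ler_euclid_normD _ _))// lerD.
  have -> : x s + y s - (x t + y t) = (x s - x t) + (y s - y t) by vring.
  by rewrite mulrDl (le_trans (ler_euclid_normD _ _))// lerD// ?x2 ?y2.
have SN x a : S x a -> S (fun t => - x t) a.
  move=> [x1 x2]; split=> [t|t s ts]; first by rewrite euclid_normN.
  by have := x2 t s ts; rewrite euclid_distC; congr (N _ <= _); vring.
have Fc x : continuous x -> continuous (F x).
  move=> cx; rewrite /F; case: ifP => _; last by move=> t; exact: cvg_cst.
  by case: xgetP => [z _ [/mprim_continuous pz _]//|_] t; exact: cvg_cst.
have Fbad x : ~ (exists a, S x a) -> F x = fun=> 0 by move=> nx; rewrite /F asboolF.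
clearbody F.
have S0 a : 0 <= a -> S (fun=> 0) a.
  by move=> a0'; split=> [t|t s _]; rewrite ?subrr euclid_norm0 !mulr_ge0.
have [rhoz|/existsNP[t0 rhot0]] := pselect (forall t, rho t = 0).
  have f0 t : f t = 0.
    apply/euclid_norm_eq0/eqP; rewrite eq_le euclid_norm_ge0 andbT.
    by apply: (le_trans (fB t)); rewrite rhoz mulr0.
  exists (fun=> 0); last by move=> t; rewrite euclid_norm0 rhoz mulr0.
  apply: (@eq_mprim _ _ _ _ (fun=> 0)).
    by move=> t; rewrite L_cst mulmx0 f0 addr0.
  move=> i j; split; first by apply: eq_locint (locint_cst 0) => t; rewrite mxE.
  move=> s t; have -> : (fun _ : R => (0 : 'cV[R]_n) i j) = fun=> 0 by apply/funext => u; rewrite mxE.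
  by rewrite oint_cst mul0r subrr.
have {}rhot0 : 0 < rho t0 by rewrite lt_neqAle rho0 andbT eq_sym; exact/eqP.
have Sa x a : S x a -> 0 <= a.
  move=> [/(_ t0) h _]; have : 0 <= a * (kap * rho t0) := le_trans (euclid_norm_ge0 _) h.
  rewrite pmulr_lge0// mulr_gt0//; exact: lt_le_trans kap1.
have ckap : gain m <= c * kap.
  by rewrite /kap mulrDr mulr1 mulrCA divff ?mulr1 ?lerDl// gt_eqF.
have [||||||||||||w [cw Fw Sw]] := @weighted_fixpoint R n S F (fun t => kap * rho t) c a0 (fun=> 0).
- exact: c0.
- exact: c_lt1.
- by move=> t; apply: cvgM; [exact: cvg_cst|exact: crho].
- by move=> x a [].
- exact: S0.
- exact: SD.
- move=> x a h; split=> [t|t s ts]; apply/ler_addgt0Pr => e e0.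
    have [y [[y1 _] h1 _]] := h t t e e0; have := y1 t.
    have := ler_euclid_normD (y t) (x t - y t); rewrite addrC subrK; lra.
  have e2 : 0 < e / 2 by lra.
  have [y [[_ y2] h1 h2]] := h t s _ e2; have := y2 t s ts.
  have -> : x s - x t = (y s - y t) + ((x s - y s) - (x t - y t)) by vring.
  have := ler_euclid_normD (y s - y t) ((x s - y s) - (x t - y t)).
  have := ler_euclid_normB (x s - y s) (x t - y t); lra.
- exact: Fc.
- move=> x y a cx cy Sxy; have aa := Sa _ _ Sxy.
  have [[a1 Sx]|nx] := pselect (exists a, S x a); last first.
    have ny : ~ exists a, S y a.
      move=> [a1 Sy]; apply: nx; exists (a + a1).
      by have := SD _ _ _ _ Sxy Sy; congr S; apply/funext => t; rewrite subrK.
    have -> : (fun t => F x t - F y t) = fun=> 0.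
      by apply/funext => t; rewrite !Fbad// subrr.
    by apply: S0; exact: mulr_ge0.
  have Sy : S y (a1 + a).
    have := SD _ _ _ _ Sx (SN _ _ Sxy); congr S; apply/funext => t; vring.
  have [px [Bx hBx]] := SF _ _ cx Sx (Sa _ _ Sx).
  have [py [By hBy]] := SF _ _ cy Sy (Sa _ _ Sy).
  have cd : continuous (fun t => x t - y t) by exact: continuousB_euclid.
  have pz : mprim (fun t => F x t - F y t) (fun t => A t *m (F x t - F y t) +
      (L t (fun s => x s - y s) - A t *m (x t - y t))).
    apply: eq_mprim (mprimB px py) => t; rewrite functionalB'// !mulmxBr.
    exact/esym/regroup_difference.
  have zB t : N (F x t - F y t) <= Bx + By.
    by apply: (le_trans (ler_euclid_normB _ _)); exact: lerD.
  have [_ oxy] := Sxy.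
  have [h1 h2] := defect_response aa rhow cd oxy pz zB.
  split=> // t; apply: (le_trans (h1 t)).
  have -> : c * a * (kap * rho t) = (c * kap) * (a * rho t) by ring.
  by apply: ler_wpM2r => //; exact: mulr_ge0.
- by move=> t; exact: cvg_cst.
- exact: a00.
- have [p0 [B0 hB0]] := SF _ 0 (fun t => cvg_cst _) (S0 0 (lexx 0)) (lexx 0).
  have p0' : mprim (F (fun=> 0)) (fun t => A t *m F (fun=> 0) t + f t).
    by apply: eq_mprim p0 => t; rewrite L_cst !mulmx0 subrr add0r.
  have [h1 h2] := bounded_response rhow lbf bf0 bfw lf fB p0' hB0.
  have E0 : S (F (fun=> 0)) a0.
    split=> [t|t s ts].
      apply: (le_trans (h1 t)); rewrite mulrA; apply: ler_wpM2r => //.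
      apply: (@le_trans _ _ a0); first by rewrite /a0 lerDl.
      by rewrite ler_peMr.
    by apply: (le_trans (h2 t s ts)); apply: ler_wpM2r => //; rewrite /a0 lerDr.
  by move: E0; congr S; apply/funext => t; rewrite subr0.
have {}Sw : S w (a0 / (1 - c)) by move: Sw; congr S; apply/funext => t; rewrite subr0.
have [pw _] := SF _ _ cw Sw (Sa _ _ Sw).
exists w; last by move=> t; have [/(_ t) + _] := Sw; rewrite mulrA.
by rewrite Fw in pw; apply: eq_mprim pw => t; exact: regroup_fixpoint.
Qed.

End delay_admissibility.

(** * The delay equation in integrated form *)


Section delay_solutions.
Variables (R : realType) (n : nat) (r : R) (eta : R -> R -> 'M[R]_n).
Local Notation N := (@euclid_norm R n).
Local Notation leb := (@lebesgue_measure R).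
Hypothesis r_gt0 : 0 < r.
Hypothesis eta_bv : forall t i j, bounded_variation (- r) 0 (fun th => eta t th i j).
Hypothesis eta_meas : forall (phi : cseg n r) i,
        lebesgue_measurable_fun (fun t => delay_op r eta t phi i ord0).
Hypothesis eta_int : loc_integrable (delay_op_norm r eta).
Implicit Types (x y z : R -> 'cV[R]_n) (s t : R) (phi psi : cseg n r).

Definition delay_rhs t y := delay_op r eta t (fun th => y (t + th)).
Local Notation L := delay_rhs.
Local Notation b := (delay_bound r eta).

Lemma delay_rhs_linear t (k : R) x y : continuous x -> continuous y ->
  L t (fun s => k *: x s + y s) = k *: L t x + L t y.
Proof.
move=> cx cy.
exact: (delay_op_linear r_gt0 eta_bv t k (continuous_history (t := t) cx)
  (continuous_history (t := t) cy)).
Qed.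

Lemma delay_rhs_bound t y (B : R) : continuous y ->
  (forall s, t - r <= s <= t -> N (y s) <= B) -> N (L t y) <= b t * B.
Proof.
move=> cy yB.
apply: (delay_op_le r_gt0 eta_bv t (continuous_history (t := t) cy)) => th hth.
by apply: yB; lra.
Qed.

Lemma delay_rhs_vlocint y : continuous y -> vlocint (fun t => L t y).
Proof. exact: delay_op_vlocint. Qed.

Lemma delay_rhs_cst t c : L t (fun=> c) = (eta t 0 - eta t (- r)) *m c.
Proof. exact: delay_op_cst. Qed.

Lemma eq_delay_rhs t x y : continuous x -> (forall s, t - r <= s <= t -> x s = y s) ->
  L t y = L t x.
Proof.
move=> cx xy.
apply: (eq_delay_op r_gt0 eta_bv t (continuous_history (t := t) cx)) => th hth.
by apply: xy; lra.
Qed.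

(** Solutions on [s, +oo[ in integrated form. Extending them continuously to the whole line
    spares all the restrictions of domains. *)
Definition solves_from s y := continuous y /\
  forall t, s <= t -> y t - y s = vint s t (fun u => L u y).

Definition has_history s y phi := forall th, - r <= th <= 0 -> y (s + th) = phi th.

Lemma solves_from_cat s y : solves_from s y -> forall u v, s <= u -> u <= v ->
  y v - y u = vint u v (fun w => L w y).
Proof.
move=> [cy hy] u v su uv; have lL := delay_rhs_vlocint cy.
have -> : y v - y u = (y v - y s) - (y u - y s) by vring.
rewrite !hy// ?(le_trans su)// (vint_cat s u v lL); vring.
Qed.

Lemma solves_from_le s t y : s <= t -> solves_from s y -> solves_from t y.
Proof.
move=> st sy; split; first by case: sy.
by move=> u tu; exact: solves_from_cat st tu.
Qed.

Lemma mprim_solves_from s y : mprim y (fun t => L t y) -> solves_from s y.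
Proof.
move=> py; split; first exact: mprim_continuous py.
by move=> t _; have [_ ->] := vint_mprim py.
Qed.

Lemma solves_from_lin s k x y : solves_from s x -> solves_from s y ->
  solves_from s (fun t => k *: x t + y t).
Proof.
move=> [cx hx] [cy hy]; split; first exact: continuous_linear_comb.
move=> t st; have lx := delay_rhs_vlocint cx; have ly := delay_rhs_vlocint cy.
have -> : k *: x t + y t - (k *: x s + y s) = k *: (x t - x s) + (y t - y s) by vring.
rewrite hx// hy// -vintZ// -vintD//; last exact: vlocintZ.
by congr vint; apply/funext => u; rewrite delay_rhs_linear.
Qed.

Lemma mprim_delay_lin k x y : mprim x (fun t => L t x) -> mprim y (fun t => L t y) ->
  mprim (fun t => k *: x t + y t) (fun t => L t (fun s => k *: x s + y s)).
Proof.
move=> px py; apply: eq_mprim (mprim_lin k px py) => t.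
exact/esym/(delay_rhs_linear t k (mprim_continuous px) (mprim_continuous py)).
Qed.

Lemma solves_from_delay_solution s y phi : solves_from s y -> has_history s y phi ->
  delay_solution eta s phi y.
Proof.
move=> sy hphi; have [cy hy] := sy; have lL := delay_rhs_vlocint cy; split.
- exact: continuous_subspaceT.
- by move=> th; rewrite in_itv; exact: hphi.
- move=> c sc; apply: (abs_continuous_vint lL) => u v su uv _; exact: solves_from_cat su uv.
have FF := ae_filter_ringOfSetsType leb.
have nes : {ae leb, forall t, t != s}.
  exists [set s]; split; [exact: measurable_set1|exact: lebesgue_measure_set1|].
  by move=> t /= /negP; rewrite negbK => /eqP.
have D := ae_is_derive_vint s lL.
move: nes D; apply: filterS2 => t ts D st.
have {ts}st : s < t by rewrite lt_neqAle eq_sym ts.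
have cd : is_derive t (1 : R) (fun=> y s) 0 by exact: is_derive_cst.
have := is_deriveD cd D; rewrite add0r; apply: near_eq_is_derive.
near=> u; rewrite -[LHS]/(y s + vint s u (fun t => L t y)) -hy; first vring.
by apply: ltW; near: u; exact: lt_nbhsr.
Unshelve. all: by end_near. Qed.

(** The extension is constant before [s - r]. *)
Lemma delay_solution_solves_from s x phi : delay_solution eta s phi x ->
  exists y, [/\ solves_from s y, has_history s y phi & forall t, s - r <= t -> y t = x t].
Proof.
move=> [cx hphi acx Dx]; have rr := r_gt0.
pose y t := x (Num.max t (s - r)).
have yx t : s - r <= t -> y t = x t by move=> h; rewrite /y (max_idPl h).
have cy : continuous y.
  move=> t; apply/continuous_euclid => e e0.
  have ht : s - r <= Num.max t (s - r) by rewrite le_max lexx orbT.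
  have /subspace_continuousP/(_ (Num.max t (s - r))) := cx.
  rewrite /= in_itv/= andbT => /(_ ht)/cvg_euclid_norm/(_ e e0).
  rewrite near_withinE => -[d /= d0 hd]; exists d => // u ut; apply: hd.
    rewrite /= distrC; apply: le_lt_trans ut; rewrite ler_norml !maxEle.
    have := ler_norm (u - t); have := ler_norm (t - u); rewrite (distrC t).
    by do ! case: ifPn => [|/negP/negP]; rewrite -?ltNge; lra.
  by rewrite in_itv/= andbT le_max lexx orbT.
exists y; split => //; last first.
  by move=> th hth; rewrite yx; [apply: hphi; rewrite in_itv|lra].
split=> // t st; apply: vint_derivative => //; first exact: delay_rhs_vlocint.
  move=> e e0; have [d d0 hd] := acx t st e e0; exists d => // m u v uv tI sd.
  apply: le_lt_trans (hd m u v uv tI sd); apply: ler_sum => i _.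
  by have [h1 h2 h3] := uv i; rewrite !yx//; lra.
have FF := ae_filter_ringOfSetsType leb.
apply: filterS Dx => u Du /andP[su ut].
have -> : L u y = delay_op r eta u (fun th => x (u + th)).
  apply/esym/(eq_delay_op r_gt0 eta_bv u (continuous_history (t := u) cy)).
  by move=> th hth; rewrite yx//; lra.
apply: near_eq_is_derive (Du (ltW su)); near=> w; rewrite yx//.
by apply: ltW; near: w; apply: lt_nbhsr; lra.
Unshelve. all: by end_near. Qed.

Variables (r0 m : R).
Hypothesis r0_gt0 : 0 < r0.
Hypothesis b_window : forall t, oint t (t + r0) b <= m.
Hypothesis m_small : m <= 1 / 4.

Let b_locint : locint b. Proof. exact: delay_bound_locint. Qed.
Let b_ge0 t : 0 <= b t. Proof. exact: delay_bound_ge0. Qed.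

Lemma solves_from_unique s x y : solves_from s x -> solves_from s y ->
  (forall t, s - r <= t <= s -> x t = y t) -> forall t, s <= t -> x t = y t.
Proof.
move=> sx sy xy t st; have rr := r_gt0.
have [cx hx] := sx; have [cy hy] := sy.
have xys : x s = y s by apply: xy; lra.
have lx := delay_rhs_vlocint cx; have ly := delay_rhs_vlocint cy.
have cd : continuous (fun t => x t - y t) by exact: continuousB_euclid.
have d0 u : s - r <= u <= s -> x u - y u = 0 by move=> /xy ->; rewrite subrr.
have dE u : s <= u -> x u - y u = vint s u (fun w => L w (fun t => x t - y t)).
  move=> su; have -> : (fun w => L w (fun t => x t - y t)) = (fun w => L w x - L w y).
    by apply/funext => w; exact: (functionalB delay_rhs_linear).
  by rewrite vintB// -hx// -hy// xys; vring.
have := @ivp_unique R n r r0 m b L (ltW r_gt0) r0_gt0 b_locint b_ge0 b_window m_small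
  delay_rhs_bound delay_rhs_vlocint s (fun t => x t - y t) cd d0 dE t st.
by move=> /eqP; rewrite subr_eq0 => /eqP.
Qed.

Lemma solves_from_exists s phi : exists y, [/\ solves_from s y, has_history s y phi,
    forall t, t <= s -> N (y t) <= sup_norm phi &
    forall t, s <= t -> N (y t) <= 2 * sup_norm phi * expR (r0^-1 * (t - s))].
Proof.
have cphi : continuous (fun t => (phi \o @clamp R r) (t - s)).
  have -> : (fun t => (phi \o @clamp R r) (t - s)) = fun t => (phi \o @clamp R r) (- s + t).
    by apply/funext => t; rewrite addrC.
  by apply: continuous_history; exact: cseg_continuous_clamp.
have phiB t : N ((phi \o @clamp R r) (t - s)) <= sup_norm phi.
  by apply: le_sup_norm => //; exact: clamp_itv.
have [y [cy y1 y2 y3]] := @ivp_exists R n r r0 m b L r0_gt0 b_locint b_ge0 b_window m_small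
  delay_rhs_linear delay_rhs_bound delay_rhs_vlocint s _ _ cphi (fun t _ => phiB t).
have ys : y s = (phi \o @clamp R r) (s - s) by exact: y1.
exists y; split => //.
- by split=> // t st; rewrite y2// ys; vring.
- move=> th hth; rewrite y1; last lra.
  by rewrite /= addrAC subrr add0r clamp_id.
- by move=> t ts; rewrite y1.
Qed.

Lemma delay_evolutionE s t phi y : s <= t -> solves_from s y -> has_history s y phi ->
  forall th, - r <= th <= 0 -> delay_evolution eta t s phi th = y (t + th).
Proof.
move=> st sy hy; rewrite /delay_evolution; set W := [set _ | _].
have [psi hpsi] := segment_exists r (continuous_history (t := t) sy.1).
have W0 : W psi.
  exists y; first exact: solves_from_delay_solution.
  by move=> th; rewrite in_itv; exact: hpsi.
have [x xsol hx] := @xgetPex _ 0 W (ex_intro _ psi W0).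
have [x' [sx hx' xx']] := delay_solution_solves_from xsol.
move=> th hth; rewrite hx; last by rewrite in_itv.
rewrite -xx'; last lra.
have agree u : s - r <= u <= s -> x' u = y u.
  move=> hu; have -> : u = s + (u - s) by ring.
  by rewrite hx' ?hy//; lra.
have [su|us] := leP s (t + th); first exact: (solves_from_unique sx sy).
by apply: agree; lra.
Qed.

End delay_solutions.

(** * Splitting off the backward bounded part of a solution *)


Lemma locint_if (R : realType) (f : R -> R) (a : R) : locint f ->
  locint (fun u => if a < u then f u else 0).
Proof.
move=> lf; apply: (@locint_dominated _ _ (fun u => `|f u|)); last 2 first.
- exact: locint_norm.
- by move=> t; case: ifP => // _; rewrite normr0.
have -> : (fun u => if a < u then f u else 0) = (fun u => \1_(`]a, +oo[%classic) u * f u).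
  apply/funext => u; rewrite indicE; case: ifPn => au.
    by rewrite mem_set ?mul1r//= in_itv/= au.
  by rewrite memNset ?mul0r//= in_itv/= andbT; exact/negP.
apply: measurable_funM; last exact: locint_measurable.
by apply: measurable_indic; exact: itv_measurable_completed.
Qed.

Lemma vint_cst (R : realType) n (a c : R) (v : 'cV[R]_n) :
  vint a c (fun=> v) = (c - a) *: v.
Proof. by apply/colP => i; rewrite !mxE oint_cst mulrC. Qed.

Section delay_decomposition.
Variables (R : realType) (n : nat) (r : R) (eta : R -> R -> 'M[R]_n).
Local Notation N := (@euclid_norm R n).
Hypothesis r_gt0 : 0 < r.
Hypothesis eta_bv : forall t i j, bounded_variation (- r) 0 (fun th => eta t th i j).
Hypothesis eta_meas : forall (phi : cseg n r) i,
        lebesgue_measurable_fun (fun t => delay_op r eta t phi i ord0).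
Hypothesis eta_int : loc_integrable (delay_op_norm r eta).
Variables (r0 m : R).
Hypothesis r0_gt0 : 0 < r0.
Hypothesis r_le : r <= r0.
Local Notation b := (delay_bound r eta).
Local Notation L := (delay_rhs r eta).
Hypothesis b_window : forall t, oint t (t + r0) b <= m.
Hypothesis m_small : m <= 1 / 4.
Variable beta : R.
Hypothesis beta_gt0 : 0 < beta.
Hypothesis admissible : forall mf, 0 <= mf -> exists2 D, 0 <= D &
  forall (rho bf : R -> R) (f : R -> 'cV[R]_n),
  slow_weight beta rho -> locint bf -> (forall t, 0 <= bf t) ->
  (forall t, oint t (t + r0) bf <= mf) -> vlocint f ->
  (forall t, N (f t) <= bf t * rho t) ->
  exists2 w, mprim w (fun t => L t w + f t) & forall t, N (w t) <= D * rho t.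
Hypothesis bounded_eq0 : forall (w : R -> 'cV[R]_n) B,
  mprim w (fun t => L t w) -> (forall t, N (w t) <= B) -> forall t, w t = 0.
Implicit Types (x y z : R -> 'cV[R]_n) (s t : R) (phi psi : cseg n r).

Let b_locint : locint b. Proof. exact: delay_bound_locint. Qed.
Let b_ge0 t : 0 <= b t. Proof. exact: delay_bound_ge0. Qed.

Lemma exp_slow_weight s (c : R) : 0 <= c ->
  slow_weight beta (fun t => c * expR (- beta * `|t - s|)).
Proof.
move=> c0; apply: slow_weightZ => //; split.
- by move=> t; exact: expR_ge0.
- move=> t u; rewrite -expRD ler_expR.
  have := ler_normD (t - u) (u - s); rewrite addrA subrK => h.
  have := ler_wpM2l (ltW beta_gt0) h; rewrite mulrDr; lra.
- apply: continuous_expR_comp => t; apply: cvgM; first exact: cvg_cst.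
  apply: (@continuous_comp _ _ _ (fun t => t - s) (@Num.norm _ R^o)).
    by apply: cvgB; [exact: cvg_id|exact: cvg_cst].
  exact: norm_continuous.
- exists 1 => t; rewrite expR_le1 mulNr oppr_le0 mulr_ge0//; exact: ltW.
Qed.

(** [z] is the part of the solution with history [phi] at [s] that extends backward to a
    bounded solution, the rest being bounded forward. *)
Definition backward_part s phi z := [/\ mprim z (fun t => L t z),
  exists B, forall t, t <= s -> N (z t) <= B &
  exists y, [/\ solves_from r eta s y, has_history s y phi &
    exists B, forall t, s <= t -> N (y t - z t) <= B]].

Definition part_decay (C : R) s phi z :=
  (forall t, t <= s -> N (z t) <= C * sup_norm phi * expR (- beta * (s - t))) /\
  forall y, solves_from r eta s y -> has_history s y phi ->
    forall t, s <= t -> forall th, - r <= th <= 0 ->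
    N (y (t + th) - z (t + th)) <= C * sup_norm phi * expR (- beta * (t - s)).

(** Let [Y] vanish up to [s], agree with the solution [y] from [s + r0] on, and be linear in
    between. It solves the delay equation outside [s, s + 2 * r0], as the delay is at most
    [r0]. So its defect [f] has any exponential decay away from [s], and the solution [w]
    driven by [f] decays at the rate [beta] in both directions. Then [z = w + Y] solves
    the delay equation, is [w] on the left of [s], and differs from [y] by [- w] on the
    right of [s + r0]. *)
Lemma backward_part_exists : exists2 C, 0 < C & forall s phi, exists z,
  backward_part s phi z /\ part_decay C s phi z.
Proof.
have rr := r_gt0; have rl := r_le; have r00 := r0_gt0; have bb := beta_gt0.
have m0 : 0 <= m by exact: (window_ge0 b_ge0 r0_gt0 b_window).
have mf0 : 0 <= 2 * m + 1 by lra.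
have [D D0 adm] := admissible mf0.
(* [S1 * p] bounds the solution on [s, s + 2 * r0]; [E1] is the factor by which the weight
   decreases over this interval. *)
pose S1 : R := 2 * expR 2; have S10 : 0 < S1 by rewrite mulr_gt0// expR_gt0.
pose E1 : R := expR (2 * beta * r0); have E10 : 0 < E1 by exact: expR_gt0.
pose C := (2 + D) * S1 * E1 * expR (beta * r).
exists C; first by rewrite !mulr_gt0// ?expR_gt0//; lra.
move=> s phi; have p0 := sup_norm_ge0 r_gt0 phi; set p := sup_norm phi in p0 *.
have [y [sy hy yl yr]] := solves_from_exists r_gt0 eta_bv eta_meas eta_int r0_gt0 b_window
  m_small s phi.
have [cy yE] := sy; pose S0 := S1 * p; have S00 : 0 <= S0 by rewrite mulr_ge0// ltW.
have S1ge : 1 <= S1.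
  by have := @expR_ge1Dx R 2; rewrite /S1; lra.
have yS t : t <= s + 2 * r0 -> N (y t) <= S0.
  move=> ts; have [st|/ltW st] := leP s t; last first.
    by apply: (le_trans (yl t st)); rewrite /S0 ler_peMl.
  apply: (le_trans (yr t st)); rewrite -/p /S0 /S1 [leRHS]mulrAC.
  apply: ler_wpM2l; first by rewrite mulr_ge0.
  by rewrite ler_expR mulrC ler_pdivrMr//; lra.
pose c : 'cV[R]_n := r0^-1 *: y (s + r0).
have lL := delay_rhs_vlocint r_gt0 eta_bv eta_meas eta_int cy.
(* The derivative of [Y]. *)
pose q u : 'cV[R]_n := (if s < u then c else 0) + (if s + r0 < u then L u y - c else 0).
have lq : vlocint q.
  move=> i; have l1 := locint_if s (locint_cst (c i ord0)).
  have l2 := locint_if (s + r0) (locintB (lL i) (locint_cst (c i ord0))).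
  have coordD (v1 v2 : 'cV[R]_n) : (v1 + v2) i ord0 = v1 i ord0 + v2 i ord0 by rewrite mxE.
  have coordN (v1 : 'cV[R]_n) : (- v1) i ord0 = - v1 i ord0 by rewrite mxE.
  have coord0 : (0 : 'cV[R]_n) i ord0 = 0 by rewrite mxE.
  apply: eq_locint (locintD l1 l2) => u; rewrite /q coordD; congr (_ + _).
    by case: ifP.
  by case: ifP => // _; rewrite coordD coordN.
have q1 u : u <= s -> q u = 0.
  move=> us; have su : s + r0 < u = false by apply/negbTE; rewrite -leNgt; lra.
  by rewrite /q su ltNge us addr0.
have q2 u : s < u -> u <= s + r0 -> q u = c.
  by move=> su us; rewrite /q su ltNge us addr0.
have q3 u : s + r0 < u -> q u = L u y.
  move=> us; have su : s < u by lra.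
  by rewrite /q us su addrC subrK.
pose Y t := vint s t q.
have cY : continuous Y by exact: continuous_vint.
have Y1 t : t <= s -> Y t = 0.
  move=> ts; rewrite /Y vintC (@eq_vint _ _ _ _ _ (fun=> 0))//; last first.
    by move=> u /andP[_ us]; exact: q1.
  by rewrite vint_cst scaler0 oppr0.
have Y2 t : s <= t -> t <= s + r0 -> Y t = (t - s) *: c.
  move=> st ts; rewrite /Y (@eq_vint _ _ _ _ _ (fun=> c))//; last first.
    by move=> u /andP[su ut]; apply: q2 => //; exact: le_trans ts.
  by rewrite vint_cst.
have Yr0 : Y (s + r0) = y (s + r0).
  rewrite Y2; [|lra|lra].
  by rewrite /c scalerA addrAC subrr add0r mulfV ?scale1r// gt_eqF.
have Y3 t : s + r0 <= t -> Y t = y t.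
  move=> st; rewrite /Y (vint_cat s (s + r0) t lq) -/(Y (s + r0)) Yr0.
  rewrite (@eq_vint _ _ _ _ _ (fun u => L u y))//; last by move=> u /andP[su _]; exact: q3.
  rewrite -(solves_from_cat r_gt0 eta_bv eta_meas eta_int sy)//; [vring|lra].
have YS t : t <= s + 2 * r0 -> N (Y t) <= S0.
  move=> ts; have [t1|t1] := leP t s; first by rewrite Y1// euclid_norm0.
  have [t2|t2] := leP t (s + r0); last by rewrite Y3; [exact: yS|exact: ltW].
  rewrite Y2//; last exact: ltW.
  have yr0 : N (y (s + r0)) <= S0 by apply: yS; lra.
  rewrite /c scalerA euclid_normZ; apply: le_trans yr0.
  rewrite ler_piMl ?euclid_norm_ge0// ger0_norm; last by rewrite mulr_ge0 ?invr_ge0; lra.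
  by rewrite ler_pdivrMr//; lra.
pose f u := L u Y - q u.
have lLY := delay_rhs_vlocint r_gt0 eta_bv eta_meas eta_int cY.
have lf : vlocint f by exact: vlocintB.
pose rho t := (S0 * E1) * expR (- beta * `|t - s|).
have rhow : slow_weight beta rho by apply: exp_slow_weight; rewrite mulr_ge0// ltW.
have rhoS t : `|t - s| <= 2 * r0 -> S0 <= rho t.
  move=> ts; rewrite /rho -mulrA ler_peMr// /E1 -expRD -[X in X <= _]expR0 ler_expR.
  have := ler_wpM2l (ltW beta_gt0) ts; lra.
have rho0 t : 0 <= rho t by case: rhow.
pose bf t := 2 * b t + r0^-1.
have r0V : 0 < r0^-1 by rewrite invr_gt0.
have lbf : locint bf by apply: locintD; [exact: locintZ|exact: locint_cst].
have bf0 t : 0 <= bf t by rewrite /bf; have := b_ge0 t; lra.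
have bfw t : oint t (t + r0) bf <= 2 * m + 1.
  rewrite /bf ointD; [|exact: locintZ|exact: locint_cst].
  rewrite ointZ// oint_cst addrAC subrr add0r mulVf ?gt_eqF//.
  by have := b_window t; lra.
have cS : N c <= r0^-1 * S0.
  rewrite /c euclid_normZ gtr0_norm// ler_wpM2l//; [exact: ltW|by apply: yS; lra].
have LB u x B : continuous x -> (forall v, u - r <= v <= u -> N (x v) <= B) ->
    N (L u x) <= b u * B by move=> cx; exact: delay_rhs_bound.
have fB u : N (f u) <= bf u * rho u.
  have [us|su] := leP u s.
    rewrite /f q1// subr0; apply: (@le_trans _ _ (b u * 0)).
      apply: LB => // v hv; rewrite Y1 ?euclid_norm0//; lra.
    by rewrite mulr0 mulr_ge0.
  have [u2|u2] := leP u (s + 2 * r0); last first.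
    rewrite /f q3; last lra.
    have -> : L u Y = L u y.
      by apply: (eq_delay_rhs r_gt0 eta_bv cy) => v hv; rewrite Y3//; lra.
    by rewrite subrr euclid_norm0 mulr_ge0.
  have h1 : N (L u Y) <= b u * S0.
    by apply: LB => // v hv; apply: YS; lra.
  have h2 : N (q u) <= (b u + r0^-1) * S0.
    rewrite mulrDl; have [u3|u3] := leP u (s + r0).
      by rewrite q2//; apply: (le_trans cS); rewrite lerDr mulr_ge0.
    rewrite q3//; apply: (@le_trans _ _ (b u * S0)); last by rewrite lerDl mulr_ge0// ltW.
    by apply: LB => // v hv; apply: yS; lra.
  have h3 : S0 <= rho u by apply: rhoS; rewrite ger0_norm; lra.
  apply: (@le_trans _ _ (bf u * S0)); last exact: ler_wpM2l.
  apply: (le_trans (ler_euclid_normB _ _)); apply: (le_trans (lerD h1 h2)).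
  by rewrite /bf le_eqVlt; apply/orP; left; apply/eqP; ring.
have [w pw wB] := adm rho bf f rhow lbf bf0 bfw lf fB.
have cw := mprim_continuous pw.
pose z t := 1 *: w t + Y t.
have pz : mprim z (fun t => L t z).
  have [lw wE] := vint_mprim pw.
  have e t : L t z = (L t w + f t) + q t.
    rewrite /z (delay_rhs_linear r_gt0 eta_bv)// scale1r /f -addrA; congr (_ + _).
    by rewrite subrK.
  apply: mprim_vint => [i|t u].
    by apply: eq_locint (vlocintD lw lq i) => t; rewrite e.
  have -> : z u - z t = (w u - w t) + (Y u - Y t).
    by rewrite /z; move: (Y u) (Y t) => p1 p2; vring.
  have -> : Y u - Y t = vint t u q.
    by rewrite /Y (vint_cat s t u lq) addrAC subrr add0r.
  rewrite wE -vintD//; congr vint; apply/funext => v; by rewrite e.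
have zw t : t <= s -> z t = w t by move=> ts; rewrite /z Y1// scale1r addr0.
have SE0 : 0 <= S0 * E1 by rewrite mulr_ge0// ltW.
have ebr : 1 <= expR (beta * r).
  by rewrite -[X in X <= _]expR0 ler_expR mulr_ge0// ltW.
have zB t : t <= s -> N (z t) <= C * p * expR (- beta * (s - t)).
  move=> ts; rewrite zw//; apply: (le_trans (wB t)).
  rewrite /rho distrC ger0_norm ?subr_ge0// mulrA; apply: ler_wpM2r; first exact: expR_ge0.
  have -> : C * p = ((2 + D) * expR (beta * r)) * (S0 * E1) by rewrite /C /S0; ring.
  apply: ler_wpM2r => //; rewrite mulrDl; have := ler_peMr D0 ebr.
  by have := expR_ge0 (beta * r); lra.
have yzB t : s - r <= t -> N (y t - z t) <= (2 + D) * rho t.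
  move=> st; rewrite /z scale1r; have := wB t; have Rt := rho0 t.
  have [t1|t1] := leP (s + r0) t.
    have -> : y t - (w t + Y t) = - w t by rewrite Y3//; vring.
    rewrite euclid_normN mulrDl; lra.
  have n1 : N (y t) <= S0 by apply: yS; lra.
  have n2 : N (Y t) <= S0 by apply: YS; lra.
  have n3 : S0 <= rho t by apply: rhoS; rewrite ler_norml; lra.
  have -> : y t - (w t + Y t) = (y t - w t) - Y t.
    by move: (Y t) => p1; vring.
  have := ler_euclid_normB (y t - w t) (Y t); have := ler_euclid_normB (y t) (w t).
  rewrite mulrDl; lra.
exists z; split; last first.
  split=> // y' sy' hy' t st th hth.
  have -> : y' (t + th) = y (t + th).
    have agree u : s - r <= u <= s -> y' u = y u.
      move=> hu; have -> : u = s + (u - s) by ring.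
      by rewrite hy' ?hy//; lra.
    have [su|us] := leP s (t + th); last by apply: agree; lra.
    exact: (solves_from_unique r_gt0 eta_bv eta_meas eta_int r0_gt0 b_window m_small sy' sy agree su).
  apply: (le_trans (yzB (t + th) _)); first lra.
  have -> : (2 + D) * rho (t + th) =
    ((2 + D) * (S0 * E1)) * expR (- beta * `|t + th - s|) by rewrite /rho; ring.
  have -> : C * p * expR (- beta * (t - s)) =
    ((2 + D) * (S0 * E1)) * (expR (beta * r) * expR (- beta * (t - s))).
    by rewrite /C /S0; ring.
  apply: ler_wpM2l; first by rewrite mulr_ge0//; lra.
  rewrite -expRD ler_expR.
  have h : t - s - r <= `|t + th - s| by apply: le_trans (ler_norm _); lra.
  have := ler_wpM2l (ltW beta_gt0) h; lra.
have Rho t : rho t <= S0 * E1.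
  rewrite /rho ler_piMr// expR_le1 mulNr oppr_le0 mulr_ge0//; exact: ltW.
split=> //.
  exists (D * (S0 * E1)) => t ts; rewrite zw//; apply: (le_trans (wB t)).
  exact: ler_wpM2l.
exists y; split=> //; exists ((2 + D) * (S0 * E1)) => t st.
apply: (le_trans (yzB t _)); first lra.
by apply: ler_wpM2l => //; lra.
Qed.

End delay_decomposition.

(** * From bounded solutions to a dichotomy *)


Section delay_dichotomy.
Variables (R : realType) (n : nat) (r : R) (eta : R -> R -> 'M[R]_n).
Local Notation N := (@euclid_norm R n).
Hypothesis r_gt0 : 0 < r.
Hypothesis eta_bv : forall t i j, bounded_variation (- r) 0 (fun th => eta t th i j).
Hypothesis eta_meas : forall (phi : cseg n r) i,
        lebesgue_measurable_fun (fun t => delay_op r eta t phi i ord0).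
Hypothesis eta_int : loc_integrable (delay_op_norm r eta).
Variables (r0 m : R).
Hypothesis r0_gt0 : 0 < r0.
Local Notation b := (delay_bound r eta).
Local Notation L := (delay_rhs r eta).
Hypothesis b_window : forall t, oint t (t + r0) b <= m.
Hypothesis m_small : m <= 1 / 4.
Hypothesis bounded_eq0 : forall (w : R -> 'cV[R]_n) B,
  mprim w (fun t => L t w) -> (forall t, N (w t) <= B) -> forall t, w t = 0.
Implicit Types (x y z : R -> 'cV[R]_n) (s t : R) (phi psi : cseg n r).
Local Notation backward_part := (@backward_part R n r eta).
Local Notation T := (delay_evolution (r := r) eta).

Let unique s x y : solves_from r eta s x -> solves_from r eta s y ->
  (forall t, s - r <= t <= s -> x t = y t) -> forall t, s <= t -> x t = y t.
Proof. exact: (solves_from_unique r_gt0 eta_bv eta_meas eta_int r0_gt0 b_window m_small). Qed.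

Lemma has_history_agree s x y phi : has_history s x phi -> has_history s y phi ->
  forall t, s - r <= t <= s -> x t = y t.
Proof.
move=> hx hy t ht; have -> : t = s + (t - s) by ring.
by rewrite hx ?hy//; lra.
Qed.

(** The difference of two backward parts is bounded backward by the first condition and forward
    by the second, as both are compared with the same forward solution. *)
Lemma backward_part_unique s phi z z' : backward_part s phi z -> backward_part s phi z' ->
  forall t, z t = z' t.
Proof.
move=> [pz [B hB] [y [sy hy [D hD]]]] [pz' [B' hB'] [y' [sy' hy' [D' hD']]]] t.
have pd := mprim_delay_lin r_gt0 eta_bv (-1) pz' pz.
apply/eqP; rewrite -subr_eq0; apply/eqP.
have -> : z t - z' t = (-1) *: z' t + z t by rewrite scaleN1r addrC.
have Bm : B + B' <= Num.max (B + B') (D + D') by rewrite le_max lexx.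
have Dm : D + D' <= Num.max (B + B') (D + D') by rewrite le_max lexx orbT.
apply: (bounded_eq0 (B := Num.max (B + B') (D + D')) pd) => u.
rewrite scaleN1r addrC; have [us|/ltW su] := leP u s.
  apply: le_trans Bm; apply: (le_trans (ler_euclid_normB _ _)).
  by apply: lerD; [exact: hB|exact: hB'].
apply: le_trans Dm.
have -> : z u - z' u = (y' u - z' u) - (y u - z u).
  have -> : y' u = y u by apply: (unique sy' sy _ su); exact: has_history_agree hy' hy.
  vring.
apply: (le_trans (ler_euclid_normB _ _)); rewrite addrC.
by apply: lerD; [exact: hD|exact: hD'].
Qed.

Lemma backward_part_lin s k phi psi z z' : backward_part s phi z -> backward_part s psi z' ->
  backward_part s (k *: phi + psi) (fun t => k *: z t + z' t).
Proof.
move=> [pz [B hB] [y [sy hy [D hD]]]] [pz' [B' hB'] [y' [sy' hy' [D' hD']]]].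
split; first exact: mprim_delay_lin.
  exists (`|k| * B + B') => t ts; apply: (le_trans (ler_euclid_normD _ _)).
  rewrite euclid_normZ; apply: lerD; last exact: hB'.
  by apply: ler_wpM2l => //; exact: hB.
exists (fun t => k *: y t + y' t); split.
- exact: solves_from_lin.
- by move=> th hth; rewrite hy// hy'.
exists (`|k| * D + D') => t st.
have -> : k *: y t + y' t - (k *: z t + z' t) = k *: (y t - z t) + (y' t - z' t) by vring.
apply: (le_trans (ler_euclid_normD _ _)).
rewrite euclid_normZ; apply: lerD; last exact: hD'.
by apply: ler_wpM2l => //; exact: hD.
Qed.

Lemma backward_part_self s phi z : mprim z (fun t => L t z) ->
  (exists B, forall t, t <= s -> N (z t) <= B) -> has_history s z phi ->
  backward_part s phi z.
Proof.
move=> pz hB hz; split=> //; exists z; split=> //.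
  exact: (mprim_solves_from s pz).
by exists 0 => t _; rewrite subrr euclid_norm0.
Qed.

Lemma bounded_backward_le s t z : continuous z -> s <= t ->
  (exists B, forall u, u <= s -> N (z u) <= B) -> exists B, forall u, u <= t -> N (z u) <= B.
Proof.
move=> cz st [B hB]; have [D D0 hD] := continuous_bounded_itv s t (continuous_euclid_norm cz).
exists (Num.max B D) => u ut; have [us|/ltW su] := leP u s.
  by apply: (le_trans (hB u us)); rewrite le_max lexx.
have := hD u; rewrite su ut => /(_ isT) h.
by apply: (le_trans (ler_norm _)); apply: (le_trans h); rewrite le_max lexx orbT.
Qed.

Lemma backward_part_shift s t phi psi y z : s <= t -> solves_from r eta s y ->
  has_history s y phi -> has_history t y psi ->
  backward_part s phi z -> backward_part t psi z.
Proof.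
move=> st sy hy hpsi [pz hB [y' [sy' hy' [D hD]]]]; split=> //.
  exact: (bounded_backward_le (mprim_continuous pz) st).
exists y; split=> //; first exact: (solves_from_le r_gt0 eta_bv eta_meas eta_int st).
exists D => u tu; have su := le_trans st tu.
have -> : y u = y' u by apply: (unique sy sy' _ su); exact: has_history_agree hy hy'.
exact: hD.
Qed.

Variables (beta C : R).
Hypothesis beta_gt0 : 0 < beta.
Hypothesis C_gt0 : 0 < C.
Hypothesis part_exists : forall s phi, exists z,
  backward_part s phi z /\ part_decay eta beta C s phi z.

(** The complementary projection [Q] maps a history at [s] to the history at [s] of its
    backward part. Uniqueness of the backward part makes it linear, idempotent and
    invariant. The kernel of the projection consists of the histories of solutions on the
    whole line that are bounded backward, and these can be followed in both directions of
    time. The factor [exp (beta * r)] pays for the length of a history. *)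
Lemma delay_dichotomy : exp_dichotomy (@sup_norm R n r) T beta (C * expR (beta * r)).
Proof.
have K'0 : 0 < C * expR (beta * r) by rewrite mulr_gt0 ?expR_gt0.
split => //.
have [Z hZ] := choice2 part_exists.
have Zpart s phi : backward_part s phi (Z s phi) by have [] := hZ s phi.
have Zprim s phi : mprim (Z s phi) (fun t => L t (Z s phi)) by have [] := Zpart s phi.
have Zcont s phi : continuous (Z s phi) := mprim_continuous (Zprim s phi).
have Zback s phi : exists B, forall t, t <= s -> N (Z s phi t) <= B by have [] := Zpart s phi.
have exseg t y : continuous y -> exists psi, has_history t y psi.
  move=> cy; have [psi hpsi] := segment_exists r (continuous_history (t := t) cy).
  by exists psi => th /hpsi.
have [Q hQ] := choice2 (fun s phi => exseg s _ (Zcont s phi)).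
have hist_inj t y psi psi' : has_history t y psi -> has_history t y psi' -> psi = psi'.
  by move=> h h'; apply: segP => th hth; rewrite -h ?h'.
have QE s phi z : backward_part s phi z -> has_history s z (Q s phi).
  by move=> hz th hth; rewrite -hQ//; exact: (backward_part_unique hz (Zpart s phi)).
have Tsol s phi : exists y, solves_from r eta s y /\ has_history s y phi.
  have [y [sy hy _ _]] := solves_from_exists r_gt0 eta_bv eta_meas eta_int r0_gt0 b_window
    m_small s phi.
  by exists y.
have TE s t phi y : s <= t -> solves_from r eta s y -> has_history s y phi ->
    has_history t y (T t s phi).
  move=> st sy hy th hth.
  by rewrite (delay_evolutionE r_gt0 eta_bv eta_meas eta_int r0_gt0 b_window m_small st sy hy hth).
pose Pf s phi := phi - Q s phi.
have Plin s : linear (Pf s).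
  move=> k phi psi; rewrite /Pf.
  have -> : Q s (k *: phi + psi) = k *: Q s phi + Q s psi.
    apply: (hist_inj s (fun t => k *: Z s phi t + Z s psi t)).
      by apply: QE; exact: backward_part_lin.
    by move=> th hth; rewrite (hQ s phi)// (hQ s psi).
  by rewrite scalerBr addrACA opprD.
have exP s : exists p : {linear cseg n r -> cseg n r}, forall phi, p phi = Pf s phi.
  pose p : {linear cseg n r -> cseg n r} :=
    HB.pack (Pf s) (GRing.isLinear.Build _ _ _ _ (Pf s) (Plin s)).
  by exists p.
have [P hP] := choice exP.
have nullP s phi : null_space (P s) phi <-> Q s phi = phi.
  rewrite /null_space /= hP /Pf; split=> [/eqP|->]; last by rewrite subrr.
  by rewrite subr_eq0 => /eqP e; exact: esym.
have null_self s phi z : mprim z (fun t => L t z) ->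
    (exists B, forall t, t <= s -> N (z t) <= B) -> has_history s z phi -> null_space (P s) phi.
  move=> pz zB hz; apply/nullP; apply: (hist_inj s z) => //.
  by apply: QE; exact: backward_part_self.
have null_hist s phi : null_space (P s) phi -> has_history s (Z s phi) phi.
  by move=> /nullP e th hth; rewrite hQ// e.
have Zsol s u phi : solves_from r eta s (Z u phi) by exact: mprim_solves_from.
have bij s t : s <= t -> set_bij (null_space (P s)) (null_space (P t)) (T t s).
  move=> st; split.
  - move=> phi /null_hist h; apply: (null_self t _ (Z s phi)) => //.
      by apply: (bounded_backward_le (Zcont s phi) st).
    exact: TE.
  - move=> phi psi /set_mem/null_hist h1 /set_mem/null_hist h2 e.
    have b1 : backward_part t (T t s phi) (Z s phi).
      apply: backward_part_self => //; first exact: (bounded_backward_le (Zcont s phi) st).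
      exact: TE.
    have b2 : backward_part t (T t s phi) (Z s psi).
      rewrite e; apply: backward_part_self => //; first exact: (bounded_backward_le (Zcont s psi) st).
      exact: TE.
    by apply: segP => th hth; rewrite -(h1 th hth) -(h2 th hth); exact: (backward_part_unique b1 b2).
  - move=> psi hpsi; have hz := null_hist _ _ hpsi.
    have [phi hphi] := exseg s _ (Zcont t psi).
    exists phi; last by apply: (hist_inj t (Z t psi)) => //; exact: TE.
    apply: (null_self s _ (Z t psi)) => //.
    by have [B hB] := Zback t psi; exists B => u us; apply: hB; exact: le_trans st.
have ebr : 1 <= expR (beta * r).
  by rewrite -[X in X <= _]expR0 ler_expR mulr_ge0// ltW.
have CK : C <= C * expR (beta * r) by rewrite ler_peMr// ltW.
exists P; split.
- move=> s phi; rewrite !hP /Pf.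
  suff -> : Q s (phi - Q s phi) = 0 by rewrite subr0.
  have b1 := backward_part_self (Zprim s phi) (Zback s phi) (hQ s phi).
  have := backward_part_lin (-1) b1 (Zpart s phi).
  have -> : (-1) *: Q s phi + phi = phi - Q s phi by rewrite scaleN1r addrC.
  move=> /QE h; apply: segP => th hth; rewrite -h// seg0; vring.
- move=> t s st phi; rewrite !hP /Pf; have [y [sy hy]] := Tsol s phi.
  have hT := TE _ _ _ _ st sy hy.
  have sd := solves_from_lin r_gt0 eta_bv eta_meas eta_int (-1) (Zsol s s phi) sy.
  have hd : has_history s (fun u => (-1) *: Z s phi u + y u) (phi - Q s phi).
    by move=> th hth; rewrite hQ// hy// scaleN1r addrC.
  apply: (hist_inj t (fun u => (-1) *: Z s phi u + y u)); first exact: TE.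
  have bt := backward_part_shift st sy hy hT (Zpart s phi).
  by move=> th hth; rewrite (QE _ _ _ bt)// hT// scaleN1r addrC.
- by move=> t s st; exact: bij.
- move=> t s st; apply: op_norm_ub.
  + by rewrite mulr_ge0 ?expR_ge0// ltW.
  move=> phi; have [y [sy hy]] := Tsol s phi.
  have [_ [_ hb]] := hZ s phi.
  have sd := solves_from_lin r_gt0 eta_bv eta_meas eta_int (-1) (Zsol s s phi) sy.
  have hd : has_history s (fun u => (-1) *: Z s phi u + y u) (phi - Q s phi).
    by move=> th hth; rewrite hQ// hy// scaleN1r addrC.
  apply: sup_norm_le => // th hth; rewrite hP -(TE _ _ _ _ st sd hd)//.
  rewrite scaleN1r addrC; apply: (le_trans (hb y sy hy t st th hth)).
  rewrite mulrAC; apply: ler_wpM2r; first exact: sup_norm_ge0.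
  by apply: ler_wpM2r => //; exact: expR_ge0.
- move=> t s ts; apply: op_norm_ub.
  + by rewrite mulr_ge0 ?expR_ge0// ltW.
  move=> phi; have [_ [hb _]] := hZ s phi.
  have [q hq] := exseg t _ (Zcont s phi).
  have qnull : null_space (P t) q.
    apply: (null_self t _ (Z s phi)) => //.
    by have [B hB] := Zback s phi; exists B => u ut; apply: hB; exact: le_trans ts.
  have -> : phi - P s phi = T s t q.
    rewrite hP /Pf opprB addrC subrK; apply: (hist_inj s (Z s phi)); first exact: hQ.
    exact: TE.
  rewrite backward_evolutionE//; last exact: bij.
  apply: sup_norm_le => // th hth; rewrite -hq//.
  apply: (le_trans (hb (t + th) _)); first lra.
  rewrite mulrAC; apply: ler_wpM2r; first exact: sup_norm_ge0.
  apply: ler_pM; [exact: ltW|exact: expR_ge0|exact: CK|].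
  rewrite ler_expR; have : 0 <= beta * (- th) by rewrite mulr_ge0//; [exact: ltW|lra].
  rewrite !mulrDr !mulrN !mulNr; lra.
Qed.

End delay_dichotomy.

(** * The size of the delay *)


Section constants.
Variables (R : realType) (alpha K M : R).
Hypotheses (alpha_gt0 : 0 < alpha) (K_gt0 : 0 < K) (M_gt0 : 0 < M).

Lemma expR_le2 (x : R) : x <= 1 / 2 -> expR x <= 2.
Proof.
move=> x2; have := @expR_ge1Dx R (- x); rewrite expRN => h.
have e0 := expR_gt0 x.
have : (1 / 2) * expR x <= 1.
  have : (1 - x) * expR x <= (expR x)^-1 * expR x by rewrite ler_wpM2r// ltW.
  rewrite mulVf ?gt_eqF//; apply: le_trans; rewrite ler_pM2r//; lra.
lra.
Qed.

Lemma inv_1B_expRN_le (x : R) : 0 < x -> (1 - expR (- x))^-1 <= x^-1 + 1.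
Proof.
move=> x0; have h := @expR_gt1Dx R x; have e0 := expR_gt0 x.
have hx : 1 + x < expR x by apply: h; rewrite gt_eqF.
rewrite expRN; set E := expR x in hx e0 *.
have E1 : 0 < 1 - E^-1 by rewrite subr_gt0 invf_lt1//; lra.
rewrite -[leLHS]mul1r ler_pdivrMr//.
have -> : x^-1 + 1 = (1 + x) / x by field; rewrite gt_eqF.
have -> : 1 - E^-1 = (E - 1) / E by field; rewrite gt_eqF.
rewrite mulf_div ler_pdivlMr ?mulr_gt0// mul1r; nra.
Qed.

(** The inverse of a sum of positive terms, one for each of the smallness conditions of
    [small_delayP]. *)
Definition small_delay : R :=
  (1 + 8 * alpha + 4 * M * (4 * K * M + alpha) / alpha + 8 * (2 * K * M ^+ 2 + M))^-1.

Local Notation r0 := small_delay.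

Let den_gt0 : 0 < 1 + 8 * alpha + 4 * M * (4 * K * M + alpha) / alpha +
  8 * (2 * K * M ^+ 2 + M).
Proof.
have h1 : 0 < 4 * M * (4 * K * M + alpha) / alpha by rewrite divr_gt0// !mulr_gt0// addr_gt0// !mulr_gt0.
have h2 : 0 < 2 * K * M ^+ 2 by rewrite !mulr_gt0// exprn_gt0.
have := alpha_gt0; have := M_gt0; lra.
Qed.

Lemma small_delay_gt0 : 0 < r0. Proof. by rewrite invr_gt0. Qed.

Lemma small_delayP : [/\ r0 <= 1, 8 * alpha * r0 <= 1,
  4 * M * (4 * K * M + alpha) * r0 <= alpha & 8 * (2 * K * M ^+ 2 + M) * r0 <= 1].
Proof.
have a0 := alpha_gt0; have m0 := M_gt0; have dg := den_gt0.
have h1 : 0 < 4 * M * (4 * K * M + alpha) / alpha by rewrite divr_gt0// !mulr_gt0// addr_gt0// !mulr_gt0.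
have h2 : 0 < 2 * K * M ^+ 2 by rewrite !mulr_gt0// exprn_gt0.
rewrite /small_delay; set d := _ + _ in dg *.
have key (x : R) : x <= d -> x * d^-1 <= 1 by move=> xd; rewrite ler_pdivrMr// mul1r.
split.
- by rewrite -[leLHS]mul1r; apply: key; rewrite /d; lra.
- by apply: key; rewrite /d; lra.
- have h3 : 4 * M * (4 * K * M + alpha) / alpha * d^-1 <= 1 by apply: key; rewrite /d; lra.
  by rewrite -[leRHS]mul1r -ler_pdivrMr// mulrAC.
- by apply: key; rewrite /d; lra.
Qed.

Lemma small_delay_exp : expR (4 * alpha * r0) <= 2.
Proof. by apply: expR_le2; have [_ h _ _] := small_delayP; lra. Qed.

Lemma ell_small_delay : ell K M alpha r0 * r0 < alpha.
Proof.
have [_ _ h _] := small_delayP; have E := small_delay_exp; have a0 := alpha_gt0.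
have r00 := small_delay_gt0.
have p : 0 < 4 * K * M + alpha by rewrite addr_gt0// !mulr_gt0.
have p' : 0 <= M * (4 * K * M + alpha) * r0 by rewrite !mulr_ge0// ltW.
rewrite /ell; apply: (@le_lt_trans _ _ (2 * (M * (4 * K * M + alpha) * r0))); last lra.
have -> : M * expR (4 * alpha * r0) * (4 * K * M + alpha) * r0 =
  expR (4 * alpha * r0) * (M * (4 * K * M + alpha) * r0) by ring.
exact: ler_wpM2r.
Qed.

Lemma window_small : M * r0 <= 1 / 4.
Proof.
have [_ _ _ h] := small_delayP; have r00 := small_delay_gt0.
have : 0 <= 2 * K * M ^+ 2 * r0 by rewrite !mulr_ge0 ?exprn_ge0// ltW.
rewrite mulrDr mulrDl in h; lra.
Qed.

(** As [decay_const] is about [M / (alpha - beta)], the main term is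
    [2 * K * M ^+ 2 * r0 * exp (beta * r0) / (alpha - beta)]; the condition
    [ell K M alpha r0 * r0 <= alpha - beta] makes it at most [1 / 2]. The other terms are
    small with [r0] alone. *)
Lemma contraction_small_delay beta : 0 <= beta -> beta <= alpha - ell K M alpha r0 * r0 ->
  (gain alpha K r0 beta (M * r0) * (M * r0) + M * r0) * expR (beta * r0) <= 3 / 4.
Proof.
move=> b0 bl; have [r1 _ _ h] := small_delayP; have r00 := small_delay_gt0.
have a0 := alpha_gt0; have k0 := K_gt0; have m0 := M_gt0.
set eps := alpha - beta; have epsl : ell K M alpha r0 * r0 <= eps by rewrite /eps; lra.
have ell0 : 0 < ell K M alpha r0 * r0.
  by rewrite /ell !mulr_gt0// ?expR_gt0// addr_gt0// !mulr_gt0.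
have eps0 : 0 < eps by exact: lt_le_trans epsl.
have ba : beta <= alpha by rewrite /eps in eps0; lra.
set Eb := expR (beta * r0); set E4 := expR (4 * alpha * r0).
have Eb0 : 0 < Eb by exact: expR_gt0.
have EbE4 : Eb <= E4.
  by rewrite ler_expR ler_pM2r//; lra.
have E42 : E4 <= 2 := small_delay_exp.
have hg : gain alpha K r0 beta (M * r0) <= 2 * K * (M * r0) * ((eps * r0)^-1 + 1).
  rewrite /gain /decay_const -/eps mulrA; apply: ler_wpM2l.
    by rewrite !mulr_ge0// ltW.
  by rewrite mulNr; apply: inv_1B_expRN_le; rewrite mulr_gt0.
have mr0 : 0 < M * r0 by rewrite mulr_gt0.
apply: (@le_trans _ _ ((2 * K * (M * r0) * ((eps * r0)^-1 + 1) * (M * r0) + M * r0) * Eb)).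
  by apply: ler_wpM2r; [exact: ltW|rewrite lerD2r; apply: ler_wpM2r => //; exact: ltW].
have -> : (2 * K * (M * r0) * ((eps * r0)^-1 + 1) * (M * r0) + M * r0) * Eb =
  2 * K * M ^+ 2 * r0 * Eb / eps + (2 * K * M ^+ 2 * r0 * r0 + M * r0) * Eb.
  by field; rewrite !gt_eqF.
have part1 : 2 * K * M ^+ 2 * r0 * Eb / eps <= 1 / 2.
  rewrite ler_pdivrMr//.
  have : 4 * K * M ^+ 2 * r0 * E4 <= eps.
    apply: le_trans epsl; rewrite /ell -/E4.
    have -> : M * E4 * (4 * K * M + alpha) * r0 = 4 * K * M ^+ 2 * r0 * E4 + M * E4 * alpha * r0 by ring.
    by rewrite lerDl !mulr_ge0 ?expR_ge0// ltW.
  have : 4 * K * M ^+ 2 * r0 * Eb <= 4 * K * M ^+ 2 * r0 * E4.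
    by apply: ler_wpM2l => //; rewrite !mulr_ge0 ?exprn_ge0// ltW.
  lra.
have part2 : (2 * K * M ^+ 2 * r0 * r0 + M * r0) * Eb <= 1 / 4.
  have km : 0 <= 2 * K * M ^+ 2 * r0 by rewrite !mulr_ge0 ?exprn_ge0// ltW.
  have : 2 * K * M ^+ 2 * r0 * r0 <= 2 * K * M ^+ 2 * r0 by rewrite ler_piMr.
  move=> h1; apply: (@le_trans _ _ ((1 / 8) * 2)); last lra.
  apply: ler_pM; [|exact: ltW| |exact: le_trans E42].
    by rewrite addr_ge0 ?(ltW mr0)// mulr_ge0// ltW.
  rewrite mulrDr mulrDl in h; lra.
lra.
Qed.

End constants.

(** * Dichotomies of ordinary differential equations in matrix form *)


Section ode_dichotomy_matrix.
Variables (R : realType) (n : nat) (alpha K : R) (A X Y : R -> 'M[R]_n).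
Local Notation N := (@euclid_norm R n).
Hypothesis A_dich : exp_dichotomy N (ode_evolution A) alpha K.
Hypothesis YX : forall t, Y t *m X t = 1%:M.
Hypothesis evolutionE : forall t s v, ode_evolution A t s v = X t *m (Y s *m v).

Lemma linear_mx (f : {linear 'cV[R]_n -> 'cV[R]_n}) :
  exists B : 'M[R]_n, forall v, f v = B *m v.
Proof.
exists (\matrix_(i, j) f (delta_mx j ord0) i ord0) => v.
have fZ k w : f (k *: w) = k *: f w by exact: linearZ.
apply/colP => i; rewrite {1}(matrix_sum_delta v) linear_sum summxE mxE.
by apply: eq_bigr => j _; rewrite big_ord1 fZ !mxE mulrC.
Qed.

(** Commutation with the evolution operators makes the projections conjugate to each other:
    [P t] is [X t *m P0 *m Y t]. *)
Lemma ode_dichotomy_matrix : exists P0 : 'M[R]_n,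
  (forall t u v, u <= t ->
     N (X t *m (P0 *m (Y u *m v))) <= K * expR (- alpha * (t - u)) * N v) /\
  (forall t u v, t <= u ->
     N (X t *m ((1%:M - P0) *m (Y u *m v))) <= K * expR (- alpha * (u - t)) * N v).
Proof.
have XY t : X t *m Y t = 1%:M by exact: fundamental_matrixV.
have YXv t v : Y t *m (X t *m v) = v by rewrite mulmxA YX mul1mx.
have XYv t v : X t *m (Y t *m v) = v by rewrite mulmxA XY mul1mx.
have [_ _ [P [Pidem Pcomm Pbij Pstable Punstable]]] := A_dich.
have [B PB] := linear_mx (P 0).
pose P0 := Y 0 *m B *m X 0; exists P0.
have PE t v : P t v = X t *m (P0 *m (Y t *m v)).
  rewrite /P0; have [t0|/ltW t0] := leP 0 t.
    have := Pcomm t 0 t0 (X 0 *m (Y t *m v)); rewrite !evolutionE YXv XYv => <-.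
    by rewrite PB !mulmxA.
  have := Pcomm 0 t t0 v; rewrite !evolutionE PB => e.
  by rewrite -!mulmxA -e YXv XYv.
have homog := fun k v => @euclid_normZ R n k v.
split=> t u v.
  move=> ut; have := @op_norm_le_homogeneous R _ N homog (@euclid_norm_ge0 R n)
    (@euclid_norm_eq0 R n) _ _ _ (Pstable t u ut) v.
  rewrite evolutionE PE YXv; apply => k x.
  by rewrite linearZ !evolutionE -!scalemxAr.
move=> tu; have bE x : backward_evolution (ode_evolution A) P t u (x - P u x) =
    X t *m ((1%:M - P0) *m (Y u *m x)).
  pose w := X t *m (Y u *m x).
  have -> : x - P u x = ode_evolution A u t (w - P t w).
    rewrite evolutionE !PE /w !mulmxBr !YXv XYv; congr (_ - _).
  rewrite backward_evolutionE; [|exact: Pbij|].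
    by rewrite PE /w YXv mulmxBl mul1mx mulmxBr.
  by rewrite /null_space /= linearB/= Pidem subrr.
have := @op_norm_le_homogeneous R _ N homog (@euclid_norm_ge0 R n)
    (@euclid_norm_eq0 R n) _ _ _ (Punstable t u tu) v.
rewrite bE; apply => k x.
by rewrite !bE -!scalemxAr.
Qed.

End ode_dichotomy_matrix.

(** * Persistence of the dichotomy under a small delay *)

Theorem theorem2p2 (R : realType) (n : nat) (alpha K M : R)
    (A : R -> 'M[R]_n) (alpha_gt0 : 0 < alpha) (K_gt0 : 0 < K) (M_gt0 : 0 < M)
    (A_loc : forall i j, loc_integrable (fun t => (A t i j)%:E))
    (A_dich : exp_dichotomy (@euclid_norm R n) (ode_evolution A) alpha K) :
  exists r0 : R,
    [/\ 0 < r0,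
        ell K M alpha r0 * r0 < alpha &
        forall beta : R, 0 < beta <= alpha - ell K M alpha r0 * r0 ->
        forall r : R, 0 < r <= r0 ->
        forall eta : R -> R -> 'M[R]_n,
          standing_assumptions r r0 M eta ->
          (forall t th : R, th <= - r -> eta t th = - A t) ->
          exists K' : R,
            exp_dichotomy (@sup_norm R n r) (delay_evolution (r := r) eta)
              beta K'].
Proof.
have r00 := small_delay_gt0 alpha_gt0 K_gt0 M_gt0.
have ell_lt := ell_small_delay alpha_gt0 K_gt0 M_gt0.
have m4 := window_small alpha_gt0 K_gt0 M_gt0.
have contraction := contraction_small_delay alpha_gt0 K_gt0 M_gt0.
set r0 := small_delay alpha K M in r00 ell_lt m4 contraction *.
exists r0; split=> // beta /andP[beta0 beta_le] r /andP[r_gt0 r_le] eta.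
move=> [[_ _ eta0 _ eta_bv] [eta_meas eta_int eta_sup]] etaA.
have b_locint := delay_bound_locint r_gt0 eta_bv eta_int.
have b_ge0 := delay_bound_ge0 eta r_gt0.
have b_window := delay_bound_window r_gt0 eta_bv eta_int r00 eta_sup.
have L_linear := delay_rhs_linear r_gt0 eta_bv.
have L_bound := delay_rhs_bound r_gt0 eta_bv.
have L_vlocint := delay_rhs_vlocint r_gt0 eta_bv eta_meas eta_int.
have L_cst t c : delay_rhs r eta t (fun=> c) = A t *m c.
  by rewrite delay_rhs_cst// eta0// etaA// opprK add0r.
have A_bound := coefficient_bound L_bound L_cst.
have [[X Y] /= [X_prim Y_prim YX]] :=
  fundamental_matrices r00 b_locint b_ge0 b_window m4 A_loc A_bound.
have [P0 [stable unstable]] :=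
  ode_dichotomy_matrix A_dich YX (ode_evolutionE A_loc X_prim Y_prim YX).
have ell0 : 0 < ell K M alpha r0 * r0.
  by rewrite /ell !mulr_gt0// ?expR_gt0// addr_gt0// !mulr_gt0.
have beta_lt : beta < alpha by lra.
have c0 : 0 < 3 / 4 :> R by lra.
have c1 : 3 / 4 < 1 :> R by lra.
have bounded_eq0 (w : R -> 'cV[R]_n) B : mprim w (fun t => delay_rhs r eta t w) ->
    (forall t, euclid_norm (w t) <= B) -> forall t, w t = 0.
  have le0 : 0 <= alpha - ell K M alpha r0 * r0 by lra.
  exact: (bounded_delay_solution_eq0 alpha_gt0 K_gt0 X_prim Y_prim YX stable unstable
    r_le r00 b_locint b_ge0 b_window L_linear L_bound L_vlocint L_cst A_loc
    (lexx 0) alpha_gt0 c0 c1 (contraction 0 (lexx 0) le0) erefl).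
have admissible := delay_admissible alpha_gt0 K_gt0 X_prim Y_prim YX stable unstable
    r_le r00 b_locint b_ge0 b_window L_linear L_bound L_vlocint L_cst A_loc
    (ltW beta0) beta_lt c0 c1 (contraction beta (ltW beta0) beta_le).
have [C C0 hC] := backward_part_exists r_gt0 eta_bv eta_meas eta_int r00 r_le b_window m4
  beta0 admissible.
exists (C * expR (beta * r)).
exact: (delay_dichotomy r_gt0 eta_bv eta_meas eta_int r00 b_window m4 bounded_eq0 beta0 C0 hC).
Qed.
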